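(* Let $\alpha>-1$ and let $\varphi(z)=\frac{az+b}{cz+d}$ be a linear fractional self-map of $\mathbb{D}$ with $\|\varphi\|_\infty=\sup_{z\in\mathbb{D}}|\varphi(z)|<1$, and let $\sigma(z)=\frac{\overline{a}z-\overline{c}}{-\overline{b}z+\overline{d}}$ be its Krein adjoint. For $w\in\mathbb{D}$ put $K^{(1)}_w(z)=\frac{(\alpha+2)z}{(1-\overline{w}z)^{\alpha+3}}$. Then, as operators on $A^2_\alpha$, $$D_\varphi^*\,T_{K^{(1)}_{\sigma(0)}}^*=T_{K^{(1)}_{\varphi(0)}}\,D_\sigma,$$ where the adjoints are taken with respect to the inner product of $A^2_\alpha$.
   Context: $\mathbb{D}$ is the open unit disk and $dA$ is normalized Lebesgue area measure on $\mathbb{D}$. For $\alpha>-1$, the weighted Bergman space $A^2_\alpha$ is the Hilbert space of analytic $f$ on $\mathbb{D}$ with $\|f\|_\alpha^2=(\alpha+1)\int_{\mathbb{D}}|f(z)|^2(1-|z|^2)^\alpha\,dA(z)<\infty$; its reproducing kernel is $K_w(z)=(1-\overline{w}z)^{-(\alpha+2)}$ and $K^{(1)}_w$ as defined satisfies $f'(w)=\langle f,K^{(1)}_w\rangle$. $D_\varphi f=f'\circ\varphi$, and for a bounded analytic $\psi$ on $\mathbb{D}$, $T_\psi f=\psi f$ is the multiplication (Toeplitz) operator. Note $\varphi(0)=b/d$ and $\sigma(0)=-\overline{c}/\overline{d}$. *)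

(* Defs.v *)
(* MathComp-Analysis over an abstract R : realType,
   complex numbers C := R[i] (mathcomp-real-closed). *)
From HB Require Import structures.
From mathcomp Require Import all_boot all_order all_algebra.
From mathcomp Require Import all_classical all_reals all_analysis.
From mathcomp Require Import complex.
Import Order.TTheory GRing.Theory Num.Theory.
Import numFieldNormedType.Exports.

Set Implicit Arguments.
Unset Strict Implicit.
Unset Printing Implicit Defensive.

Local Open Scope ring_scope.
Local Open Scope complex_scope.

Section Bergman.
Variable R : realType.

(* identification of R x R with the complex plane *)
Definition pt (p : R * R) : R[i] := p.1 +i* p.2.

(* the open unit disk, as a subset of R x R *)
Definition diskR : set (R * R) := [set p | p.1 ^+ 2 + p.2 ^+ 2 < 1].

(* Lebesgue area measure on R x R *)
Definition areaR := product_measure1 (@lebesgue_measure R) (@lebesgue_measure R).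

(* weight (1 - |z|^2)^alpha *)
Definition bweight (alpha : R) (p : R * R) : R :=
  powR (1 - (p.1 ^+ 2 + p.2 ^+ 2)) alpha.

(* analytic (complex differentiable) at every point of the open unit disk *)
Definition holo_disk (f : R[i] -> R[i]) : Prop :=
  forall z : R[i], `|z| < 1 -> derivable (f : (R[i])^o -> (R[i])^o) z 1.

(* complex derivative *)
Definition cderiv (f : R[i] -> R[i]) (z : R[i]) : R[i] :=
  derive (f : (R[i])^o -> (R[i])^o) z 1.

(* membership in A^2_alpha; dA = dx dy / pi is normalized area measure *)
Definition inA2 (alpha : R) (f : R[i] -> R[i]) : Prop :=
  holo_disk f /\
  (\int[areaR]_(p in diskR)
      (((complex.Re (f (pt p)) ^+ 2 + complex.Im (f (pt p)) ^+ 2)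
          * bweight alpha p)%:E) < +oo)%E.

(* inner product of A^2_alpha:
   <f,g> = (alpha+1) * \int_D f(z) conj(g(z)) (1-|z|^2)^alpha dA(z) *)
Definition ipA2 (alpha : R) (f g : R[i] -> R[i]) : R[i] :=
  ((alpha + 1) / pi)%:C *
  (Rintegral areaR diskR
     (fun p => complex.Re (f (pt p) * (g (pt p))^*) * bweight alpha p)
   +i*
   Rintegral areaR diskR
     (fun p => complex.Im (f (pt p) * (g (pt p))^*) * bweight alpha p)).

(* S is the Hilbert-space adjoint of T on A^2_alpha *)
Definition is_adjoint (alpha : R) (T S : (R[i] -> R[i]) -> (R[i] -> R[i])) : Prop :=
  forall f, inA2 alpha f ->
    [/\ inA2 alpha (T f), inA2 alpha (S f) &
        forall g, inA2 alpha g -> ipA2 alpha (T f) g = ipA2 alpha f (S g)].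

(* principal branch of u^s (s real) for Re u > 0:
   u^s = |u|^s (cos (s arg u) + i sin (s arg u)), arg u = atan (Im u / Re u) *)
Definition cpow (u : R[i]) (s : R) : R[i] :=
  let r := Num.sqrt (complex.Re u ^+ 2 + complex.Im u ^+ 2) in
  let th := atan (complex.Im u / complex.Re u) in
  (powR r s * cos (s * th)) +i* (powR r s * sin (s * th)).

(* K^{(1)}_w(z) = (alpha+2) z / (1 - conj(w) z)^(alpha+3) *)
Definition K1 (alpha : R) (w : R[i]) (z : R[i]) : R[i] :=
  ((alpha + 2)%:C * z) / cpow (1 - w^* * z) (alpha + 3).

(* multiplication (Toeplitz) operator T_psi f = psi f *)
Definition Toep (psi : R[i] -> R[i]) (f : R[i] -> R[i]) : R[i] -> R[i] :=
  fun z => psi z * f z.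

(* D_phi f = f' o phi *)
Definition Dop (phi : R[i] -> R[i]) (f : R[i] -> R[i]) : R[i] -> R[i] :=
  fun z => cderiv f (phi z).

(* linear fractional map z |-> (a z + b) / (c z + d) *)
Definition lft (a b c d : R[i]) (z : R[i]) : R[i] := (a * z + b) / (c * z + d).

(* Krein adjoint sigma(z) = (conj a z - conj c) / (- conj b z + conj d) *)
Definition krein (a b c d : R[i]) : R[i] -> R[i] :=
  lft (a^*) (- c^*) (- b^*) (d^*).

End Bergman.

(* Main.v *)
(* Write K_w(z) = (1 - conj(w) z)^(-(alpha+2)) for the reproducing kernel.  From
   (1 - conj(sigma(0)) z) (1 - conj(w) phi(z)) = (1 - phi(0) conj(w)) (1 - conj(sigma(w)) z)
   one gets T_{K1_{sigma(0)}} D_phi K_w = conj(K1_{phi(0)}(w)) K1_{sigma(w)}, and pairing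
   both sides with f gives the value at w of D_phi^* T^* f, because <f, K_w> = f(w) and
   <f, K1_w> = f'(w).

   The reproducing formulas come from power series: a function analytic in the disk has a
   Taylor expansion there (Goursat's bisection and Cauchy's formula on circles), the
   monomials are orthogonal because the area measure is rotation invariant, and Bessel's
   inequality with Fatou's lemma gives convergence of the Taylor polynomials in norm.  The
   Taylor coefficients of the kernels are read off the binomial series of (1 - z)^(-s),
   which is identified with the principal power along rays.  An operator T bounded in norm
   has an adjoint, g being sent to the series with coefficients
   <g, T z^n> / ||z^n||^2. *)
Require Import Defs.
From HB Require Import structures.
From mathcomp Require Import all_boot all_order all_algebra.
From mathcomp Require Import all_classical all_reals all_analysis.
From mathcomp Require Import complex measurable_realfun ring lra.
Import Order.TTheory GRing.Theory Num.Theory.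
Import numFieldNormedType.Exports.
Local Open Scope ring_scope.
Local Open Scope complex_scope.
Set Implicit Arguments.
Unset Strict Implicit.
Unset Printing Implicit Defensive.

(** Members of A^2_alpha are total functions on [R[i]] known only inside the disk, so an adjoint is
    determined only there and every final identity is an equality on the disk. As [is_adjoint]
    contains membership as well as the pairing, existence of the adjoints needs actual norm bounds:
    a bounded symbol for multiplication, and for D_phi the fact that phi maps into a disk of radius
    r < 1, on which f' is dominated by the norm of f. Cauchy-Schwarz is replaced by |<f,g>| <= t
    |f|^2 + |g|^2 / t for all t > 0, with t chosen at each use, and completeness by power series
    with square-summable weighted coefficients. Polar coordinates are replaced by two facts: a
    rotation is a product of shears, and |z|^2 distributes the area of the disk as pi times Lebesgue
    measure on [0, 1[. K_w is handled as the series [psum (kerc alpha w)], whose coefficients are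
    inverse to the squared norms of the monomials. Closed forms enter only when the product identity
    is raised to the power alpha + 3; the delicate point there is multiplicativity of the principal
    power, which depends on all four factors having positive real part. *)

Notation Re := complex.Re.
Notation Im := complex.Im.

(** * Modulus and complex differentiability *)

(* Below a ring operation [z^*] would parse as [Num.conj]; [z^*%C] is always [conjc]. *)
Section modulus.
Variable R : realType.
Local Notation C := R[i].
Implicit Types x y z w h l : C.

(** The norm of [R[i]] takes its values in [R[i]]; this real-valued copy makes the real order
    lemmas, [lra] and [nra] applicable. *)
Definition cn z : R := Re `|z|.

Lemma cnE z : `|z| = (cn z)%:C.
Proof. by rewrite /cn normc_def. Qed.

Lemma cn_ge0 z : 0 <= cn z.
Proof. by rewrite -lecR -cnE normr_ge0. Qed.
Hint Resolve cn_ge0 : core.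

Lemma cnM z w : cn (z * w) = cn z * cn w.
Proof. by apply: complexI; rewrite rmorphM /= -!cnE normrM. Qed.

Lemma cnD z w : cn (z + w) <= cn z + cn w.
Proof. by rewrite -lecR rmorphD /= -!cnE ler_normD. Qed.

Lemma cnN z : cn (- z) = cn z.
Proof. by rewrite /cn normrN. Qed.

Lemma cnB z w : cn (z - w) <= cn z + cn w.
Proof. by rewrite -(cnN w) cnD. Qed.

Lemma cn_distC z w : cn (z - w) = cn (w - z).
Proof. by rewrite -cnN opprB. Qed.

Lemma cn0 : cn 0 = 0.
Proof. by rewrite /cn normr0. Qed.

Lemma cn1 : cn 1 = 1.
Proof. by rewrite /cn normr1. Qed.

Lemma cnV z : cn z^-1 = (cn z)^-1.
Proof. by apply: complexI; rewrite fmorphV /= -!cnE normfV. Qed.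

Lemma cnX z n : cn (z ^+ n) = cn z ^+ n.
Proof. by elim: n => [|n IH]; rewrite ?expr0 ?cn1 // !exprS cnM IH. Qed.

Lemma cn_real (r : R) : cn r%:C = `|r|.
Proof. by rewrite /cn normc_def /= expr0n /= addr0 sqrtr_sqr. Qed.

Lemma cn_nat n : cn n%:R = n%:R.
Proof. by rewrite -(rmorph_nat (real_complex R)) cn_real normr_nat. Qed.

Lemma cn_eq0 z : (cn z == 0) = (z == 0).
Proof. by rewrite -[RHS]normr_eq0 cnE -[0 in RHS](rmorph0 (real_complex R)) (inj_eq (@complexI R)). Qed.

Lemma cn_gt0 z : (0 < cn z) = (z != 0).
Proof. by rewrite lt_def cn_ge0 andbT cn_eq0. Qed.

Lemma cn_sqr z : cn z ^+ 2 = Re z ^+ 2 + Im z ^+ 2.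
Proof. by rewrite /cn normc_def /= sqr_sqrtr // addr_ge0 ?sqr_ge0. Qed.

Lemma cn_conj z : cn z^*%C = cn z.
Proof. by rewrite /cn normcJ. Qed.

Lemma cn_mulJ z : z * z^*%C = (cn z ^+ 2)%:C.
Proof. by rewrite -sqr_normc cnE rmorphXn. Qed.

Lemma Re_le_cn z : `|Re z| <= cn z.
Proof. by rewrite -(@ler_pXn2r _ 2) ?nnegrE // cn_sqr real_normK ?num_real // lerDl sqr_ge0. Qed.

Lemma Im_le_cn z : `|Im z| <= cn z.
Proof. by rewrite -(@ler_pXn2r _ 2) ?nnegrE // cn_sqr real_normK ?num_real // lerDr sqr_ge0. Qed.

Lemma cn_le_ReIm z : cn z <= `|Re z| + `|Im z|.
Proof.
rewrite -(@ler_pXn2r _ 2) ?nnegrE ?addr_ge0 // cn_sqr sqrrD !real_normK ?num_real //.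
by rewrite addrAC lerDl mulrn_wge0 // mulr_ge0.
Qed.

Lemma cn_sum (I : Type) (s : seq I) (P : pred I) (F : I -> C) :
  cn (\sum_(i <- s | P i) F i) <= \sum_(i <- s | P i) cn (F i).
Proof.
elim/big_ind2 : _ => //; first by rewrite cn0.
by move=> x1 x2 y1 y2 h1 h2; apply: le_trans (cnD _ _) (lerD h1 h2).
Qed.

Lemma ltC_cn z (r : R) : (`|z| < r%:C) = (cn z < r).
Proof. by rewrite cnE ltcR. Qed.

Lemma norm_lt1 z : (`|z| < 1) = (cn z < 1).
Proof. exact: (ltC_cn z 1). Qed.

Lemma leC_cn z (r : R) : (`|z| <= r%:C) = (cn z <= r).
Proof. by rewrite cnE lecR. Qed.

Lemma ReD z w : Re (z + w) = Re z + Re w. Proof. by case: z w => ? ? []. Qed.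
Lemma ImD z w : Im (z + w) = Im z + Im w. Proof. by case: z w => ? ? []. Qed.
Lemma ReN z : Re (- z) = - Re z. Proof. by case: z. Qed.
Lemma ImN z : Im (- z) = - Im z. Proof. by case: z. Qed.
Lemma ReM z w : Re (z * w) = Re z * Re w - Im z * Im w. Proof. by case: z w => ? ? []. Qed.
Lemma ImM z w : Im (z * w) = Re z * Im w + Im z * Re w. Proof. by case: z w => ? ? []. Qed.
Lemma ReJ z : Re z^*%C = Re z. Proof. by case: z. Qed.
Lemma ImJ z : Im z^*%C = - Im z. Proof. by case: z. Qed.
Definition ReImE := (ReD, ImD, ReN, ImN, ReM, ImM, ReJ, ImJ).

Lemma eqC z w : Re z = Re w -> Im z = Im w -> z = w.
Proof. by case: z w => ? ? [? ?] /= -> ->. Qed.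

(** First-order expansion instead of a limit of quotients: no condition [h != 0] arises, so the
    product and chain rules are plain estimates. [cdiff_derivable] and [derivable_cdiff] relate it
    to [derivable]. *)
Definition cdiff (f : C -> C) z l := forall e : R, 0 < e ->
  exists2 dl : R, 0 < dl & forall h, cn h < dl -> cn (f (z + h) - f z - l * h) <= e * cn h.

Lemma gt0_complex (e : C) : 0 < e -> exists2 r : R, e = r%:C & 0 < r.
Proof. by case: e => a b; rewrite ltcE /= => /andP[/eqP -> ?]; exists a. Qed.

Lemma cdiff_derivable (f : C -> C) z l : cdiff f z l ->
  derivable (f : C^o -> C^o) z 1 /\ cderiv f z = l.
Proof.
move=> fl.
suff cv : (h^-1 *: (((f : C^o -> C^o) \o shift z) (h *: (1 : C^o)) - f z) @[h --> (0 : C^o)^'] --> (l : C^o))%classic.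
  split; first by apply/cvg_ex; exists l.
  by rewrite /cderiv /derive; apply/(cvg_lim _ cv); exact: norm_hausdorff.
apply/cvgrPdist_le => _ /gt0_complex[e -> e0].
have [dl d0 H] := fl _ e0.
exists dl%:C; first by rewrite /= ltcR.
move=> h; rewrite /= sub0r normrN ltC_cn => hd h0.
have Hh := H h hd.
rewrite /= leC_cn /GRing.scale /= mulr1 [h + z]addrC.
have -> : l - h^-1 * (f (z + h) - f z) = - (f (z + h) - f z - l * h) / h by field.
rewrite cnM cnN cnV ler_pdivrMr ?cn_gt0 //.
Qed.

Lemma derivable_cdiff (f : C -> C) z :
  derivable (f : C^o -> C^o) z 1 -> cdiff f z (cderiv f z).
Proof.
move=> /cvgrPdist_le df e e0.
have /df : 0 < e%:C by rewrite ltcR.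
move=> [/= _ /gt0_complex[dl -> d0] H]; exists dl => // h hd.
have [->|h0] := eqVneq h 0; first by rewrite addr0 subrr mulr0 subrr cn0 mulr0.
have := H h; rewrite /= sub0r normrN ltC_cn => /(_ hd h0).
rewrite leC_cn /GRing.scale /= mulr1 [h + z]addrC /cderiv => Hh.
set l := derive _ _ _ in Hh *.
have -> : f (z + h) - f z - l * h = - ((l - h^-1 * (f (z + h) - f z)) * h) by field.
by rewrite cnN cnM ler_wpM2r.
Qed.

Lemma cdiff_continuous f z l : cdiff f z l -> forall e : R, 0 < e ->
  exists2 dl : R, 0 < dl & forall h, cn h < dl -> cn (f (z + h) - f z) <= e.
Proof.
move=> fl e e0; have [dl d0 H] := fl 1 ltr01.
have L0 : 0 < 1 + cn l by rewrite ltr_wpDr.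
exists (Order.min dl (e / (1 + cn l))).
  by rewrite lt_min d0 divr_gt0.
move=> h; rewrite lt_min => /andP[hd he].
have -> : f (z + h) - f z = (f (z + h) - f z - l * h) + l * h by ring.
apply: le_trans (cnD _ _) _; rewrite cnM.
move: he; rewrite ltr_pdivlMr // => he.
have := H h hd; lra.
Qed.

Lemma cdiff_near f g z l (r : R) : 0 < r -> (forall h, cn h < r -> f (z + h) = g (z + h)) ->
  cdiff f z l -> cdiff g z l.
Proof.
move=> r0 fg fl e e0; have [dl d0 H] := fl e e0.
exists (Order.min dl r); first by rewrite lt_min d0.
move=> h; rewrite lt_min => /andP[hd hr].
by have := fg 0; rewrite cn0 addr0 -fg // => <- //; exact: H.
Qed.

Lemma cdiffD f g z l m : cdiff f z l -> cdiff g z m -> cdiff (fun x => f x + g x) z (l + m).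
Proof.
move=> fl gm e e0; have e2 : 0 < e / 2 by lra.
have [d1 d10 H1] := fl _ e2; have [d2 d20 H2] := gm _ e2.
exists (Order.min d1 d2); first by rewrite lt_min d10.
move=> h; rewrite lt_min => /andP[/H1 h1 /H2 h2].
have -> : f (z + h) + g (z + h) - (f z + g z) - (l + m) * h =
  (f (z + h) - f z - l * h) + (g (z + h) - g z - m * h) by ring.
apply: le_trans (cnD _ _) _; lra.
Qed.

Lemma cdiffM f g z l m : cdiff f z l -> cdiff g z m ->
  cdiff (fun x => f x * g x) z (l * g z + f z * m).
Proof.
move=> fl gm e e0.
(* The four error terms add up to at most [e1 * A * cn h]; the summand 1, together with [e1 <= 1],
   pays for the product of the two increments. *)
pose A := 1 + cn (g z) + cn (f z) + cn l.
have A0 : 0 < A by rewrite /A; have := cn_ge0 (g z); have := cn_ge0 (f z); have := cn_ge0 l; lra.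
pose e1 := Order.min 1 (e / (3 * A)).
have e10 : 0 < e1 by rewrite lt_min ltr01 divr_gt0 // mulr_gt0.
have e1A : e1 * (3 * A) <= e.
  by rewrite -ler_pdivlMr ?mulr_gt0 // ge_min lexx orbT.
have e11 : e1 <= 1 by rewrite ge_min lexx.
have [d1 d10 H1] := fl _ e10; have [d2 d20 H2] := gm _ e10.
have [d3 d30 H3] := cdiff_continuous gm e10.
exists (Order.min d1 (Order.min d2 d3)); first by rewrite !lt_min d10 d20.
move=> h; rewrite !lt_min => /and3P[/H1 h1 /H2 h2 /H3 h3].
have -> : f (z + h) * g (z + h) - f z * g z - (l * g z + f z * m) * h =
  (f (z + h) - f z - l * h) * g z + (f (z + h) - f z - l * h) * (g (z + h) - g z)
  + l * (g (z + h) - g z) * h + f z * (g (z + h) - g z - m * h) by ring.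
do 3 (apply: le_trans (cnD _ _) _; rewrite -?lerBrDr).
rewrite !cnM.
set u := cn (_ - l * h) in h1 *; set v := cn (g _ - _) in h3 *.
set w := cn (_ - m * h) in h2 *.
have u0 : 0 <= u by exact: cn_ge0.
have v0 : 0 <= v by exact: cn_ge0.
have w0 : 0 <= w by exact: cn_ge0.
clearbody u v w e1; rewrite /A in A0 e1A; clear A.
move: (cn_ge0 h) (cn_ge0 l) (cn_ge0 (f z)) (cn_ge0 (g z)).
move: (cn h) (cn l) (cn (f z)) (cn (g z)) A0 e1A h1 h2 h3 => ch cl cf cg A0 e1A h1 h2 h3 ch0 cl0 cf0 cg0.
have a1 : u * cg <= e1 * ch * cg by rewrite ler_wpM2r.
have a2 : u * v <= e1 * ch * 1 by apply: ler_pM => //; lra.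
have a3 : cl * v * ch <= cl * e1 * ch by rewrite ler_wpM2r // ler_wpM2l.
have a4 : cf * w <= cf * (e1 * ch) by rewrite ler_wpM2l.
have a5 : e1 * ch * (3 * (1 + cg + cf + cl)) <= e * ch by rewrite mulrAC ler_wpM2r.
have b1 : 0 <= e1 * ch * (1 + cg + cf + cl).
  by rewrite mulr_ge0 ?mulr_ge0 // ?ltW // addr_ge0 // !addr_ge0.
nra.
Qed.

Lemma cdiff_comp f g z l m : cdiff g z m -> cdiff f (g z) l ->
  cdiff (fun x => f (g x)) z (l * m).
Proof.
move=> gm fl e e0.
pose A := 1 + cn m + cn l.
have A0 : 0 < A by rewrite /A; have := cn_ge0 m; have := cn_ge0 l; lra.
pose e1 := Order.min 1 (e / (2 * A)).
have e10 : 0 < e1 by rewrite lt_min ltr01 divr_gt0 // mulr_gt0.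
have e1A : e1 * (2 * A) <= e.
  by rewrite -ler_pdivlMr ?mulr_gt0 // ge_min lexx orbT.
have e11 : e1 <= 1 by rewrite ge_min lexx.
have [d1 d10 H1] := fl _ e10; have [d2 d20 H2] := gm _ e10.
have d12 : 0 < d1 / 2 by lra.
have [d3 d30 H3] := cdiff_continuous gm d12.
exists (Order.min d2 d3); first by rewrite !lt_min d20.
move=> h; rewrite !lt_min => /andP[/H2 h2 /H3 h3].
pose k := g (z + h) - g z.
have kd : cn k < d1 by apply: le_lt_trans h3 _; lra.
have := H1 k kd; rewrite (_ : g z + k = g (z + h)); last by rewrite /k; ring.
move=> h1.
have -> : f (g (z + h)) - f (g z) - l * m * h =
  (f (g (z + h)) - f (g z) - l * k) + l * (g (z + h) - g z - m * h) by rewrite /k; ring.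
apply: le_trans (cnD _ _) _; rewrite cnM.
have kb : cn k <= (1 + cn m) * cn h.
  rewrite (_ : k = (g (z + h) - g z - m * h) + m * h); last by rewrite /k; ring.
  apply: le_trans (cnD _ _) _; rewrite cnM mulrDl mul1r lerD //.
  by apply: le_trans h2 _; rewrite ler_piMl.
have a1 : e1 * cn k <= e1 * ((1 + cn m) * cn h) by rewrite ler_wpM2l // ltW.
have a2 : cn l * cn (g (z + h) - g z - m * h) <= cn l * (e1 * cn h) by rewrite ler_wpM2l.
have a3 : e1 * (2 * A) * cn h <= e * cn h by rewrite ler_wpM2r.
have b1 : 0 <= e1 * cn h * A by rewrite !mulr_ge0 // ltW.
rewrite /A in a3 b1 *; nra.
Qed.

Lemma cdiff_cst (k : C) z : cdiff (fun=> k) z 0.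
Proof. by move=> e e0; exists 1 => // h _; rewrite subrr mul0r subrr cn0 mulr_ge0 // ltW. Qed.

Lemma cdiff_id z : cdiff id z 1.
Proof. by move=> e e0; exists 1 => // h _; rewrite /= mul1r addrAC addrK subrr cn0 mulr_ge0 // ltW. Qed.

Lemma cdiff_affine (a b : C) z : cdiff (fun x => a * x + b) z a.
Proof.
have := cdiffD (cdiffM (cdiff_cst a z) (cdiff_id z)) (cdiff_cst b z).
by rewrite mul0r add0r mulr1 addr0.
Qed.

Lemma cdiff_inv z : z != 0 -> cdiff GRing.inv z (- z^-1 ^+ 2).
Proof.
move=> z0 e e0; have c0 : 0 < cn z by rewrite cn_gt0.
pose d1 := Order.min (cn z / 2) (e * cn z ^+ 3 / 2).
exists d1; first by rewrite lt_min divr_gt0 // divr_gt0 // mulr_gt0 // exprn_gt0.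
move=> h; rewrite lt_min => /andP[h1 h2].
have zh2 : cn z / 2 <= cn (z + h).
  have := cnB (z + h) h; rewrite addrK; lra.
have zh0 : z + h != 0 by rewrite -cn_gt0; lra.
have -> : (z + h)^-1 - z^-1 - - z^-1 ^+ 2 * h = h * h / ((z + h) * z ^+ 2).
  by field; rewrite zh0 z0.
have -> : cn (h * h / ((z + h) * z ^+ 2)) = cn h / (cn (z + h) * cn z ^+ 2) * cn h.
  by rewrite cnM cnV !cnM -expr2; ring.
rewrite ler_wpM2r // ler_pdivrMr; last first.
  by rewrite mulr_gt0 ?exprn_gt0 ?cn_gt0.
have : e * (cn z / 2 * cn z ^+ 2) <= e * (cn (z + h) * cn z ^+ 2).
  by rewrite (ler_wpM2l (ltW e0)) // ler_wpM2r ?sqr_ge0.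
have -> : e * (cn z / 2 * cn z ^+ 2) = e * cn z ^+ 3 / 2 by field.
lra.
Qed.

End modulus.
#[global] Hint Extern 0 (is_true (@Order.le _ _ _ (cn _))) => exact: cn_ge0 : core.

(** * Power series *)

Section power_series.
Variable R : realType.
Local Notation C := R[i].
Implicit Types (a b : nat -> C) (u v : nat -> C) (z w h l : C) (r : R).

(** Convergence measured by the real modulus; the passage to filter convergence goes through real
    and imaginary parts. *)
Definition ccvg u l := forall e : R, 0 < e -> exists N, forall n, (N <= n)%N -> cn (u n - l) <= e.

Lemma ccvg_unique u l l' : ccvg u l -> ccvg u l' -> l = l'.
Proof.
move=> ul ul'; apply/eqP; rewrite -subr_eq0 -cn_eq0 eq_le cn_ge0 andbT.
apply/ler_addgt0Pr => e e0; rewrite add0r; have e2 : 0 < e / 2 by lra.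
have [N1 H1] := ul _ e2; have [N2 H2] := ul' _ e2.
have := H1 (maxn N1 N2) (leq_maxl _ _); have := H2 (maxn N1 N2) (leq_maxr _ _).
set x := u _; have -> : l - l' = - (x - l) + (x - l') by ring.
by move=> h1 h2; apply: le_trans (cnD _ _) _; rewrite cnN; lra.
Qed.

Lemma ccvg_le u l r : ccvg u l -> (forall n, cn (u n) <= r) -> cn l <= r.
Proof.
move=> ul ur; apply/ler_addgt0Pr => e e0; have [N H] := ul _ e0.
have := H N (leqnn _); have := ur N => h1 h2.
have -> : l = u N - (u N - l) by ring.
by apply: le_trans (cnB _ _) _; lra.
Qed.

Lemma ccvg_cst l : ccvg (fun=> l) l.
Proof. by move=> e e0; exists 0%N => n _; rewrite subrr cn0 ltW. Qed.

Lemma ccvgD u v l m : ccvg u l -> ccvg v m -> ccvg (fun n => u n + v n) (l + m).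
Proof.
move=> ul vm e e0; have e2 : 0 < e / 2 by lra.
have [N1 H1] := ul _ e2; have [N2 H2] := vm _ e2.
exists (maxn N1 N2) => n; rewrite geq_max => /andP[/H1 h1 /H2 h2].
rewrite (_ : u n + v n - (l + m) = (u n - l) + (v n - m)); last by ring.
by apply: le_trans (cnD _ _) _; lra.
Qed.

Lemma ccvgZ k u l : ccvg u l -> ccvg (fun n => k * u n) (k * l).
Proof.
move=> ul e e0; have k0 : 0 < 1 + cn k by have := cn_ge0 k; lra.
have [N H] := ul _ (divr_gt0 e0 k0).
exists N => n /H; rewrite -mulrBr cnM ler_pdivlMr // => hn.
by apply: le_trans hn; rewrite mulrC (ler_wpM2l (cn_ge0 _)) // lerDr.
Qed.

Lemma ccvgB u v l m : ccvg u l -> ccvg v m -> ccvg (fun n => u n - v n) (l - m).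
Proof.
move=> ul vm; have := ccvgD ul (ccvgZ (-1) vm); rewrite mulN1r.
by under eq_fun do rewrite mulN1r.
Qed.

Lemma ccvg_shift u l k : ccvg (fun n => u (n + k)%N) l <-> ccvg u l.
Proof.
split=> ul e /ul [N H].
  exists (N + k)%N => n hn; rewrite -(subnK (leq_trans (leq_addl _ _) hn)).
  by apply: H; rewrite leq_subRL ?(leq_trans (leq_addl _ _) hn) // addnC.
by exists N => n hn; apply: H; rewrite (leq_trans hn) // leq_addr.
Qed.

Lemma ccvgS u l : ccvg (fun n => u n.+1) l <-> ccvg u l.
Proof. by rewrite -(ccvg_shift u l 1); under eq_fun do rewrite -addn1. Qed.

Lemma ccvg_ReIm u l : ((fun n => Re (u n)) @ \oo --> Re l)%classic ->
  ((fun n => Im (u n)) @ \oo --> Im l)%classic -> ccvg u l.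
Proof.
move=> /cvgrPdist_le hr /cvgrPdist_le hi e e0; have e2 : 0 < e / 2 by lra.
have [N1 _ H1] := hr _ e2; have [N2 _ H2] := hi _ e2.
exists (maxn N1 N2) => n; rewrite geq_max => /andP[/H1 h1 /H2 h2].
apply: le_trans (cn_le_ReIm _) _; rewrite !ReImE -normrN opprB -[`|Im _ - _|]normrN opprB.
rewrite /= in h1 h2; lra.
Qed.

Lemma ccvg_Re u l : ccvg u l -> ((fun n => Re (u n)) @ \oo --> Re l)%classic.
Proof.
move=> ul; apply/cvgrPdist_le => e /ul[N H]; exists N => // n /H hn.
by rewrite distrC -ReN -ReD (le_trans (Re_le_cn _)).
Qed.

Lemma ccvg_Im u l : ccvg u l -> ((fun n => Im (u n)) @ \oo --> Im l)%classic.
Proof.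
move=> ul; apply/cvgrPdist_le => e /ul[N H]; exists N => // n /H hn.
by rewrite distrC -ImN -ImD (le_trans (Im_le_cn _)).
Qed.

Definition cpart a z n := \sum_(k < n) a k * z ^+ k.

(** [limn] is total, so this is a function on all of [R[i]]; it is the sum of the series where the
    partial sums converge, in particular under [growth a] and [cn z < 1]. *)
Definition psum a z : C :=
  (limn (fun n => Re (cpart a z n))) +i* (limn (fun n => Im (cpart a z n))).

(** Radius of convergence at least 1 in Abel's form: one bound per radius, without mention of
    convergence, hence easily stable under the operations on coefficients below. *)
Definition growth a := forall r, 0 < r -> r < 1 -> exists M, forall n, cn (a n) * r ^+ n <= M.

(** Comparison with the geometric series of ratio [r / s], where [s] lies halfway between [r] and
    1. *)
Lemma growth_summable a r : growth a -> 0 <= r -> r < 1 ->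
  exists B, forall n, \sum_(k < n) cn (a k) * r ^+ k <= B.
Proof.
move=> ga r0 r1; pose s := (1 + r) / 2.
have s0 : 0 < s by rewrite /s; lra.
have s1 : s < 1 by rewrite /s; lra.
have rs : r < s by rewrite /s; lra.
have [M HM] := ga s s0 s1; pose q := r / s.
have q0 : 0 <= q by rewrite divr_ge0 // ltW.
have q1 : q < 1 by rewrite ltr_pdivrMr // mul1r.
exists (M / (1 - q)) => n.
have hq : 0 < 1 - q by lra.
have step k : cn (a k) * r ^+ k <= M * q ^+ k.
  have -> : r = q * s by rewrite /q divfK // gt_eqF.
  by rewrite exprMn [q ^+ k * _]mulrC mulrA; apply: ler_wpM2r (HM k); exact: exprn_ge0.
apply: (@le_trans _ _ (\sum_(k < n) M * q ^+ k)); first by apply: ler_sum => k _; exact: step.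
rewrite -mulr_sumr ler_pdivlMr // -mulrA.
have M0 : 0 <= M by apply: le_trans (HM 0%N); rewrite expr0 mulr1.
rewrite ler_piMr // mulrC -[_ * _]opprK -mulNr opprB -subrX1 opprB gerBl; exact: exprn_ge0.
Qed.

Lemma bernoulli_le (x : R) n : 0 <= x -> n%:R * x <= (1 + x) ^+ n.
Proof.
move=> x0; suff : 1 + n%:R * x <= (1 + x) ^+ n by lra.
elim: n => [|n IH]; first by rewrite mul0r addr0 expr0.
rewrite exprS -natr1; have h : 0 <= n%:R :> R by [].
have : 0 <= n%:R * x * x by rewrite !mulr_ge0.
nra.
Qed.

(** Passing from [r] to a larger radius [s] gains the factor (s/r)^n, which beats n by Bernoulli's
    inequality. *)
Lemma growth_nat a : growth a -> growth (fun n => n%:R * a n).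
Proof.
move=> ga r r0 r1; pose s := (1 + r) / 2.
have s0 : 0 < s by rewrite /s; lra.
have s1 : s < 1 by rewrite /s; lra.
have rs : r < s by rewrite /s; lra.
have [M HM] := ga s s0 s1; pose x := s / r - 1.
have x0 : 0 < x by rewrite subr_gt0 ltr_pdivlMr // mul1r.
exists (M / x) => n; rewrite cnM cn_nat ler_pdivlMr //.
have -> : n%:R * cn (a n) * r ^+ n * x = cn (a n) * (n%:R * x * r ^+ n) by ring.
apply: le_trans (HM n); rewrite (ler_wpM2l (cn_ge0 _)) //.
have sE : s = (1 + x) * r by rewrite /x [1 + _]addrC subrK divfK // gt_eqF.
by rewrite [in leRHS]sE exprMn ler_wpM2r ?exprn_ge0 ?bernoulli_le // ltW.
Qed.

Lemma growth_shift a : growth a -> growth (fun n => a n.+1).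
Proof.
move=> ga r r0 r1; have [M HM] := ga r r0 r1.
by exists (M / r) => n; rewrite ler_pdivlMr // -mulrA -exprSr.
Qed.

Definition dcoef a n := n.+1%:R * a n.+1.

Lemma growth_dcoef a : growth a -> growth (dcoef a).
Proof. by move=> /growth_nat /growth_shift. Qed.

Lemma growth_bounded a M : (forall n, cn (a n) <= M) -> growth a.
Proof.
move=> aM r r0 r1; exists M => n; apply: le_trans (aM n).
by rewrite ler_piMr // exprn_ile1 // ltW.
Qed.

Lemma growthD a b : growth a -> growth b -> growth (fun n => a n + b n).
Proof.
move=> ga gb r r0 r1; have [M HM] := ga r r0 r1; have [N HN] := gb r r0 r1.
exists (M + N) => n; apply: le_trans (lerD (HM n) (HN n)).
by rewrite -mulrDl ler_wpM2r ?cnD // exprn_ge0 // ltW.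
Qed.

Lemma growthZ k a : growth a -> growth (fun n => k * a n).
Proof.
move=> ga r r0 r1; have [M HM] := ga r r0 r1.
by exists (cn k * M) => n; rewrite cnM -mulrA ler_wpM2l.
Qed.

Lemma growthB a b : growth a -> growth b -> growth (fun n => a n - b n).
Proof.
move=> ga /(growthZ (-1)) /(growthD ga).
by under eq_fun do rewrite mulN1r.
Qed.

Lemma cvg_real_summable (f : nat -> R) (g : nat -> R) (B : R) :
  (forall n, `|f n| <= g n) -> (forall n, \sum_(k < n) g k <= B) ->
  cvgn (fun n => \sum_(k < n) f k).
Proof.
move=> fg gB.
have -> : (fun n => \sum_(k < n) f k) = series f by apply/funext => n; rewrite /series /= big_mkord.
apply: normed_cvg; apply: (series_le_cvg _ _ fg) => //.
  by move=> n; apply: le_trans (fg n).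
apply: nondecreasing_is_cvgn.
  apply: nondecreasing_series => n _ _; exact: le_trans (fg n).
by exists B => _ [n _ <-]; rewrite /series /= big_mkord.
Qed.

Lemma ccvg_psum a z : growth a -> cn z < 1 -> ccvg (cpart a z) (psum a z).
Proof.
move=> ga z1; have [B HB] := growth_summable ga (cn_ge0 z) z1.
apply: ccvg_ReIm => /=.
  have -> : (fun n => Re (cpart a z n)) = (fun n => \sum_(k < n) Re (a k * z ^+ k)).
    by apply/funext => n; elim: n => [|n IH]; rewrite /cpart ?big_ord0 // !big_ord_recr ReD -IH.
  by apply: (@cvg_real_summable (fun k => Re (a k * z ^+ k)) (fun k => cn (a k) * cn z ^+ k) B) => // n; rewrite -cnX -cnM Re_le_cn.
have -> : (fun n => Im (cpart a z n)) = (fun n => \sum_(k < n) Im (a k * z ^+ k)).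
  by apply/funext => n; elim: n => [|n IH]; rewrite /cpart ?big_ord0 // !big_ord_recr ImD -IH.
by apply: (@cvg_real_summable (fun k => Im (a k * z ^+ k)) (fun k => cn (a k) * cn z ^+ k) B) => // n; rewrite -cnX -cnM Im_le_cn.
Qed.

Lemma psum_unique a z l : growth a -> cn z < 1 -> ccvg (cpart a z) l -> psum a z = l.
Proof. by move=> ga z1; apply: ccvg_unique; exact: ccvg_psum. Qed.

Lemma cpartD a b z n : cpart (fun n => a n + b n) z n = cpart a z n + cpart b z n.
Proof. by rewrite /cpart -big_split /=; apply: eq_bigr => k _; rewrite mulrDl. Qed.

Lemma cpartZ k a z n : cpart (fun n => k * a n) z n = k * cpart a z n.
Proof. by rewrite /cpart mulr_sumr; apply: eq_bigr => j _; rewrite mulrA. Qed.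

Lemma psumD a b z : growth a -> growth b -> cn z < 1 ->
  psum (fun n => a n + b n) z = psum a z + psum b z.
Proof.
move=> ga gb z1; apply: psum_unique => //; first exact: growthD.
rewrite (_ : cpart _ z = fun n => cpart a z n + cpart b z n); last by apply/funext => n; exact: cpartD.
by apply: ccvgD; exact: ccvg_psum.
Qed.

Lemma psumZ k a z : growth a -> cn z < 1 -> psum (fun n => k * a n) z = k * psum a z.
Proof.
move=> ga z1; apply: psum_unique => //; first exact: growthZ.
rewrite (_ : cpart _ z = fun n => k * cpart a z n); last by apply/funext => n; exact: cpartZ.
by apply: ccvgZ; exact: ccvg_psum.
Qed.

Lemma psum_rec a z : growth a -> cn z < 1 -> psum a z = a 0%N + z * psum (fun n => a n.+1) z.
Proof.
move=> ga z1; apply: psum_unique => //; apply/ccvgS.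
have -> : (fun n => cpart a z n.+1) = (fun n => a 0%N + z * cpart (fun n => a n.+1) z n).
  apply/funext => n; rewrite /cpart big_ord_recl expr0 mulr1 mulr_sumr; congr (_ + _).
  by apply: eq_bigr => k _; rewrite exprS mulrCA.
apply: ccvgD (ccvg_cst _) (ccvgZ _ _); apply: ccvg_psum => //; exact: growth_shift.
Qed.

(** Second-order remainder of the n-th power. Multiplying by [r ^+ 2] avoids the exponent n - 2, and
    n^2 is a crude substitute for n (n - 1) / 2 that survives the induction. *)
Lemma expr_taylor2 z h r n : cn z <= r -> cn (z + h) <= r ->
  cn ((z + h) ^+ n - z ^+ n - n%:R * z ^+ n.-1 * h) * r ^+ 2 <= n%:R ^+ 2 * r ^+ n * cn h ^+ 2.
Proof.
move=> zr zhr; have r0 : 0 <= r by exact: le_trans zr.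
elim: n => [|n IH]; first by rewrite !expr0 subrr !mul0r subrr cn0 mul0r expr0n !mul0r.
set E := _ - _ - _ in IH.
have -> : (z + h) ^+ n.+1 - z ^+ n.+1 - n.+1%:R * z ^+ n * h = (z + h) * E + n%:R * z ^+ n.-1 * h ^+ 2.
  rewrite /E; case: n {IH E} => [|n] /=; first by rewrite !expr0 !expr1; ring.
  by rewrite -!natr1 !exprS; ring.
have h1 : cn ((z + h) * E + n%:R * z ^+ n.-1 * h ^+ 2) <= r * cn E + n%:R * r ^+ n.-1 * cn h ^+ 2.
  apply: le_trans (cnD _ _) _; rewrite !cnM !cnX cn_nat lerD //; first by rewrite ler_wpM2r.
  by rewrite ler_wpM2r ?sqr_ge0 // ler_wpM2l // lerXn2r // nnegrE.
apply: le_trans (ler_wpM2r (sqr_ge0 r) h1) _.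
have h2 : r * (cn E * r ^+ 2) <= r * (n%:R ^+ 2 * r ^+ n * cn h ^+ 2) by rewrite ler_wpM2l.
have h3 : n%:R * r ^+ n.-1 * cn h ^+ 2 * r ^+ 2 = n%:R * r ^+ n.+1 * cn h ^+ 2.
  by case: n {IH E h1 h2} => [|n]; rewrite ?mul0r //= !exprS; ring.
rewrite mulrDl h3 -mulrA -natr1 (exprS r n) -!mulrA [leRHS]mulrA.
have X0 : 0 <= (n%:R + 1) * (r * r ^+ n * cn h ^+ 2).
  by rewrite !mulr_ge0 ?exprn_ge0 // addr_ge0.
have E2 : r * (n%:R ^+ 2 * r ^+ n * cn h ^+ 2) = n%:R ^+ 2 * (r * r ^+ n * cn h ^+ 2) by ring.
rewrite E2 in h2; rewrite -!mulrA in h2 X0 *; move: (r * (r ^+ n * _)) X0 h2 => X X0 h2.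
nra.
Qed.

Lemma cdiff_psum a z : growth a -> cn z < 1 -> cdiff (psum a) z (psum (dcoef a) z).
Proof.
move=> ga z1; pose r := (1 + cn z) / 2.
have zr : cn z < r by rewrite /r; lra.
have r0 : 0 < r by apply: le_lt_trans zr.
have r1 : r < 1 by rewrite /r; lra.
(* The two factors n match the n^2 of [expr_taylor2]. *)
have [B HB] := growth_summable (growth_nat (growth_nat ga)) (ltW r0) r1.
have B0 : 0 <= B by have := HB 0%N; rewrite big_ord0.
move=> e e0; pose K := B / r ^+ 2 + 1.
have K0 : 0 < K by rewrite ltr_wpDl // divr_ge0 // sqr_ge0.
exists (Order.min (r - cn z) (e / K)); first by rewrite lt_min subr_gt0 zr divr_gt0.
move=> h; rewrite lt_min => /andP[h1 h2].
have zhr : cn (z + h) <= r by have := cnD z h; lra.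
have zh1 : cn (z + h) < 1 by lra.
suff H : cn (psum a (z + h) - psum a z - psum (dcoef a) z * h) <= cn h ^+ 2 * (B / r ^+ 2).
  apply: le_trans H _; rewrite expr2 mulrAC ler_wpM2r //.
  rewrite ltr_pdivlMr // in h2; apply: le_trans (ltW h2).
  by rewrite (ler_wpM2l (cn_ge0 _)) // lerDl.
(* Degree at most n for [a] is paired with degree at most n - 1 for [dcoef a], so that the
   combination is a finite sum of second-order remainders. *)
have cv : ccvg (fun n => cpart a (z + h) n.+1 - cpart a z n.+1 - h * cpart (dcoef a) z n)
   (psum a (z + h) - psum a z - h * psum (dcoef a) z).
  apply: ccvgB; last by apply: ccvgZ; apply: ccvg_psum => //; exact: growth_dcoef.
  by apply: ccvgB; apply/ccvgS; exact: ccvg_psum.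
rewrite [psum (dcoef a) z * h]mulrC; apply: (ccvg_le cv) => n.
have -> : cpart a (z + h) n.+1 - cpart a z n.+1 - h * cpart (dcoef a) z n =
  \sum_(k < n.+1) a k * ((z + h) ^+ k - z ^+ k - k%:R * z ^+ k.-1 * h).
  rewrite /cpart mulr_sumr -sumrB.
  have -> : \sum_(k < n) h * (dcoef a k * z ^+ k) = \sum_(k < n.+1) a k * (k%:R * z ^+ k.-1 * h).
    rewrite [RHS]big_ord_recl !mul0r mulr0 add0r; apply: eq_bigr => k _.
    rewrite /dcoef /= /bump /= add1n; ring.
  by rewrite -sumrB; apply: eq_bigr => k _; ring.
apply: le_trans (cn_sum _ _ _) _; rewrite mulrA ler_pdivlMr ?exprn_gt0 // mulr_suml.
apply: le_trans (ler_wpM2l (sqr_ge0 _) (HB n.+1)); rewrite mulr_sumr.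
apply: ler_sum => k _; rewrite !cnM !cn_nat.
have H := ler_wpM2l (cn_ge0 (a k)) (expr_taylor2 k (ltW zr) zhr).
rewrite -[leLHS]mulrA (le_trans H) // le_eqVlt; apply/orP; left; apply/eqP; ring.
Qed.

(** Shifting the coefficients divides the sum by z away from the origin, and continuity of the
    shifted sum restores the value at 0; so the constant term vanishes at every stage. *)
Lemma psum0_coef (a : nat -> C) r : growth a -> 0 < r ->
  (forall z, cn z < r -> psum a z = 0) -> forall n, a n = 0.
Proof.
move=> ga r0 H n.
suff : growth (fun k => a (n + k)%N) /\ (forall z, cn z < Order.min r 1 -> psum (fun k => a (n + k)%N) z = 0).
  move=> [gn /(_ 0)]; rewrite cn0 lt_min r0 ltr01 => /(_ isT).
  by rewrite psum_rec ?cn0 // mul0r addr0 addn0.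
elim: n => [|n [gn IH]]; first by split => // z; rewrite lt_min => /andP[/H].
have gn1 : growth (fun k => a (n.+1 + k)%N).
  by have := growth_shift gn; under eq_fun do rewrite addnS -addSn.
split => //.
have H1 z : cn z < Order.min r 1 -> z != 0 -> psum (fun k => a (n.+1 + k)%N) z = 0.
  move=> zr z0; have z1 : cn z < 1 by move: zr; rewrite lt_min => /andP[].
  have a0 : a (n + 0)%N = 0.
    by have := IH 0; rewrite cn0 lt_min r0 ltr01 psum_rec ?cn0 // mul0r addr0; apply.
  have := IH z zr; rewrite psum_rec // a0 add0r => /eqP; rewrite mulf_eq0 (negPf z0) /=.
  by under eq_fun do rewrite addnS -addSn; move/eqP.
move=> z zr; have [->|] := eqVneq z 0; last exact: H1.
apply/eqP; rewrite -cn_eq0 eq_le cn_ge0 andbT; apply/ler_addgt0Pr => e e0; rewrite add0r.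
have z1 : cn (0 : C) < 1 by rewrite cn0.
have [d d0 Hd] := cdiff_continuous (cdiff_psum gn1 z1) e0.
pose s := Order.min (d / 2) (Order.min (r / 2) (1 / 2)).
have s0 : 0 < s by rewrite !lt_min; apply/and3P; split; lra.
have := Hd s%:C; rewrite cn_real gtr0_norm // add0r H1 ?sub0r ?cnN; first apply.
- by rewrite gt_min; apply/orP; left; lra.
- by rewrite cn_real gtr0_norm // lt_min !gt_min; apply/andP; split; lra.
- by rewrite -cn_gt0 cn_real gtr0_norm.
Qed.

Lemma psum_inj a b r : growth a -> growth b -> 0 < r ->
  (forall z, cn z < r -> cn z < 1 -> psum a z = psum b z) -> forall n, a n = b n.
Proof.
move=> ga gb r0 H n; apply/eqP; rewrite -subr_eq0; apply/eqP.
apply: (@psum0_coef (fun n => a n - b n) (Order.min r 1)); first exact: growthB.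
  by rewrite lt_min r0 ltr01.
move=> z; rewrite lt_min => /andP[zr z1].
under eq_fun do rewrite -mulN1r.
by rewrite psumD ?psumZ ?H ?mulN1r ?subrr //; exact: growthZ.
Qed.

End power_series.

(** * Integrals along curves and Taylor expansion in the disk *)

Section line_integrals.
Variable R : realType.
Local Notation C := R[i].
Local Notation mu := (@lebesgue_measure R).
Implicit Types (g : R -> C) (a b x : R).

Definition rcont g x := forall e : R, 0 < e ->
  exists2 dl : R, 0 < dl & forall y, `|y - x| < dl -> cn (g y - g x) <= e.

(** Continuity is two-sided at the endpoints too, which costs nothing: the integrands used are
    defined on the whole line. *)
Definition ccont a b g := forall x, a <= x -> x <= b -> rcont g x.

Definition cint a b g : C :=
  (\int[mu]_(x in `[a, b]) Re (g x))%R +i* (\int[mu]_(x in `[a, b]) Im (g x))%R.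

Lemma rcont_cst (k : C) x : rcont (fun=> k) x.
Proof. by move=> e e0; exists 1 => // y _; rewrite subrr cn0 ltW. Qed.

Lemma rcontD g1 g2 x : rcont g1 x -> rcont g2 x -> rcont (fun y => g1 y + g2 y) x.
Proof.
move=> c1 c2 e e0; have e2 : 0 < e / 2 by lra.
have [d1 d10 H1] := c1 _ e2; have [d2 d20 H2] := c2 _ e2.
exists (Order.min d1 d2); first by rewrite lt_min d10.
move=> y; rewrite lt_min => /andP[/H1 h1 /H2 h2].
have -> : g1 y + g2 y - (g1 x + g2 x) = (g1 y - g1 x) + (g2 y - g2 x) by ring.
by apply: le_trans (cnD _ _) _; lra.
Qed.

Lemma rcontM g1 g2 x : rcont g1 x -> rcont g2 x -> rcont (fun y => g1 y * g2 y) x.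
Proof.
move=> c1 c2 e e0.
pose A := 1 + cn (g1 x) + cn (g2 x).
have A0 : 0 < A by rewrite /A; have := cn_ge0 (g1 x); have := cn_ge0 (g2 x); lra.
pose e1 := Order.min 1 (e / A).
have e10 : 0 < e1 by rewrite lt_min ltr01 divr_gt0.
have e1A : e1 * A <= e by rewrite -ler_pdivlMr // ge_min lexx orbT.
have e11 : e1 <= 1 by rewrite ge_min lexx.
have [d1 d10 H1] := c1 _ e10; have [d2 d20 H2] := c2 _ e10.
exists (Order.min d1 d2); first by rewrite lt_min d10.
move=> y; rewrite lt_min => /andP[/H1 h1 /H2 h2].
have -> : g1 y * g2 y - g1 x * g2 x = (g1 y - g1 x) * (g2 y - g2 x)
  + (g1 y - g1 x) * g2 x + g1 x * (g2 y - g2 x) by ring.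
apply: le_trans e1A; apply: le_trans (cnD _ _) _.
have -> : e1 * A = e1 + e1 * cn (g2 x) + cn (g1 x) * e1 by rewrite /A; ring.
apply: lerD; last by rewrite cnM ler_wpM2l.
apply: le_trans (cnD _ _) _; apply: lerD; last by rewrite cnM ler_wpM2r.
rewrite cnM -[leRHS]mulr1; apply: ler_pM => //; exact: le_trans h2 e11.
Qed.

Lemma rcontB g1 g2 x : rcont g1 x -> rcont g2 x -> rcont (fun y => g1 y - g2 y) x.
Proof.
move=> c1 c2; have := rcontD c1 (rcontM (rcont_cst (-1) x) c2).
by under eq_fun do rewrite mulN1r.
Qed.

Lemma rcont_comp (f : C -> C) g x l : cdiff f (g x) l -> rcont g x -> rcont (fun y => f (g y)) x.
Proof.
move=> fl gx e e0; have [d1 d10 H1] := cdiff_continuous fl e0.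
have d12 : 0 < d1 / 2 by lra.
have [d2 d20 H2] := gx _ d12; exists d2 => // y /H2 h.
have := H1 (g y - g x); rewrite (addrC (g x)) subrK; apply; lra.
Qed.

Lemma rcont_real (f : R -> R) x : {for x, continuous f} -> rcont (fun y => (f y)%:C) x.
Proof.
move=> /cvgrPdist_le fx e e0; have [d /= d0 H] := fx _ e0.
exists d => // y yd; rewrite -rmorphB cn_real distrC; apply: H.
by rewrite /ball_ /= distrC.
Qed.

Lemma rcont_sum n (F : nat -> R -> C) x : (forall k, rcont (F k) x) ->
  rcont (fun y => \sum_(k < n) F k y) x.
Proof.
move=> H; elim: n => [|n IH].
  by under eq_fun do rewrite big_ord0; exact: rcont_cst.
by under eq_fun do rewrite big_ord_recr /=; exact: rcontD.
Qed.

Lemma rcont_Re g x : rcont g x -> {for x, continuous (fun y => Re (g y))}.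
Proof.
move=> gx; apply/cvgrPdist_le => e /gx[d d0 H]; exists d => // y yd.
by rewrite distrC -ReN -ReD (le_trans (Re_le_cn _)) // H // distrC.
Qed.

Lemma rcont_Im g x : rcont g x -> {for x, continuous (fun y => Im (g y))}.
Proof.
move=> gx; apply/cvgrPdist_le => e /gx[d d0 H]; exists d => // y yd.
by rewrite distrC -ImN -ImD (le_trans (Im_le_cn _)) // H // distrC.
Qed.

Lemma within_continuous a b (f : R -> R) :
  (forall x, a <= x -> x <= b -> {for x, continuous f}) -> ({within `[a, b], continuous f})%classic.
Proof.
move=> H; apply: continuous_in_subspaceT => x; rewrite inE /= in_itv /= => /andP[ax xb].
exact: H.
Qed.

Lemma ccont_Re a b g : ccont a b g -> ({within `[a, b], continuous (fun y => Re (g y))})%classic.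
Proof. by move=> gc; apply: within_continuous => x ax xb; apply: rcont_Re; exact: gc. Qed.

Lemma ccont_Im a b g : ccont a b g -> ({within `[a, b], continuous (fun y => Im (g y))})%classic.
Proof. by move=> gc; apply: within_continuous => x ax xb; apply: rcont_Im; exact: gc. Qed.

Lemma ccont_int_Re a b g : ccont a b g ->
  mu.-integrable `[a, b]%classic (EFin \o (fun y => Re (g y))).
Proof. by move=> gc; apply: continuous_compact_integrable; [exact: segment_compact | exact: ccont_Re]. Qed.

Lemma ccont_int_Im a b g : ccont a b g ->
  mu.-integrable `[a, b]%classic (EFin \o (fun y => Im (g y))).
Proof. by move=> gc; apply: continuous_compact_integrable; [exact: segment_compact | exact: ccont_Im]. Qed.

Lemma ccontZ a b k g : ccont a b g -> ccont a b (fun x => k * g x).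
Proof. by move=> c1 x ax xb; apply: rcontM; [exact: rcont_cst | exact: c1]. Qed.

Lemma cintD a b g1 g2 : ccont a b g1 -> ccont a b g2 ->
  cint a b (fun x => g1 x + g2 x) = cint a b g1 + cint a b g2.
Proof.
move=> c1 c2; apply: eqC; rewrite /cint ?ReImE /=.
  under eq_Rintegral do rewrite ReD; rewrite RintegralD //; exact: ccont_int_Re.
under eq_Rintegral do rewrite ImD; rewrite RintegralD //; exact: ccont_int_Im.
Qed.

Lemma cintZ a b k g : ccont a b g -> cint a b (fun x => k * g x) = k * cint a b g.
Proof.
move=> c1; have iR := ccont_int_Re c1; have iI := ccont_int_Im c1.
have I1 (r : R) : mu.-integrable `[a, b]%classic (EFin \o (fun y => r * Re (g y))).
  by rewrite (_ : _ \o _ = (fun x => r%:E * (EFin \o (fun y => Re (g y))) x)%E) //; exact: integrableZl.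
have I2 (r : R) : mu.-integrable `[a, b]%classic (EFin \o (fun y => r * Im (g y))).
  by rewrite (_ : _ \o _ = (fun x => r%:E * (EFin \o (fun y => Im (g y))) x)%E) //; exact: integrableZl.
apply: eqC; rewrite /cint ?ReImE /=.
  under eq_Rintegral do rewrite ReM; rewrite RintegralB // !RintegralZl //.
under eq_Rintegral do rewrite ImM; rewrite RintegralD // !RintegralZl //.
Qed.

Lemma cintB a b g1 g2 : ccont a b g1 -> ccont a b g2 ->
  cint a b (fun x => g1 x - g2 x) = cint a b g1 - cint a b g2.
Proof.
move=> c1 c2; rewrite -mulN1r -cintZ // -cintD //; last exact: ccontZ.
by under [in RHS]eq_fun do rewrite mulN1r.
Qed.

Lemma cint_sum a b n (F : nat -> R -> C) : (forall k, ccont a b (F k)) ->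
  cint a b (fun x => \sum_(k < n) F k x) = \sum_(k < n) cint a b (F k).
Proof.
move=> H; elim: n => [|n IH].
  rewrite big_ord0; under eq_fun do rewrite big_ord0 -[0](mul0r 0).
  rewrite cintZ ?mul0r // => x _ _; exact: rcont_cst.
rewrite big_ord_recr /= -IH -cintD //; first by under eq_fun do rewrite big_ord_recr /=.
by move=> x ax xb; apply: rcont_sum => k; exact: H.
Qed.

Lemma eq_cint a b g1 g2 : (forall x, a <= x -> x <= b -> g1 x = g2 x) -> cint a b g1 = cint a b g2.
Proof.
move=> H; apply: eqC; rewrite /cint /=; apply: eq_Rintegral => x; rewrite inE /= in_itv /= => /andP[ax xb]; by rewrite H.
Qed.

Lemma Rint_le (f : R -> R) a b (M : R) : a <= b ->
  mu.-integrable `[a, b]%classic (EFin \o f) ->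
  (forall x, a <= x -> x <= b -> `|f x| <= M) ->
  `|(\int[mu]_(x in `[a, b]) f x)%R| <= (b - a) * M.
Proof.
move=> ab fi H; apply: le_trans (le_normr_Rintegral _ fi) _ => //.
have -> : (b - a) * M = (\int[mu]_(x in `[a, b]) (cst M) x)%R.
  rewrite Rintegral_cst // -[X in fine X]/(lebesgue_measure `[a, b]%classic).
  rewrite lebesgue_measure_itv /= lte_fin lt_neqAle ab andbT mulrC.
  by case: eqVneq => [->|_] //=; rewrite subrr.
apply: le_Rintegral => //.
- by rewrite (_ : _ \o _ = (fun x => `|(EFin \o f) x|)%E) //; exact: integrable_abse.
- apply: continuous_compact_integrable; first exact: segment_compact.
  by apply: within_continuous => x _ _; exact: cst_continuous.
- by move=> x; rewrite /= in_itv /= => /andP[ax xb]; exact: H.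
Qed.

(** The factor 2 comes from bounding real and imaginary parts separately; later uses tolerate any
    constant. *)
Lemma cint_le a b g M : a <= b -> ccont a b g ->
  (forall x, a <= x -> x <= b -> cn (g x) <= M) -> cn (cint a b g) <= 2 * ((b - a) * M).
Proof.
move=> ab gc H; apply: le_trans (cn_le_ReIm _) _; rewrite mulr_natl mulr2n /cint /=.
apply: lerD; apply: Rint_le => //; [exact: ccont_int_Re | | exact: ccont_int_Im |];
 move=> x ax xb; apply: le_trans (H x ax xb); [exact: Re_le_cn | exact: Im_le_cn].
Qed.

Lemma cint_split a c b g : a <= c -> c <= b -> ccont a b g ->
  cint a b g = cint a c g + cint c b g.
Proof.
move=> ac cb gc.
have gac : ccont a c g by move=> x ax xc; apply: gc => //; exact: le_trans cb.
have gcb : ccont c b g by move=> x ax xc; apply: gc => //; exact: le_trans ax.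
suff key (f : R -> R) : mu.-integrable `[a, b]%classic (EFin \o f) ->
  mu.-integrable `[c, b]%classic (EFin \o f) ->
  (\int[mu]_(x in `[a, b]) f x)%R = (\int[mu]_(x in `[a, c]) f x)%R + (\int[mu]_(x in `[c, b]) f x)%R.
  by apply: eqC; rewrite /cint ?ReImE /=; apply: key; first [exact: ccont_int_Re | exact: ccont_int_Im].
move=> fi fi2; have := @Rintegral_itvB _ f (BLeft a) (BRight b) c fi.
rewrite !bnd_simp => /(_ ac cb) H.
rewrite Rintegral_itv_obnd_cbnd in H; first by rewrite -H addrC subrK.
by apply: integrableS fi2 => //; apply: subset_itvr; rewrite bnd_simp.
Qed.

Lemma cint_FTC (G g : R -> C) a b : a <= b -> ccont a b g ->
  (forall x, is_derive x (1 : R) (fun y => Re (G y)) (Re (g x))) ->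
  (forall x, is_derive x (1 : R) (fun y => Im (G y)) (Im (g x))) ->
  cint a b g = G b - G a.
Proof.
(* The degenerate interval is treated apart by [cint_le], since the fundamental theorem is applied
   with [a < b]. *)
rewrite le_eqVlt => /predU1P[<-|ab] gc GR GI.
  rewrite subrr; apply/eqP; rewrite -cn_eq0 eq_le cn_ge0 andbT.
  have := @cint_le _ _ g (cn (g a)) (lexx a) gc; rewrite subrr mul0r mulr0; apply.
  by move=> x ax xa; rewrite (@le_anti _ _ x a) ?ax ?xa.
have key (F f : R -> R) : ({within `[a, b], continuous f})%classic ->
    (forall x, is_derive x (1 : R) F (f x)) ->
    (\int[mu]_(x in `[a, b]) f x)%R = F b - F a.
  move=> fc Fd; rewrite /Rintegral (continuous_FTC2 (F := F)) //.
  - have Fc x : {for x, continuous F}.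
      by apply: differentiable_continuous; apply/derivable1_diffP; case: (Fd x).
    split => [x _||].
    + by case: (Fd x).
    + by apply: cvg_at_right_filter; exact: Fc.
    + by apply: cvg_at_left_filter; exact: Fc.
  - by move=> x _; rewrite derive1E; case: (Fd x).
apply: eqC; rewrite /cint !ReImE /=.
  exact: (key (fun y => Re (G y)) (fun y => Re (g y)) (ccont_Re gc) GR).
exact: (key (fun y => Im (G y)) (fun y => Im (g y)) (ccont_Im gc) GI).
Qed.

End line_integrals.

(** * Bisection for additive functions of rectangles *)

Section bisection.
Variable R : realType.
Local Notation C := R[i].

Section rectangle_function.
Variable J : R -> R -> R -> R -> C.
Variables (s1 s2 t1 t2 : R).
Hypothesis s12 : s1 <= s2.
Hypothesis t12 : t1 <= t2.
Hypothesis JD1 : forall a m b c d, s1 <= a -> a <= m -> m <= b -> b <= s2 ->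
  t1 <= c -> c <= d -> d <= t2 -> J a b c d = J a m c d + J m b c d.
Hypothesis JD2 : forall a b c m d, s1 <= a -> a <= b -> b <= s2 ->
  t1 <= c -> c <= m -> m <= d -> d <= t2 -> J a b c d = J a b c m + J a b m d.
Hypothesis Jloc : forall s t, s1 <= s -> s <= s2 -> t1 <= t -> t <= t2 ->
  forall e : R, 0 < e -> exists2 dl : R, 0 < dl & forall a b c d,
    s1 <= a -> a <= s -> s <= b -> b <= s2 -> t1 <= c -> c <= t -> t <= d -> d <= t2 ->
    b - a < dl -> d - c < dl -> cn (J a b c d) <= e * (b - a + (d - c)) ^+ 2.

(** Halves the first side, then the second, keeping each time a half that carries at least half of
    the modulus; the retained quarter therefore carries at least a quarter. *)
Let halve (q : (R * R) * (R * R)) :=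
  let: ((a, b), (c, d)) := q in
  let m := (a + b) / 2 in let n := (c + d) / 2 in
  let ab := if cn (J a b c d) <= 2 * cn (J a m c d) then (a, m) else (m, b) in
  let cd := if cn (J ab.1 ab.2 c d) <= 2 * cn (J ab.1 ab.2 c n) then (c, n) else (n, d) in
  (ab, cd).

Let half_lt (x y z : C) : x = y + z -> ~~ (cn x <= 2 * cn y) -> cn x <= 2 * cn z.
Proof. by move=> ->; rewrite -ltNge => h; have := cnD y z; lra. Qed.

Let good (q : (R * R) * (R * R)) :=
  [/\ s1 <= q.1.1, q.1.1 <= q.1.2, q.1.2 <= s2 & [/\ t1 <= q.2.1, q.2.1 <= q.2.2 & q.2.2 <= t2]].

Let area q := cn (J q.1.1 q.1.2 q.2.1 q.2.2).

Let halveP q : good q -> let q' := halve q in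
  [/\ good q', area q <= 4 * area q',
    q'.1.2 - q'.1.1 = (q.1.2 - q.1.1) / 2 /\ q'.2.2 - q'.2.1 = (q.2.2 - q.2.1) / 2,
    q.1.1 <= q'.1.1 /\ q'.1.2 <= q.1.2 & q.2.1 <= q'.2.1 /\ q'.2.2 <= q.2.2].
Proof.
case: q => [[a b] [c d]] [/= sa ab bs [tc cd dt]]; rewrite /good /area /=.
set m := (a + b) / 2; set n := (c + d) / 2.
have am : a <= m by rewrite /m; lra.
have mb : m <= b by rewrite /m; lra.
have cn' : c <= n by rewrite /n; lra.
have nd : n <= d by rewrite /n; lra.
set p := if cn (J a b c d) <= _ then _ else _.
have [p1 p2 p3 p4 p5] : [/\ s1 <= p.1, p.1 <= p.2, p.2 <= s2, cn (J a b c d) <= 2 * cn (J p.1 p.2 c d) &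
   p.2 - p.1 = (b - a) / 2 /\ (a <= p.1 /\ p.2 <= b)].
  rewrite /p; case: ifPn => /= h.
    by split => //; [lra | rewrite /m; split; lra].
  split => //; [lra | | rewrite /m; split; lra].
  by apply: half_lt h; exact: JD1.
clearbody p; case: p p1 p2 p3 p4 p5 => a' b' /= p1 p2 p3 p4 [p5 p6].
case: ifPn => /= h.
  by rewrite /n; split; [split => //; split => //; lra | lra | split; lra | | split; lra].
have {}h : cn (J a' b' c d) <= 2 * cn (J a' b' n d) by apply: half_lt h; exact: JD2.
by rewrite /n in h *; split; [split => //; split => //; lra | lra | split; lra | | split; lra].
Qed.

Let q_ n := iter n halve ((s1, s2), (t1, t2)).

Let q_good n : good (q_ n).
Proof.
elim: n => [|n IH]; first by rewrite /q_ /good /=; split; rewrite ?lexx.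
by rewrite /q_ iterS; case: (halveP IH).
Qed.

Let q_area n : cn (J s1 s2 t1 t2) <= 4 ^+ n * area (q_ n).
Proof.
elim: n => [|n IH]; first by rewrite expr0 mul1r.
apply: le_trans IH _; rewrite exprSr -mulrA ler_wpM2l ?exprn_ge0 //.
by case: (halveP (q_good n)).
Qed.

Let q_width n : (q_ n).1.2 - (q_ n).1.1 = (s2 - s1) / 2 ^+ n /\
  (q_ n).2.2 - (q_ n).2.1 = (t2 - t1) / 2 ^+ n.
Proof.
elim: n => [|n [IH1 IH2]]; first by rewrite /= expr0 !divr1.
case: (halveP (q_good n)) => _ _ [h1 h2] _ _.
by rewrite /q_ iterS h1 h2 -/(q_ n) IH1 IH2 exprSr invfM; split; ring.
Qed.

Let q_nest n k : [/\ (q_ n).1.1 <= (q_ (n + k)).1.1, (q_ (n + k)).1.2 <= (q_ n).1.2,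
  (q_ n).2.1 <= (q_ (n + k)).2.1 & (q_ (n + k)).2.2 <= (q_ n).2.2].
Proof.
elim: k => [|k [h1 h2 h3 h4]]; first by rewrite addn0.
case: (halveP (q_good (n + k))) => _ _ _ [g1 g2] [g3 g4]; rewrite addnS /q_ iterS -/(q_ _).
by split; lra.
Qed.

Let nested_point (a b : nat -> R) : (forall n, a n <= b n) ->
  (forall n k, a n <= a (n + k)%N) -> (forall n k, b (n + k)%N <= b n) ->
  exists x, forall n, a n <= x /\ x <= b n.
Proof.
move=> ab ha hb.
have aub n k : a n <= b k.
  have := ha n k; have := hb k n; have := ab (n + k)%N; rewrite [(k + n)%N]addnC; lra.
have hs : has_sup [set a n | n in [set: nat]]%classic.
  by split; [exists (a 0%N), 0%N | exists (b 0%N) => _ [n _ <-]].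
exists (sup [set a n | n in [set: nat]]%classic) => n; split.
  by apply: ub_le_sup; [case: hs | exists n].
by apply: ge_sup; [case: hs | move=> _ [k _ <-]].
Qed.

(* Goursat's bisection. *)
Lemma additive_rectangle0 : J s1 s2 t1 t2 = 0.
Proof.
have [s sP] : exists s, forall n, (q_ n).1.1 <= s /\ s <= (q_ n).1.2.
  apply: nested_point => [n|n k|n k]; first by case: (q_good n).
    by case: (q_nest n k).
  by case: (q_nest n k).
have [t tP] : exists t, forall n, (q_ n).2.1 <= t /\ t <= (q_ n).2.2.
  apply: nested_point => [n|n k|n k]; first by case: (q_good n) => _ _ _ [].
    by case: (q_nest n k).
  by case: (q_nest n k).
apply/eqP; rewrite -cn_eq0 eq_le cn_ge0 andbT; apply/ler_addgt0Pr => e e0; rewrite add0r.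
pose W := s2 - s1 + (t2 - t1).
have W0 : 0 <= W by rewrite addr_ge0 // subr_ge0.
(* The summand 1 covers a degenerate rectangle with [W = 0]. The factor 4^N lost in N quarterings
   will cancel against the square of [W / 2 ^+ N]. *)
have e1 : 0 < e / (W ^+ 2 + 1) by rewrite divr_gt0 // ltr_wpDl // sqr_ge0.
have [ss1 ss2] := sP 0%N; have [tt1 tt2] := tP 0%N.
have [dl d0 H] := Jloc ss1 ss2 tt1 tt2 e1.
have [N HN] : exists N, W / 2 ^+ N < dl.
  pose N := (Num.bound (W / dl)).
  exists N; rewrite ltr_pdivrMr ?exprn_gt0 // mulrC -ltr_pdivrMr //.
  apply: lt_le_trans (archi_boundP _) _; first by rewrite divr_ge0 // ltW.
  by rewrite -natrX ler_nat ltnW // ltn_expl.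
have [w1 w2] := q_width N; have [g1 g2 g3 [g4 g5 g6]] := q_good N.
have [h1 h2] := sP N; have [h3 h4] := tP N.
have p2 : 0 < 2 ^+ N :> R by rewrite exprn_gt0.
have wW : (q_ N).1.2 - (q_ N).1.1 + ((q_ N).2.2 - (q_ N).2.1) = W / 2 ^+ N by rewrite w1 w2 /W; ring.
have {}H := H _ _ _ _ g1 h1 h2 g3 g4 h3 h4 g6.
have l1 : (q_ N).1.2 - (q_ N).1.1 < dl by apply: le_lt_trans HN; rewrite -wW lerDl subr_ge0.
have l2 : (q_ N).2.2 - (q_ N).2.1 < dl by apply: le_lt_trans HN; rewrite -wW lerDr subr_ge0.
have {}H := H l1 l2.
apply: le_trans (q_area N) _; rewrite wW in H.
apply: le_trans (ler_wpM2l (exprn_ge0 N (ler0n _ 4)) H) _.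
have -> : 4 ^+ N * (e / (W ^+ 2 + 1) * (W / 2 ^+ N) ^+ 2) = e / (W ^+ 2 + 1) * W ^+ 2.
  have -> : 4 = 2 * 2 :> R by rewrite -natrM.
  by rewrite exprMn; field; rewrite !gt_eqF ?exprn_gt0 // ltr_wpDl // sqr_ge0.
rewrite mulrAC ler_pdivrMr; last by rewrite ltr_wpDl // sqr_ge0.
by rewrite (ler_wpM2l (ltW e0)) // lerDl.
Qed.

End rectangle_function.
End bisection.

(** * Cauchy's formula on a circle *)

Section cauchy.
Variable R : realType.
Local Notation C := R[i].

Definition cis (t : R) : C := cos t +i* sin t.

Lemma cn_cis t : cn (cis t) = 1.
Proof. by apply/eqP; rewrite -(@eqrXn2 _ 2) // cn_sqr /= cos2Dsin2 expr1n. Qed.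

Lemma cisD s t : cis (s + t) = cis s * cis t.
Proof. by apply: eqC; rewrite ?ReM ?ImM /= ?cosD ?sinD // addrC. Qed.

Lemma cis0 : cis 0 = 1.
Proof. by apply: eqC; rewrite /= ?cos0 ?sin0. Qed.

Lemma cis_neq0 t : cis t != 0.
Proof. by rewrite -cn_gt0 cn_cis. Qed.

Lemma cisX t n : cis t ^+ n = cis (n%:R * t).
Proof.
elim: n => [|n IH]; first by rewrite mul0r cis0.
by rewrite exprS IH -cisD -natr1 mulrDl mul1r addrC.
Qed.

Lemma cisN t : cis (- t) = (cis t)^-1.
Proof.
by apply: (mulfI (cis_neq0 t)); rewrite divff ?cis_neq0 // -cisD subrr cis0.
Qed.

Lemma cis_2pi : cis (2 * pi) = 1.
Proof. by apply: eqC; rewrite /= mulrC mulr_natr ?cos2pi ?sin2pi. Qed.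

Local Notation ci := (0 +i* 1 : C).

Lemma is_derive_cis_Re (k : C) (m x : R) :
  is_derive x (1 : R) (fun y => Re (k * cis (m * y))) (Re (ci * m%:C * k * cis (m * x))).
Proof.
rewrite (_ : (fun y => _) = (fun y => Re k * cos (m * y) - Im k * sin (m * y))); last first.
  by apply/funext => y; rewrite ReM.
apply: is_derive_eq; rewrite !ReImE /= /GRing.scale /=; ring.
Qed.

Lemma is_derive_cis_Im (k : C) (m x : R) :
  is_derive x (1 : R) (fun y => Im (k * cis (m * y))) (Im (ci * m%:C * k * cis (m * x))).
Proof.
rewrite (_ : (fun y => _) = (fun y => Re k * sin (m * y) + Im k * cos (m * y))); last first.
  by apply/funext => y; rewrite ImM.
apply: is_derive_eq; rewrite !ReImE /= /GRing.scale /=; ring.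
Qed.

Lemma rcont_derive (G : R -> C) x (a b : R) :
  is_derive x (1 : R) (fun y => Re (G y)) a -> is_derive x (1 : R) (fun y => Im (G y)) b ->
  rcont G x.
Proof.
move=> dR dI.
have cR : {for x, continuous (fun y => Re (G y))}.
  by apply: differentiable_continuous; apply/derivable1_diffP; case: dR.
have cI : {for x, continuous (fun y => Im (G y))}.
  by apply: differentiable_continuous; apply/derivable1_diffP; case: dI.
rewrite (_ : G = fun y => (Re (G y))%:C + ci * (Im (G y))%:C); last first.
  by apply/funext => y; apply: eqC; rewrite !ReImE /=; ring.
by apply: rcontD (rcont_real cR) (rcontM (rcont_cst _ _) (rcont_real cI)).
Qed.

Lemma rcont_cis (k : C) (m x : R) : rcont (fun y => k * cis (m * y)) x.
Proof. exact: rcont_derive (is_derive_cis_Re k m x) (is_derive_cis_Im k m x). Qed.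

Lemma cint_cis (k : C) (m a b : R) : a <= b ->
  cint a b (fun t => ci * m%:C * k * cis (m * t)) = k * cis (m * b) - k * cis (m * a).
Proof.
move=> ab; apply: (cint_FTC (G := fun t => k * cis (m * t))) => //.
- by move=> x _ _; exact: rcont_cis.
- by move=> x; exact: is_derive_cis_Re.
- by move=> x; exact: is_derive_cis_Im.
Qed.

Lemma cn_ci : cn ci = 1.
Proof. by apply/eqP; rewrite -(@eqrXn2 _ 2) // cn_sqr /= expr0n add0r. Qed.

(** Integrates the derivative of [cis]; the constant 2 is that of [cint_le]. *)
Lemma cis_lipschitz s t : cn (cis t - cis s) <= 2 * `|t - s|.
Proof.
wlog st : s t / s <= t.
  by move=> H; case/orP: (le_total s t) => /H // h; rewrite cn_distC distrC.
have := cint_cis 1 1 st; rewrite !mul1r => <-.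
rewrite ger0_norm ?subr_ge0 // -[t - s]mulr1; apply: cint_le => //.
  by move=> x _ _; under eq_fun do rewrite mulr1; exact: rcont_cis.
by move=> x _ _; rewrite !cnM cn_ci cn_real cn_cis normr1 ?cn1 ?cn_real ?normr1 !mulr1.
Qed.

Lemma expR_lipschitz (s t : R) : s <= 0 -> t <= 0 -> `|expR t - expR s| <= `|t - s|.
Proof.
wlog st : s t / s <= t.
  by move=> H s0 t0; case/orP: (le_total s t) => /H h; [exact: h | rewrite distrC [leRHS]distrC; exact: h].
move=> s0 t0; rewrite !ger0_norm ?subr_ge0 ?ler_expR //.
have -> : s = t + (s - t) by ring.
rewrite expRD; have h1 := expR_ge1Dx (s - t).
have h2 : 0 < expR t by exact: expR_gt0.
have h3 : expR t <= 1 by rewrite -expR0 ler_expR.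
have h4 : expR t * (1 + (s - t)) <= expR t * expR (s - t) by rewrite (ler_wpM2l (ltW h2)).
have : expR t * (t - s) <= 1 * (t - s) by rewrite ler_wpM2r // subr_ge0.
nra.
Qed.

Section contour.
Variables (f : C -> C) (r : R) (z : C).
Hypothesis fh : forall w, cn w < 1 -> cdiff f w (cderiv f w).
Hypothesis zr : cn z < r.
Hypothesis r1 : r < 1.

Let r0 : 0 < r. Proof. exact: le_lt_trans zr. Qed.
(* [w = psi s t] contracts the circle to [z] as [s] goes to [-oo]; in these coordinates
   [dw / (w - z) = ds + v dt], so [J g a b c d] below is the integral of [g (w) dw / (w - z)]
   along the boundary of the image of the rectangle [a, b] x [c, d]. *)
Let zeta t := r%:C * cis t.
Let u t := zeta t - z.
Let v t := ci * zeta t / u t.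
Let psi s t := z + (expR s)%:C * u t.

Let cn_zeta t : cn (zeta t) = r.
Proof. by rewrite cnM cn_real cn_cis mulr1 gtr0_norm. Qed.

Let cn_u_ge t : r - cn z <= cn (u t).
Proof. by have := cnD (u t) z; rewrite /u subrK cn_zeta; lra. Qed.

Let u_neq0 t : u t != 0.
Proof. by rewrite -cn_gt0; apply: lt_le_trans (cn_u_ge t); rewrite subr_gt0. Qed.

Let cn_u t : cn (u t) <= 2.
Proof. by apply: le_trans (cnB _ _) _; rewrite cn_zeta; have := zr; have := r1; lra. Qed.

Let V := (r - cn z)^-1.

Let V0 : 0 < V. Proof. by rewrite invr_gt0 subr_gt0. Qed.

Let cn_v t : cn (v t) <= V.
Proof.
rewrite /v cnM cnV (cnM ci (zeta t)) cn_zeta cn_ci mul1r -[leRHS]mul1r; apply: ler_pM => //.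
- exact: ltW.
- by rewrite invr_ge0.
- exact: ltW.
- by rewrite lef_pV2 ?cn_u_ge // posrE ?cn_gt0 ?u_neq0 // subr_gt0.
Qed.

Let uv t : u t * v t = ci * zeta t.
Proof. by rewrite /v; field; exact: u_neq0. Qed.

Let rcont_zeta t : rcont zeta t.
Proof.
have := rcont_cis r%:C 1 t; rewrite (_ : (fun y => _) = zeta) //.
by apply/funext => y; rewrite mul1r.
Qed.

Let rcont_u t : rcont u t.
Proof. by apply: rcontB (rcont_cst _ _); exact: rcont_zeta. Qed.

Let rcont_v t : rcont v t.
Proof.
apply: rcontM; first by apply: rcontM (rcont_cst _ _) _; exact: rcont_zeta.
exact: (rcont_comp (cdiff_inv (u_neq0 t))).
Qed.

Let cn_psi s t : s <= 0 -> cn (psi s t) < 1.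
Proof.
move=> s0; have e0 : 0 < expR s by exact: expR_gt0.
have e1 : expR s <= 1 by rewrite -expR0 ler_expR.
have -> : psi s t = (1 - expR s)%:C * z + (expR s)%:C * zeta t.
  by rewrite /psi /u rmorphB rmorph1; ring.
apply: le_lt_trans (cnD _ _) _; rewrite (cnM _ z) (cnM _ (zeta t)) !cn_real cn_zeta ger0_norm ?subr_ge0 // gtr0_norm //.
apply: le_lt_trans r1; have : (1 - expR s) * cn z <= (1 - expR s) * r.
  by rewrite ler_wpM2l ?subr_ge0 // ltW.
lra.
Qed.

Let psi_lipschitz s t s' t' : s <= 0 -> s' <= 0 ->
  cn (psi s' t' - psi s t) <= 2 * (`|s' - s| + `|t' - t|).
Proof.
move=> s0 s'0; have e1 : expR s <= 1 by rewrite -expR0 ler_expR.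
have -> : psi s' t' - psi s t = (expR s' - expR s)%:C * u t' + (expR s)%:C * (r%:C * (cis t' - cis t)).
  by rewrite /psi /u /zeta rmorphB; ring.
apply: le_trans (cnD _ _) _; rewrite !cnM !cn_real [2 * _]mulrDr; apply: lerD.
  by rewrite [leRHS]mulrC; apply: ler_pM => //; exact: expR_lipschitz.
rewrite gtr0_norm ?expR_gt0 // gtr0_norm // -[leRHS]mul1r; apply: ler_pM => //.
  by rewrite mulr_ge0 // ltW.
rewrite -[leRHS]mul1r; by apply: ler_pM; rewrite ?cis_lipschitz // ltW.
Qed.

Let rcont_psi_t s t : rcont (psi s) t.
Proof. by apply: rcontD (rcont_cst _ _) (rcontM (rcont_cst _ _) _); exact: rcont_u. Qed.

Let rcont_psi_s s t : rcont (psi ^~ t) s.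
Proof.
apply: rcontD (rcont_cst _ _) (rcontM _ (rcont_cst _ _)).
by apply: rcont_real; exact: continuous_expR.
Qed.

(** What splitting and estimating the integrals of [J] requires: continuity along both families of
    coordinate lines, up to and including [s = 0], which is the circle itself. *)
Let adm (g : C -> C) := forall s t, s <= 0 ->
  rcont (fun t => g (psi s t)) t /\ rcont (fun s => g (psi s t)) s.

Let adm_cdiff (g g' : C -> C) : (forall w, cn w < 1 -> cdiff g w (g' w)) -> adm g.
Proof.
move=> gg s t s0; have gd := gg _ (cn_psi t s0).
by split; [exact: (rcont_comp gd) (rcont_psi_t s t) | exact: (@rcont_comp _ g (psi ^~ t) s _ gd (rcont_psi_s s t))].
Qed.

Let J (g : C -> C) a b c d :=
  cint c d (fun t => (g (psi b t) - g (psi a t)) * v t) - cint a b (fun s => g (psi s d) - g (psi s c)).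

Let cc1 g a b c d : adm g -> a <= 0 -> b <= 0 ->
  ccont c d (fun t => (g (psi b t) - g (psi a t)) * v t).
Proof.
move=> gg a0 b0 t _ _; apply: rcontM (rcont_v t).
by apply: rcontB; [have [] := gg b t b0 | have [] := gg a t a0].
Qed.

Let cc2 g a b c d : adm g -> b <= 0 -> ccont a b (fun s => g (psi s d) - g (psi s c)).
Proof.
move=> gg b0 s _ sb; have s0 : s <= 0 := le_trans sb b0.
by apply: rcontB; [have [] := gg s d s0 | have [] := gg s c s0].
Qed.

Let JD g h a b c d : adm g -> adm h -> a <= 0 -> b <= 0 ->
  J (fun w => g w + h w) a b c d = J g a b c d + J h a b c d.
Proof.
move=> gg hh a0 b0; rewrite /J.
have -> : cint c d (fun t => (g (psi b t) + h (psi b t) - (g (psi a t) + h (psi a t))) * v t) =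
   cint c d (fun t => (g (psi b t) - g (psi a t)) * v t) + cint c d (fun t => (h (psi b t) - h (psi a t)) * v t).
  rewrite -cintD; [by apply: eq_cint => t _ _; ring | exact: cc1 | exact: cc1].
have -> : cint a b (fun s => g (psi s d) + h (psi s d) - (g (psi s c) + h (psi s c))) =
   cint a b (fun s => g (psi s d) - g (psi s c)) + cint a b (fun s => h (psi s d) - h (psi s c)).
  rewrite -cintD; [by apply: eq_cint => t _ _; ring | exact: cc2 | exact: cc2].
by rewrite opprD addrACA.
Qed.

(** Both integrals equal B (exp b - exp a) (u d - u c): [u * v] is the derivative of [u], the
    exponential is its own primitive, and [A] drops out of the differences. *)
Let J_affine (A B : C) a b c d : a <= b -> b <= 0 -> c <= d ->
  J (fun w => A + B * (w - z)) a b c d = 0.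
Proof.
move=> ab b0 cd; rewrite /J.
have -> : cint c d (fun t => (A + B * (psi b t - z) - (A + B * (psi a t - z))) * v t) =
   B * (expR b - expR a)%:C * (u d - u c).
  transitivity (cint c d (fun t => ci * 1%:C * (B * (expR b - expR a)%:C * r%:C) * cis (1 * t))).
    apply: eq_cint => t _ _; rewrite /psi.
    transitivity (B * (expR b - expR a)%:C * (u t * v t)); first by rewrite rmorphB; ring.
    by rewrite uv /zeta mul1r rmorph1; ring.
  by rewrite cint_cis // !mul1r /u /zeta; ring.
have -> : cint a b (fun s => A + B * (psi s d - z) - (A + B * (psi s c - z))) =
   B * (expR b - expR a)%:C * (u d - u c).
  transitivity (cint a b (fun s => B * (u d - u c) * (expR s)%:C)).
    by apply: eq_cint => s _ _; rewrite /psi; ring.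
  rewrite cintZ; last by move=> x _ _; apply: rcont_real; exact: continuous_expR.
  have -> : cint a b (fun x => (expR x)%:C) = (expR b)%:C - (expR a)%:C.
    apply: (cint_FTC (G := fun x => (expR x)%:C)) => //.
      by move=> x _ _; apply: rcont_real; exact: continuous_expR.
    by move=> x /=; exact: is_derive_cst.
  by rewrite rmorphB; ring.
by rewrite subrr.
Qed.

(** Opposite sides are paired, whence 2M; [V] bounds [v], and the other factor 2 is that of
    [cint_le]. *)
Let J_le g a b c d M : adm g -> a <= b -> b <= 0 -> c <= d ->
  (forall s t, a <= s -> s <= b -> c <= t -> t <= d -> cn (g (psi s t)) <= M) ->
  cn (J g a b c d) <= 4 * (V + 1) * M * (b - a + (d - c)).
Proof.
move=> gg ab b0 cd H; have a0 := le_trans ab b0.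
have M0 : 0 <= M by apply: le_trans (H a c _ _ _ _).
apply: le_trans (cnB _ _) _.
have h1 : cn (cint c d (fun t => (g (psi b t) - g (psi a t)) * v t)) <= 2 * ((d - c) * (2 * M * V)).
  apply: cint_le => //; first exact: cc1.
  move=> t ct td; rewrite cnM; apply: ler_pM (cn_ge0 _) (cn_ge0 _) _ (cn_v t).
  apply: le_trans (cnB _ _) _; rewrite mulr_natl mulr2n lerD // H //.
have h2 : cn (cint a b (fun s => g (psi s d) - g (psi s c))) <= 2 * ((b - a) * (2 * M)).
  apply: cint_le => //; first exact: cc2.
  move=> t ct td; apply: le_trans (cnB _ _) _; rewrite mulr_natl mulr2n lerD // H //.
apply: le_trans (lerD h1 h2) _.
have p1 : 0 <= M * (d - c) by rewrite mulr_ge0 // subr_ge0.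
have p2 : 0 <= M * (b - a) * V by rewrite !mulr_ge0 // ?subr_ge0 // ltW.
nra.
Qed.

(** Near a point [f] is affine up to an error small compared with the distance. The affine part
    contributes nothing, and the error times the perimeter is of second order in the size, as the
    bisection demands. *)
Let J0 s t : s <= 0 -> 0 <= t -> J f s 0 0 t = 0.
Proof.
move=> s0 t0; have ff : adm f by apply: adm_cdiff fh.
apply: additive_rectangle0 => //.
- move=> a m b c d sa am mb b0 tc cd dt; rewrite /J.
  have m0 : m <= 0 := le_trans mb b0; have a0 : a <= 0 := le_trans am m0.
  rewrite (cint_split am mb); last exact: cc2.
  have -> : cint c d (fun t => (f (psi b t) - f (psi a t)) * v t) =
    cint c d (fun t => (f (psi m t) - f (psi a t)) * v t) + cint c d (fun t => (f (psi b t) - f (psi m t)) * v t).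
    rewrite -cintD; [by apply: eq_cint => x _ _; ring | exact: cc1 | exact: cc1].
  by rewrite opprD addrACA.
- move=> a b c m d sa ab b0 tc cm md dt; rewrite /J.
  have a0 : a <= 0 := le_trans ab b0.
  rewrite (cint_split cm md); last exact: cc1.
  have -> : cint a b (fun s => f (psi s d) - f (psi s c)) =
    cint a b (fun s => f (psi s m) - f (psi s c)) + cint a b (fun s => f (psi s d) - f (psi s m)).
    rewrite -cintD; [by apply: eq_cint => x _ _; ring | exact: cc2 | exact: cc2].
  by rewrite opprD addrACA.
move=> s' t' ss' s'0 tt' t't e e0.
pose p := psi s' t'; have p1 : cn p < 1 by exact: cn_psi.
(* The constant of [J_le] times the Lipschitz constant 2 of [psi]. *)
set K := 4 * (V + 1) * 2.
have K0 : 0 < K by rewrite /K; have := V0; lra.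
have [dl d0 H] := fh p1 (divr_gt0 e0 K0).
(* With sides below [dl / 4], the Lipschitz constant 2 keeps the image of the rectangle within [dl]
   of [p]. *)
exists (dl / 4); first by rewrite divr_gt0.
move=> a b c d sa as' s'b b0 tc ct' t'd dt bad dcd.
have ab := le_trans as' s'b; have cd := le_trans ct' t'd.
pose l := cderiv f p; pose rho w := f w - f p - l * (w - p).
have rr : adm rho.
  apply: (@adm_cdiff _ (fun w => cderiv f w + (- l))) => w w1.
  have -> : rho = fun w => f w + (- l * w + (l * p - f p)) by apply/funext => w'; rewrite /rho; ring.
  by apply: cdiffD; [exact: fh | exact: cdiff_affine].
have aa : adm (fun w => (f p + l * (z - p)) + l * (w - z)).
  apply: (@adm_cdiff _ (fun w => l)) => w w1.
  have -> : (fun w => (f p + l * (z - p)) + l * (w - z)) = fun w => l * w + (f p - l * p).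
    by apply/funext => w'; ring.
  exact: cdiff_affine.
have -> : J f a b c d = J (fun w => rho w + ((f p + l * (z - p)) + l * (w - z))) a b c d.
  have E (x y k w0 p0 z0 : C) : x = x - y - k * (w0 - p0) + (y + k * (z0 - p0) + k * (w0 - z0)) by ring.
  have fE : f = fun w => rho w + (f p + l * (z - p) + l * (w - z)) by apply/funext => w; exact: E.
  exact: (congr1 (fun g => J g a b c d) fE).
rewrite JD //; last exact: le_trans ab b0.
rewrite J_affine // addr0.
set D := b - a + (d - c).
have D0 : 0 <= D by rewrite /D; lra.
have -> : e * D ^+ 2 = 4 * (V + 1) * (e / K * (2 * D)) * D.
  by rewrite /K; field; rewrite gt_eqF //; have := V0; lra.
apply: J_le => // s'' t'' as'' s''b ct'' t''d.
have s''0 : s'' <= 0 := le_trans s''b b0.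
have hl : cn (psi s'' t'' - p) <= 2 * D.
  apply: le_trans (psi_lipschitz _ _ s'0 s''0) _; rewrite ler_wpM2l // /D lerD // ler_norml; lra.
have := H (psi s'' t'' - p); rewrite (addrC p) subrK -/l -/(rho _).
have hd : cn (psi s'' t'' - p) < dl by apply: le_lt_trans hl _; rewrite /D; lra.
move=> /(_ hd) h; apply: le_trans h _; rewrite ler_wpM2l // ltW // divr_gt0 //.
Qed.

(** The integral of dw / (w - z) is left unevaluated on the right; it is found later by expanding
    the constant 1. In the rectangle [ln m, 0] x [0, 2 pi] the sides t = 0 and t = 2 pi cancel by
    periodicity, and on the side s = ln m the values of [f] are close to [f z]. *)
Lemma cauchy_circle :
  cint 0 (2 * pi) (fun t => f (r%:C * cis t) * (ci * (r%:C * cis t) / (r%:C * cis t - z))) =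
  f z * cint 0 (2 * pi) (fun t => ci * (r%:C * cis t) / (r%:C * cis t - z)).
Proof.
suff : cint 0 (2 * pi) (fun t => f (zeta t) * v t) = f z * cint 0 (2 * pi) v by [].
have p0 : 0 <= 2 * pi :> R by rewrite mulr_ge0 // pi_ge0.
have ff : adm f by apply: adm_cdiff fh.
have psi0 t : psi 0 t = zeta t by rewrite /psi expR0 /u mul1r addrC subrK.
have u2 : u (2 * pi) = u 0 by rewrite /u /zeta cis_2pi cis0.
have cf : ccont 0 (2 * pi) (fun t => f (zeta t) * v t).
  move=> t _ _; apply: rcontM (rcont_v t).
  by have [] := ff 0 t (lexx 0); under eq_fun do rewrite psi0.
have cv : ccont 0 (2 * pi) v by move=> t _ _; exact: rcont_v.
apply/eqP; rewrite -subr_eq0 -cintZ // -cintB //; last exact: ccontZ.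
rewrite -cn_eq0 eq_le cn_ge0 andbT; apply/ler_addgt0Pr => e e0; rewrite add0r.
have z1 : cn z < 1 by exact: lt_trans zr r1.
pose K := 2 * (2 * pi * V) : R.
have K0 : 0 < K by rewrite !mulr_gt0 // pi_gt0.
have [dl d0 H] := cdiff_continuous (fh z1) (divr_gt0 e0 K0).
(* [psi (ln m) t] is z + m u(t) with [cn (u t) <= 2], so [m <= dl / 4] keeps it within [dl] of [z],
   while [m <= 1] gives [ln m <= 0]. *)
pose m := Order.min 1 (dl / 4).
have m0 : 0 < m by rewrite lt_min ltr01 divr_gt0.
have s0 : ln m <= 0 by rewrite ln_le0 // ge_min lexx.
have := J0 s0 p0; rewrite /J.
have -> : cint (ln m) 0 (fun s => f (psi s (2 * pi)) - f (psi s 0)) = 0.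
  rewrite (@eq_cint _ _ _ _ (fun=> 0 * 0)); last by move=> x _ _; rewrite /psi u2 subrr mul0r.
  by rewrite cintZ ?mul0r // => x _ _; exact: rcont_cst.
rewrite subr0 => J00.
have -> : cint 0 (2 * pi) (fun t => f (zeta t) * v t - f z * v t) =
  cint 0 (2 * pi) (fun t => (f (psi 0 t) - f (psi (ln m) t)) * v t) +
  cint 0 (2 * pi) (fun t => (f (psi (ln m) t) - f z) * v t).
  rewrite -cintD; first by apply: eq_cint => t _ _; rewrite psi0; ring.
    exact: cc1.
  move=> t _ _; apply: rcontM (rcont_v t); apply: rcontB (rcont_cst _ _).
  by have [] := ff (ln m) t s0.
rewrite J00 add0r.
have -> : e = 2 * ((2 * pi - 0) * (e / K * V)).
  transitivity (e / K * K); first by rewrite divfK // gt_eqF.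
  by move: (e / K) => x; rewrite /K subr0; ring.
apply: cint_le => //.
  move=> t _ _; apply: rcontM (rcont_v t); apply: rcontB (rcont_cst _ _).
  by have [] := ff (ln m) t s0.
move=> t _ _; rewrite cnM; apply: ler_pM => //; apply: H.
rewrite cnM cn_real gtr0_norm ?expR_gt0 // lnK ?posrE //.
have : m * cn (u t) <= dl / 4 * 2 by apply: ler_pM => //; [exact: ltW | rewrite ge_min lexx orbT].
lra.
Qed.

End contour.
End cauchy.

(** * From Cauchy integrals to power series *)

Section taylor.
Variable R : realType.
Local Notation C := R[i].
Local Notation ci := (0 +i* 1 : C).

Lemma cn_dist (x y : C) : `|cn x - cn y| <= cn (x - y).
Proof.
have h1 := cnD (x - y) y; have h2 := cnD (y - x) x.
by rewrite subrK in h1; rewrite subrK (cn_distC y x) in h2; rewrite ler_norml; lra.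
Qed.

Lemma ccont_bounded a b (g : R -> C) : a <= b -> ccont a b g ->
  exists M, forall t, a <= t -> t <= b -> cn (g t) <= M.
Proof.
move=> ab gc.
have [|c _ H] := @EVT_max _ (fun t => cn (g t)) _ _ ab.
  apply: within_continuous => x ax xb; apply/cvgrPdist_le => e /(gc x ax xb)[d d0 H].
  by exists d => // y yd; apply: le_trans (cn_dist _ _) _; rewrite cn_distC H // distrC.
by exists (cn (g c)) => t at_ tb; apply: H; rewrite in_itv /= at_ tb.
Qed.

Lemma ccvg_geom (q : C) (u : nat -> C) (M : R) : cn q < 1 -> (forall n, cn (u n) <= M) ->
  ccvg (fun n => q ^+ n * u n) 0.
Proof.
move=> q1 uM e e0.
have M0 : 0 <= M by apply: le_trans (uM 0%N).
have : (geometric M (cn q) @ \oo --> 0)%classic by apply: cvg_geometric; rewrite ger0_norm.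
move=> /cvgrPdist_le /(_ e e0) [N _ H]; exists N => n /H; rewrite /= sub0r normrN subr0.
rewrite ger0_norm ?mulr_ge0 ?exprn_ge0 // => h; apply: le_trans h.
by rewrite cnM cnX mulrC ler_wpM2r ?exprn_ge0.
Qed.

(** Fourier coefficient on the circle of radius [r]: for analytic [F], the Taylor coefficient times
    r^k. Since this power is not divided out, the coefficients stay bounded in [k]. *)
Definition fcoef (r : R) (F : C -> C) k : C :=
  cint 0 (2 * pi) (fun t => F (r%:C * cis t) * cis (- (k%:R * t))) / (2 * pi)%:C.

Section circle.
Variables (r : R) (z : C).
Hypothesis zr : cn z < r.
Let r0 : 0 < r. Proof. exact: le_lt_trans zr. Qed.
Let zeta t := r%:C * cis t.

Let pi20 : 0 <= 2 * pi :> R. Proof. by rewrite mulr_ge0 // pi_ge0. Qed.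
Let pi2n0 : (2 * pi)%:C != 0 :> C.
Proof. by rewrite -cn_gt0 cn_real gtr0_norm mulr_gt0 // pi_gt0. Qed.

Let rcont_cisN n (t : R) : rcont (fun t => cis (- (n%:R * t))) t.
Proof.
have := rcont_cis 1 (- n%:R) t; rewrite (_ : (fun y => 1 * _) = (fun t => cis (- (n%:R * t)))) //.
by apply/funext => y; rewrite mul1r mulNr.
Qed.

Let zeta_neq0 t : zeta t != 0.
Proof. by rewrite mulf_neq0 ?cis_neq0 // -cn_gt0 cn_real gtr0_norm. Qed.

Let cn_zeta t : cn (zeta t) = r.
Proof. by rewrite cnM cn_real cn_cis mulr1 gtr0_norm. Qed.

Let cn_u t : r - cn z <= cn (zeta t - z).
Proof. by have := cnD (zeta t - z) z; rewrite subrK cn_zeta; lra. Qed.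

Let u_neq0 t : zeta t - z != 0.
Proof. by rewrite -cn_gt0; apply: lt_le_trans (cn_u t); rewrite subr_gt0. Qed.

Let v t := ci * zeta t / (zeta t - z).

Let rcont_v t : rcont v t.
Proof.
have rz : rcont zeta t.
  have := rcont_cis r%:C 1 t; rewrite (_ : (fun y => _) = zeta) //.
  by apply/funext => y; rewrite mul1r.
apply: rcontM; first exact: rcontM (rcont_cst _ _) rz.
by apply: (@rcont_comp _ GRing.inv (fun t => zeta t - z) t _ (cdiff_inv (u_neq0 t))); exact: rcontB rz (rcont_cst _ _).
Qed.

(** A finite geometric sum with exact remainder, so that only finite sums are exchanged with the
    integral. *)
Let v_geom t n : v t = ci * (\sum_(k < n) (z / r%:C) ^+ k * cis (- (k%:R * t))) +
  (z / r%:C) ^+ n * (cis (- (n%:R * t)) * v t).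
Proof.
have rn0 : r%:C != 0 :> C by rewrite -cn_gt0 cn_real gtr0_norm.
have E k : (z / r%:C) ^+ k * cis (- (k%:R * t)) = (z / zeta t) ^+ k.
  by rewrite cisN -cisX -!exprVn -exprMn /zeta invfM mulrA.
rewrite mulrA E; under eq_bigr do rewrite E.
have H := subrX1 (z / zeta t) n.
set q := z / zeta t in H *; set S := \sum_(i < n) _ in H *.
have zE : z = q * zeta t by rewrite /q divfK ?zeta_neq0.
have uE : zeta t - z = (1 - q) * zeta t by rewrite mulrBl mul1r -zE.
have q1 : 1 - q != 0 by apply: contra_neq (u_neq0 t) => h; rewrite uE h mul0r.
have vE : v t = ci / (1 - q) by rewrite /v uE invfM -mulrA [zeta t * _]mulrCA divff // mulr1.
have qn : q ^+ n = 1 + (q - 1) * S by rewrite -H addrC subrK.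
by rewrite vE qn; field.
Qed.

(** Continuity on the circle is enough here; the lemma is applied both to [f] and to the constant
    1. *)
Lemma fcoef_ccvg (F : C -> C) : ccont 0 (2 * pi) (fun t => F (r%:C * cis t)) ->
  ccvg (fun n => \sum_(k < n) fcoef r F k * (z / r%:C) ^+ k)
   (cint 0 (2 * pi) (fun t => F (r%:C * cis t) * (ci * (r%:C * cis t) / (r%:C * cis t - z))) / (ci * (2 * pi)%:C)).
Proof.
move=> Fc; rewrite -/(cint 0 (2 * pi) (fun t => F (zeta t) * v t)).
pose E n := cint 0 (2 * pi) (fun t => F (zeta t) * cis (- (n%:R * t)) * v t).
set I := cint _ _ _.
have cF k : ccont 0 (2 * pi) (fun t => F (zeta t) * cis (- (k%:R * t))).
  by move=> t t0 t1; apply: rcontM; [exact: Fc | exact: rcont_cisN].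
have cE k : ccont 0 (2 * pi) (fun t => F (zeta t) * cis (- (k%:R * t)) * v t).
  by move=> t t0 t1; apply: rcontM; [exact: cF | exact: rcont_v].
have cv : ccont 0 (2 * pi) (fun t => F (zeta t) * v t).
  by move=> t t0 t1; apply: rcontM; [exact: Fc | exact: rcont_v].
have IE n : I = ci * (2 * pi)%:C * (\sum_(k < n) fcoef r F k * (z / r%:C) ^+ k) + (z / r%:C) ^+ n * E n.
  transitivity (cint 0 (2 * pi) (fun t =>
     \sum_(k < n) (ci * (z / r%:C) ^+ k) * (F (zeta t) * cis (- (k%:R * t))) +
     (z / r%:C) ^+ n * (F (zeta t) * cis (- (n%:R * t)) * v t))).
    apply: eq_cint => t _ _; transitivity (F (zeta t) * (ci * (\sum_(k < n) (z / r%:C) ^+ k * cis (- (k%:R * t))) +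
      (z / r%:C) ^+ n * (cis (- (n%:R * t)) * v t))); first by congr (_ * _); exact: v_geom.
    rewrite [LHS]mulrDr; congr (_ + _); last by ring.
    by rewrite !mulr_sumr; apply: eq_bigr => k _; ring.
  rewrite cintD; last by apply: ccontZ.
    have := @cint_sum _ 0 (2 * pi) n (fun k t => ci * (z / r%:C) ^+ k * (F (zeta t) * cis (- (k%:R * t)))).
    move=> ->; last by move=> k; exact: ccontZ.
    rewrite [X in _ + X](cintZ ((z / r%:C) ^+ n) (cE n)); congr (_ + _); rewrite mulr_sumr; apply: eq_bigr => k _; rewrite cintZ // /fcoef -/zeta.
    rewrite -/zeta; have P0 := pi2n0; move: (cint _ _ _) ((2 * pi)%:C) P0 => X P P0.
    by move: (z / r%:C) => q; field.
  move=> t t0 t1; apply: (@rcont_sum _ n (fun k t => ci * (z / r%:C) ^+ k * (F (zeta t) * cis (- (k%:R * t))))) => k.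
  by apply: ccontZ t0 t1.
have [M HM] := ccont_bounded pi20 cv.
have EM n : cn (E n) <= 2 * ((2 * pi - 0) * M).
  apply: cint_le => // t t0 t1; rewrite cnM cnM cn_cis mulr1 -cnM; exact: HM.
have q1 : cn (z / r%:C) < 1 by rewrite cnM cnV cn_real gtr0_norm // ltr_pdivrMr // mul1r.
have ci0 : ci != 0 by rewrite -cn_gt0 cn_ci.
have K := ccvgZ (ci * (2 * pi)%:C)^-1 (ccvgB (ccvg_cst I) (ccvg_geom q1 EM)).
suff wE : (fun n => \sum_(k < n) fcoef r F k * (z / r%:C) ^+ k) =
    (fun n => (ci * (2 * pi)%:C)^-1 * (I - (z / r%:C) ^+ n * E n)).
  by rewrite wE [I / _]mulrC -{2}[I]subr0.
apply/funext => n; rewrite {1}(IE n) addrK mulKf //.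
by rewrite mulf_neq0.
Qed.

Lemma fcoef_cst1 k : fcoef r (fun=> 1) k = (k == 0%N)%:R.
Proof.
rewrite /fcoef; case: k => [|k] /=.
  have -> : cint 0 (2 * pi) (fun t => 1 * cis (- (0%:R * t)) : C) = (2 * pi)%:C; last by rewrite divff.
  rewrite (@eq_cint _ _ _ _ (fun=> 1%:C)); last by move=> x _ _; rewrite mul1r mul0r oppr0 cis0.
  apply: eqC; rewrite /cint /= Rintegral_cst //; last by rewrite mul0r.
  rewrite mul1r -[X in fine X]/(lebesgue_measure `[0, 2 * pi]%classic).
  rewrite lebesgue_measure_itv /= lte_fin mulr_gt0 ?pi_gt0 //= oppr0 addr0 //.
have k0 : k.+1%:R != 0 :> C by rewrite pnatr_eq0.
(* The constant in front of [cis] takes the shape integrated by [cint_cis], with frequency -(k+1);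
   the two boundary values then agree by periodicity. *)
have -> : cint 0 (2 * pi) (fun t => 1 * cis (- (k.+1%:R * t)) : C) =
  cint 0 (2 * pi) (fun t => ci * (- k.+1%:R)%:C * (ci / k.+1%:R) * cis (- k.+1%:R * t)).
  apply: eq_cint => t _ _; rewrite mulNr; congr (_ * _); rewrite rmorphN rmorph_nat.
  have cici : ci * ci = - 1 by apply: eqC; rewrite !ReImE /=; ring.
  transitivity (- (ci * ci)); first by rewrite cici opprK.
  by field.
by rewrite cint_cis // -mulrBr mulr0 cis0 mulNr cisN -cisX cis_2pi expr1n invr1 subrr mulr0 mul0r.
Qed.

End circle.

Lemma fcoef_bounded (r : R) (F : C -> C) : ccont 0 (2 * pi) (fun t => F (r%:C * cis t)) ->
  exists M, forall k, cn (fcoef r F k) <= M.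
Proof.
move=> Fc; have p0 : 0 <= 2 * pi :> R by rewrite mulr_ge0 // pi_ge0.
have [M HM] := ccont_bounded p0 Fc.
exists (2 * ((2 * pi - 0) * M) / (2 * pi)) => k.
rewrite /fcoef cnM cnV cn_real ger0_norm // ler_wpM2r ?invr_ge0 //.
apply: cint_le => //.
  move=> t t0 t1; apply: rcontM; first exact: Fc.
  have := rcont_cis 1 (- k%:R) t; rewrite (_ : (fun y => 1 * _) = (fun t => cis (- (k%:R * t)))) //.
  by apply/funext => y; rewrite mul1r mulNr.
by move=> t t0 t1; rewrite cnM cn_cis mulr1 HM.
Qed.

Section disk.
Variable f : C -> C.
Hypothesis fh : forall w, cn w < 1 -> cdiff f w (cderiv f w).

Let fc (r : R) : 0 < r -> r < 1 -> ccont 0 (2 * pi) (fun t => f (r%:C * cis t)).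
Proof.
move=> r0 r1 t _ _; have h : cn (r%:C * cis t) < 1 by rewrite cnM cn_real cn_cis mulr1 gtr0_norm.
apply: (@rcont_comp _ f (fun t => r%:C * cis t) t _ (fh h)).
have := rcont_cis r%:C 1 t; rewrite (_ : (fun y => _ * cis (1 * y)) = fun t => r%:C * cis t) //.
by apply/funext => y; rewrite mul1r.
Qed.

Let taylor_circle r z : 0 < r -> r < 1 -> cn z < r ->
  ccvg (fun n => \sum_(k < n) fcoef r f k * (z / r%:C) ^+ k) (f z).
Proof.
move=> r0 r1 zr.
have cauchy := cauchy_circle fh zr r1.
have := fcoef_ccvg zr (fc r0 r1); rewrite cauchy.
set I := cint _ _ _; set k := ci * _; suff Ik : I = k.
  by rewrite Ik mulfK // mulf_neq0 // -cn_gt0 ?cn_ci // cn_real gtr0_norm mulr_gt0 // pi_gt0.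
have c1 : ccont 0 (2 * pi) (fun t : R => (fun=> 1 : C) (r%:C * cis t)).
  by move=> t _ _; exact: rcont_cst.
have k0 : k != 0 by rewrite mulf_neq0 // -cn_gt0 ?cn_ci // cn_real gtr0_norm mulr_gt0 // pi_gt0.
have := @fcoef_ccvg r z zr (fun=> 1) c1.
have -> : cint 0 (2 * pi) (fun t => 1 * (ci * (r%:C * cis t) / (r%:C * cis t - z))) = I.
  by apply: eq_cint => t _ _; rewrite mul1r.
(* For the constant 1 every partial sum but the empty one equals 1, hence the shift by one index.
   The same sequence tends to [I / k], which evaluates [I]. *)
move=> h0; have {h0}h := (ccvgS _ _).2 h0.
suff : I / k = 1 by move=> /(congr1 ( *%R^~ k)); rewrite divfK // mul1r.
apply: (ccvg_unique h); set w := (fun n => _); rewrite (_ : w = fun=> 1); first exact: ccvg_cst.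
apply/funext => n; rewrite /w big_ord_recl fcoef_cst1 // mul1r expr0 big1 ?addr0 // => i _.
by rewrite fcoef_cst1 // mul0r.
Qed.

Let rh : R := 1 / 2.
Let rh0 : 0 < rh. Proof. by rewrite /rh; lra. Qed.
Let rh1 : rh < 1. Proof. by rewrite /rh; lra. Qed.

(** Both sides are coefficients of a power series for w |-> f (rh w), one read off the circle of
    radius [rh], the other off that of radius [r]; uniqueness makes them equal. *)
Let fcoef_scale r k : rh < r -> r < 1 -> fcoef rh f k = fcoef r f k * (rh / r)%:C ^+ k.
Proof.
move=> hr r1; have r0 : 0 < r := lt_trans rh0 hr.
have [M HM] := fcoef_bounded (fc rh0 rh1).
have [N HN] := fcoef_bounded (fc r0 r1).
have q1 : rh / r < 1 by rewrite ltr_pdivrMr // mul1r.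
have q0 : 0 < rh / r by rewrite divr_gt0.
have gh := growth_bounded HM.
have g2 : growth (fun k => fcoef r f k * (rh / r)%:C ^+ k).
  apply: (@growth_bounded _ _ N) => n; apply: le_trans (HN n).
  by rewrite cnM cnX cn_real ler_piMr // exprn_ile1 // ?normr_ge0 // gtr0_norm // ltW.
move: k; apply: (psum_inj gh g2 ltr01) => w w1 _.
have rhn0 : rh%:C != 0 :> C by rewrite -cn_gt0 cn_real gtr0_norm.
have rn0 : r%:C != 0 :> C by rewrite -cn_gt0 cn_real gtr0_norm.
have cw : cn (rh%:C * w) < rh by rewrite cnM cn_real gtr0_norm // gtr_pMr.
have -> : psum (fcoef rh f) w = f (rh%:C * w).
  apply: psum_unique => //; have := taylor_circle rh0 rh1 cw.
  rewrite (_ : (fun n => _) = cpart (fcoef rh f) w) //.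
  by apply/funext => n; apply: eq_bigr => k _; rewrite mulrC mulrAC divff // mul1r mulrC.
apply/esym; apply: psum_unique => //.
have := taylor_circle r0 r1 (lt_trans cw hr).
rewrite (_ : (fun n => _) = cpart (fun k => fcoef r f k * (rh / r)%:C ^+ k) w) //.
apply/funext => n; apply: eq_bigr => k _; rewrite -[RHS]mulrA -exprMn; congr (_ * _ ^+ _).
by rewrite [in RHS](rmorphM _ rh) (fmorphV _ r) mulrAC.
Qed.

Lemma taylor_disk : exists2 a : nat -> C, growth a & forall z, cn z < 1 -> f z = psum a z.
Proof.
have rhn0 : rh%:C != 0 :> C by rewrite -cn_gt0 cn_real gtr0_norm.
(* The circle of radius 1/2 fixes the coefficients; larger circles yield the same ones by
   [fcoef_scale]. *)
pose a k := fcoef rh f k / rh%:C ^+ k.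
have aE r k : rh < r -> r < 1 -> a k * r%:C ^+ k = fcoef r f k.
  move=> hr r1; have r0 : 0 < r := lt_trans rh0 hr.
  have rn0 : r%:C != 0 :> C by rewrite -cn_gt0 cn_real gtr0_norm.
  rewrite /a (fcoef_scale k hr r1) (rmorphM _ rh) (fmorphV _ r) exprMn exprVn /=.
  have := expf_neq0 k rn0; have := expf_neq0 k rhn0; move: (_ ^+ k) (_ ^+ k) => x y x0 y0.
  by field; rewrite x0.
have ga : growth a.
  (* [fcoef_scale] compares only with radii above 1/2, so a small [r] is first raised to 3/4. *)
  move=> r r0 r1; pose s := Order.max r ((1 + rh) / 2).
  have s1 : s < 1 by rewrite gt_max r1 /=; have := rh1; lra.
  have hs : rh < s by rewrite lt_max; apply/orP; right; have := rh1; lra.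
  have s0 : 0 < s := lt_trans rh0 hs.
  have [M HM] := fcoef_bounded (fc s0 s1).
  exists M => n; apply: le_trans (HM n); rewrite -aE // cnM cnX cn_real gtr0_norm //.
  apply: (ler_wpM2l (cn_ge0 _)); apply: lerXn2r; rewrite ?nnegrE ?(ltW r0) ?(ltW s0) //.
  by rewrite le_max lexx.
exists a => // z z1; apply/esym; apply: psum_unique => //.
pose s := Order.max ((1 + cn z) / 2) ((1 + rh) / 2).
have s1 : s < 1 by rewrite gt_max; apply/andP; split; have := rh1; lra.
have hs : rh < s by rewrite lt_max; apply/orP; right; have := rh1; lra.
have zs : cn z < s by rewrite lt_max; apply/orP; left; lra.
have s0 : 0 < s := lt_trans rh0 hs.
have sn0 : s%:C != 0 :> C by rewrite -cn_gt0 cn_real gtr0_norm.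
have := taylor_circle s0 s1 zs; rewrite (_ : (fun n => _) = cpart a z) //.
apply/funext => n; apply: eq_bigr => k _; rewrite -aE // exprMn exprVn.
by field; rewrite expf_neq0.
Qed.

End disk.
End taylor.

(** * Invariance of the area measure under rotations, moments of the disk *)

Section plane_measure.
Variable R : realType.
Local Notation mu := (@lebesgue_measure R).
Local Notation T := (measurableTypeR R).
Local Notation TT := (measurableTypeR R * measurableTypeR R)%type.
Local Open Scope classical_set_scope.

Lemma measurable_translation (c : R) : measurable_fun [set: T] (fun y : T => y + c : T).
Proof. by apply: measurable_funD. Qed.

Lemma lebesgue_measure_translation (c : R) (A : set T) : measurable A ->
  mu ((fun y : T => y + c : T) @^-1` A) = mu A.
Proof.
move=> mA; have mf := measurable_translation c.
pose m := measure_function_pushforward__canonical__measure_function_Measure mu mf.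
apply/esym; apply: (lebesgue_measure_unique (mu := m)) => // X /ocitvP[->|[[a b] /= ab ->]].
  by rewrite !measure0.
rewrite -[RHS]/(mu ((fun y : T => y + c : T) @^-1` `]a, b])).
rewrite (_ : _ @^-1` _ = `]a - c, b - c]).
  by rewrite !lebesgue_measure_itv /= !lte_fin ltrD2r ab -!EFinB; congr EFin; ring.
by apply/seteqP; split => x /=; rewrite !in_itv /= ltrBlDr lerBrDr.
Qed.

(** [areaR] integrates sections at fixed first coordinate, whereas a horizontal shear translates the
    sections at fixed second coordinate; hence the other order of integration. *)
Lemma areaR_ysection (A : set TT) : measurable A ->
  areaR A = (\int[mu]_y mu (ysection A y))%E.
Proof.
move=> mA; rewrite /areaR.
rewrite -[RHS]/((mu \x^ mu)%E A).
by apply: product_measure_unique => // B D mB mD; rewrite /= product_measure2E.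
Qed.

Lemma areaR_shear_y (t : R) (A : set TT) : measurable A ->
  areaR ((fun p : TT => (p.1, p.2 + t * p.1) : TT) @^-1` A) = areaR A.
Proof.
move=> mA; rewrite /areaR /product_measure1; apply: eq_integral => x _ /=.
rewrite -(lebesgue_measure_translation (t * x) (measurable_xsection x mA)); congr (mu _).
Qed.

Lemma areaR_shear_x (t : R) (A : set TT) : measurable A ->
  measurable ((fun p : TT => (p.1 + t * p.2, p.2) : TT) @^-1` A) ->
  areaR ((fun p : TT => (p.1 + t * p.2, p.2) : TT) @^-1` A) = areaR A.
Proof.
move=> mA mA'; rewrite !areaR_ysection //; apply: eq_integral => x _ /=.
rewrite -(lebesgue_measure_translation (t * x) (measurable_ysection x mA)); congr (mu _).
Qed.

Definition rotR (c s : R) (p : TT) : TT := (c * p.1 - s * p.2, s * p.1 + c * p.2).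

Lemma measurable_rotR c s : measurable_fun [set: TT] (rotR c s).
Proof.
apply/measurable_fun_pairP; split => /=.
  by apply: measurable_funB; apply: measurable_funM.
by apply: measurable_funD; apply: measurable_funM.
Qed.

(** The parameter [t] is the tangent of half the angle, which excludes the half turn. Each shear
    translates the sections in one direction and therefore preserves area. *)
Lemma areaR_rot (c s : R) (A : set TT) : c ^+ 2 + s ^+ 2 = 1 -> c != -1 -> measurable A ->
  areaR (rotR c s @^-1` A) = areaR A.
Proof.
move=> cs c1 mA; pose t := s / (1 + c).
have c1' : 1 + c != 0 by rewrite addrC addr_eq0.
pose f1 (p : TT) : TT := (p.1 + (- t) * p.2, p.2).
pose f2 (p : TT) : TT := (p.1, p.2 + s * p.1).
have mf1 : measurable_fun [set: TT] f1.
  apply/measurable_fun_pairP; rewrite /comp /f1 /=; split; last exact: measurable_snd.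
  by apply: measurable_funD => //; apply: measurable_funM.
have mf2 : measurable_fun [set: TT] f2.
  apply/measurable_fun_pairP; rewrite /comp /f2 /=; split; first exact: measurable_fst.
  by apply: measurable_funD => //; apply: measurable_funM.
have mp1 B : measurable B -> measurable (f1 @^-1` B) by move=> mB; rewrite -[X in measurable X]setTI; exact: mf1.
have mp2 B : measurable B -> measurable (f2 @^-1` B) by move=> mB; rewrite -[X in measurable X]setTI; exact: mf2.
(* A rotation is a product of three shears. *)
have -> : rotR c s = f1 \o f2 \o f1.
  have s2 : s * t = 1 - c.
    rewrite /t; apply: (mulIf c1'); rewrite mulrA divfK // -expr2.
    have -> : s ^+ 2 = 1 - c ^+ 2 by rewrite -cs; ring.
    by ring.
  have ts : t * (1 + c) = s by rewrite /t divfK.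
  apply/funext => -[x y]; rewrite /rotR /f1 /f2 /=; congr (_, _).
    transitivity ((1 - s * t) * x - (t * (1 + c)) * y + t * (s * t - (1 - c)) * y).
      by rewrite s2 ts subrr mulr0 mul0r; ring.
    by ring.
  transitivity (s * x + (1 - s * t) * y); first by rewrite s2; ring.
  by ring.
rewrite !comp_preimage areaR_shear_x ?areaR_shear_y ?areaR_shear_x //.
- exact: mp1.
- exact: (mp1 _ mA).
- exact: (mp2 _ (mp1 _ mA)).
- exact: (mp1 _ (mp2 _ (mp1 _ mA))).
Qed.

End plane_measure.

(** * Area of disks and the distribution of the squared modulus *)

Section disk_area.
Variable R : realType.
Local Notation mu := (@lebesgue_measure R).
Local Notation T := (measurableTypeR R).
Local Notation TT := (measurableTypeR R * measurableTypeR R)%type.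
Local Open Scope classical_set_scope.

Lemma continuous_subsegment (f : R -> R) (A : set R) : continuous f -> {within A, continuous f}.
Proof. by move=> cf; apply: continuous_subspaceT. Qed.

Lemma continuous_semicircle (b : R) : continuous (fun x : R => 2 * Num.sqrt (b - x ^+ 2)).
Proof.
move=> x; apply: cvgM; first exact: cvg_cst.
apply: continuous_comp; last exact: sqrt_continuous.
by apply: cvgB; [exact: cvg_cst | exact: exprn_continuous].
Qed.

(** The substitution x = b sin t produces b^2 (1 + cos 2t) on [-pi/2, pi/2]. *)
Lemma integral_semicircle (b : R) : 0 < b ->
  (\int[mu]_(x in `[(- b)%R, b]) (2 * Num.sqrt (b ^+ 2 - x ^+ 2))%:E)%E = (pi * b ^+ 2)%:E.
Proof.
move=> b0; pose F (t : R) := b * sin t.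
have dF (t : R) : is_derive t (1 : R) F (b * cos t).
  by rewrite /F; apply: is_derive_eq; rewrite /GRing.scale /=; ring.
have F'E : F^`() = fun t => b * cos t by apply/funext => t; rewrite derive1E; case: (dF t).
have cF : continuous F.
  by move=> t; apply: differentiable_continuous; apply/derivable1_diffP; case: (dF t).
have cF' : continuous (fun t : R => b * cos t).
  by move=> t; apply: cvgM; [exact: cvg_cst | exact: continuous_cos].
pose h : R := pi / 2.
have h0 : 0 < h by rewrite divr_gt0 // pi_gt0.
have Fh : F h = b by rewrite /F sin_pihalf mulr1.
have FNh : F (- h) = - b by rewrite /F sinN sin_pihalf mulrN1.
have := @integration_by_substitution_increasing R F (fun x => 2 * Num.sqrt (b ^+ 2 - x ^+ 2)) (- h) h.
rewrite Fh FNh => ->; last first.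
- by apply: continuous_subsegment; exact: continuous_semicircle.
- split => [x _||]; first by case: (dF x).
    by apply: cvg_at_right_filter; exact: cF.
  by apply: cvg_at_left_filter; exact: cF.
- by rewrite F'E; apply/cvg_ex; exists (b * cos h); apply: cvg_at_left_filter; exact: cF'.
- by rewrite F'E; apply/cvg_ex; exists (b * cos (- h)); apply: cvg_at_right_filter; exact: cF'.
- by rewrite F'E => x _; exact: cF'.
- by move=> x y xh yh xy; rewrite /F ltr_pM2l // ltr_sin.
- lra.
transitivity (\int[mu]_(x in `[(- h)%R, h]) (b ^+ 2 * (1 + cos (2 * x)))%:E)%E.
  apply: eq_integral => x; rewrite inE /= in_itv /= => /andP[hx xh]; congr EFin.
  have c0 : 0 <= cos x by rewrite cos_ge0_pihalf // hx xh.
  rewrite F'E /F !fctE /=.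
  have -> : b ^+ 2 - (b * sin x) ^+ 2 = (b * cos x) ^+ 2 by rewrite !exprMn cos2sin2; ring.
  rewrite sqrtr_sqr ger0_norm; last by rewrite mulr_ge0 // ltW.
  have -> : 2 * x = x + x :> R by ring.
  by rewrite cosD -[sin x * _]expr2 sin2cos2; ring.
have dG (t : R) : is_derive t (1 : R) (fun t => b ^+ 2 * (t + sin (2 * t) / 2)) (b ^+ 2 * (1 + cos (2 * t))).
  by apply: is_derive_eq; rewrite /GRing.scale /=; field.
have cG : continuous (fun t : R => b ^+ 2 * (t + sin (2 * t) / 2)).
  by move=> t; apply: differentiable_continuous; apply/derivable1_diffP; case: (dG t).
rewrite (continuous_FTC2 (F := (fun t => b ^+ 2 * (t + sin (2 * t) / 2)))).
- rewrite -EFinB; congr EFin.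
  have h2 : 2 * h = pi by rewrite /h; field.
  have hN : 2 * - h = - pi by rewrite -h2; ring.
  by rewrite hN h2 sinN sinpi /h; field.
- lra.
- apply: continuous_subsegment => x; apply: cvgM; first exact: cvg_cst.
  apply: cvgD; first exact: cvg_cst.
  apply: (continuous_comp (f := fun x : R => 2 * x)); last exact: continuous_cos.
  by apply: cvgM; [exact: cvg_cst | exact: cvg_id].
- split => [x _||]; first by case: (dG x).
    by apply: cvg_at_right_filter; exact: cG.
  by apply: cvg_at_left_filter; exact: cG.
- by move=> x _; rewrite derive1E; case: (dG x).
Qed.

(** The squared modulus rather than the modulus: on the unit disk its distribution under area is a
    constant multiple of Lebesgue measure. *)
Definition rho (p : TT) : R := p.1 ^+ 2 + p.2 ^+ 2.

Lemma measurable_rho : measurable_fun [set: TT] (rho : TT -> T).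
Proof. by apply: measurable_funD; apply: measurable_funX. Qed.

Lemma rho_ge0 p : 0 <= rho p.
Proof. by rewrite addr_ge0 ?sqr_ge0. Qed.

Lemma areaR_disk (b : R) : 0 <= b -> areaR [set p : TT | rho p <= b] = (pi * b)%:E.
Proof.
move=> b0.
have mE : xsection [set p : TT | rho p <= b] = fun x => if x ^+ 2 <= b then `[- Num.sqrt (b - x ^+ 2), Num.sqrt (b - x ^+ 2)] else set0.
  apply/funext => x; apply/seteqP; split => y; rewrite /xsection /= inE /= /rho /=.
    move=> xyb; have xb : x ^+ 2 <= b by have := sqr_ge0 y; lra.
    rewrite xb /= in_itv /= -ler_norml -sqrtr_sqr ler_wsqrtr //; lra.
  case: ifPn => //= xb; rewrite in_itv /= -ler_norml => H.
  have : `|y| ^+ 2 <= Num.sqrt (b - x ^+ 2) ^+ 2 by rewrite lerXn2r // nnegrE ?sqrtr_ge0.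
  rewrite real_normK ?num_real // sqr_sqrtr; lra.
rewrite /areaR /product_measure1 /= mE.
have -> : (\int[mu]_x mu (if (x ^+ 2 <= b)%R then `[(- Num.sqrt (b - x ^+ 2))%R, Num.sqrt (b - x ^+ 2)] else set0) =
  \int[mu]_x (((fun x => (2 * Num.sqrt (b - x ^+ 2))%:E) \_ `[(- Num.sqrt b)%R, Num.sqrt b]) x))%E.
  apply: eq_integral => x _; rewrite patchE.
  have xbE : (x \in (`[- Num.sqrt b, Num.sqrt b] : set R)) = (x ^+ 2 <= b).
    rewrite mem_setE in_itv /= -ler_norml -sqrtr_sqr ler_sqrt //.
  rewrite xbE; case: ifPn => xb; last by rewrite measure0.
  rewrite lebesgue_measure_itv /= lte_fin.
  have s0 := sqrtr_ge0 (b - x ^+ 2); case: ifPn => h; first by rewrite -EFinB; congr EFin; ring.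
  by congr EFin; move: h; rewrite -leNgt; lra.
rewrite -integral_mkcond.
have [->|bn0] := eqVneq b 0.
  by rewrite sqrtr0 oppr0 set_itv1 integral_set1 mulr0.
have sb0 : 0 < Num.sqrt b by rewrite sqrtr_gt0 lt_def bn0.
have := integral_semicircle sb0; rewrite sqr_sqrtr // => <-.
Qed.

(** Lebesgue measure is characterised by its values on all half-open intervals, but the image
    measure has no mass on negative numbers. So [m] is the image divided by pi, completed by
    Lebesgue measure on []-oo, 0]]; on [A] the added part is null. *)
Lemma areaR_rho_pushforward (A : set T) : measurable A -> A `<=` `[0, 1[ ->
  areaR (rho @^-1` A) = (pi%:E * mu A)%E.
Proof.
move=> mA A01.
pose nu := measure_function_pushforward__canonical__measure_function_Measure
  (mu \x mu)%E measurable_rho.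
have pi1 : 0 <= pi^-1 :> R by rewrite invr_ge0 pi_ge0.
pose k : {nonneg R} := NngNum pi1.
have mN : measurable (`]-oo, 0] : set T) by [].
pose m : {measure set T -> \bar R} := measure_add (mscale k nu) (mrestr mu mN).
have nuE (x y : R) : x <= y -> nu `]x, y] = (pi * (Order.max y 0 - Order.max x 0))%:E.
  move=> xy; rewrite -[nu _]/(areaR (rho @^-1` `]x, y])).
  have mD c : measurable (rho @^-1` `]-oo, c] : set TT).
    by rewrite -[X in measurable X]setTI; apply: measurable_rho.
  have aD c : areaR (rho @^-1` `]-oo, c]) = (pi * Order.max c 0)%:E.
    case: (leP 0 c) => c0.
      rewrite -(areaR_disk c0); congr areaR; apply/seteqP; split => p; rewrite /= ?in_itv //=.
    rewrite mulr0 (_ : rho @^-1` _ = set0); first by rewrite /areaR measure0.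
    apply/seteqP; split => p //=; rewrite in_itv /= => h; have := rho_ge0 p; lra.
  have -> : rho @^-1` `]x, y] = rho @^-1` `]-oo, y] `\` rho @^-1` `]-oo, x].
    apply/seteqP; split => p; rewrite /= !in_itv /=; first by move=> /andP[h1 h2]; split => //; apply/negP; rewrite -ltNge.
    by move=> [h1 /negP]; rewrite -ltNge => h2; rewrite h1 h2.
  have yoo : (areaR (rho @^-1` `]-oo, y]) < +oo)%E by rewrite aD ltry.
  have := measureD (mu := (mu \x mu)%E) (mD y) (mD x) yoo.
  rewrite setIidr; last by move=> p /=; rewrite !in_itv /= => h; exact: le_trans xy.
  move=> H; rewrite [LHS]H -[X in (X - _)%E]/(areaR (rho @^-1` `]-oo, y])).
  by rewrite -[X in (_ - X)%E]/(areaR (rho @^-1` `]-oo, x])) !aD -EFinB mulrBr.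
have mE : mu A = m A.
  apply: lebesgue_measure_unique => // X /ocitvP[->|[[x y] /= xy ->]]; first by rewrite !measure0.
  rewrite /m /= /measure_add /msum /= !big_ord_recr big_ord0 /= add0e /mscale /= -/nu nuE ?ltW // /mrestr.
  rewrite lebesgue_measure_itv /= lte_fin xy -EFinM mulrA mulVf ?mul1r; last by rewrite gt_eqF // pi_gt0.
  have -> : `]x, y] `&` `]-oo, 0] = `]x, Order.min y 0].
    by apply/seteqP; split => z; rewrite /= !in_itv /= le_min; [move=> [/andP[-> ->] ->] | move=> /andP[-> /andP[-> ->]]].
  rewrite lebesgue_measure_itv /= lte_fin lt_min xy /=.
  case: (leP 0 y) => y0; case: (leP 0 x) => x0; rewrite ?(ltNge x 0) ?x0 /= -?EFinB -?EFinD; by congr EFin; lra.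
have r0 : mu (A `&` `]-oo, 0]) = 0%E.
  apply/eqP; rewrite eq_le measure_ge0 andbT -(lebesgue_measure_set1 (0 : R)).
  apply: le_measure; rewrite ?inE //; first exact: measurableI.
  move=> x [/A01 /=]; rewrite !in_itv /= => /andP[h1 _] h2; apply/eqP; rewrite eq_le h1 h2 //.
rewrite [in RHS]mE /m /= /measure_add /msum /= !big_ord_recr big_ord0 /= add0e /mscale /=.
rewrite [mrestr _ _ _]r0 addr0 muleA -EFinM divff ?mul1e //.
by rewrite gt_eqF // pi_gt0.
Qed.

End disk_area.

(** * Moments of the weight, by a recursion for beta integrals *)

Section beta_moments.
Variables (R : realType) (alpha : R).
Hypothesis a1 : -1 < alpha.
Local Notation mu := (@lebesgue_measure R).
Local Notation T := (measurableTypeR R).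
Local Open Scope classical_set_scope.

(* Squared norm of [z ^+ n] in A^2_alpha, i.e. n! Gamma(alpha+2) / Gamma(n+alpha+2). *)
Fixpoint gam (n : nat) : R :=
  if n is m.+1 then gam m * (m.+1%:R / (m.+1%:R + alpha + 1)) else 1.

Lemma gam_gt0 n : 0 < gam n.
Proof.
elim: n => //= n IH; rewrite mulr_gt0 // divr_gt0 // ?ltr0n //.
by have : 0 <= n%:R :> R by []; have := a1; rewrite -natr1; lra.
Qed.

Let f n (t : R) := t ^+ n * (1 - t) `^ alpha.

(** Truncated at [r < 1], because for negative [alpha] the integrand is unbounded at 1. *)
Let b n (r : R) := (\int[mu]_(t in `[0, r]) f n t)%R.

Let f_cont n (t : R) : t < 1 -> {for t, continuous (f n)}.
Proof.
move=> t1; apply: cvgM; first exact: exprn_continuous.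
apply: (continuous_comp (f := fun t : R => 1 - t) (g := fun x => x `^ alpha)).
  by apply: cvgB; [exact: cvg_cst | exact: cvg_id].
apply: differentiable_continuous; apply/derivable1_diffP.
have : 0 < 1 - t by lra.
by move=> h; have := is_derive1_powR alpha h; case.
Qed.

Let f_int n r : r < 1 -> mu.-integrable `[0, r] (EFin \o f n).
Proof.
move=> r1; apply: continuous_compact_integrable; first exact: segment_compact.
apply: within_continuous => x _ xr; apply: f_cont; exact: le_lt_trans r1.
Qed.

Let dpow (t : R) : t < 1 -> is_derive t (1 : R) (fun t => (1 - t) `^ (alpha + 1)) (- (alpha + 1) * (1 - t) `^ alpha).
Proof.
move=> t1; have h : 0 < 1 - t by lra.
have H := is_derive1_powR (alpha + 1) h.
have dt : is_derive t (1 : R) (fun t : R => 1 - t) (- 1).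
  by apply: is_derive_eq; ring.
have := @is_derive1_comp _ (fun x => x `^ (alpha + 1)) (fun t => 1 - t) t _ _ H dt.
by rewrite addrK mulrN1 mulNr.
Qed.

Let powS (t : R) : t < 1 -> (1 - t) `^ (alpha + 1) = (1 - t) * (1 - t) `^ alpha.
Proof.
move=> t1; rewrite powRD ?powRr1 1?mulrC //; first by rewrite subr_ge0 ltW.
by apply/implyP => _; rewrite subr_eq0 gt_eqF.
Qed.

Let FTC0r (F g : R -> R) (r : R) : 0 < r -> r < 1 ->
  (forall t : R, t < 1 -> is_derive t (1 : R) F (g t)) -> (forall t : R, t < 1 -> {for t, continuous g}) ->
  (\int[mu]_(t in `[0, r]) g t)%R = F r - F 0.
Proof.
move=> r0 r1 dF cg; rewrite /Rintegral (continuous_FTC2 (F := F)) //.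
- by apply: within_continuous => x _ xr; apply: cg; exact: le_lt_trans r1.
- have cF x : x < 1 -> {for x, continuous F}.
    by move=> x1; apply: differentiable_continuous; apply/derivable1_diffP; case: (dF x x1).
  split => [x||].
  + by rewrite in_itv /= => /andP[_ xr]; case: (dF x (lt_trans xr r1)).
  + by apply: cvg_at_right_filter; apply: cF.
  + by apply: cvg_at_left_filter; apply: cF.
- by move=> x; rewrite in_itv /= => /andP[_ xr]; rewrite derive1E; case: (dF x (lt_trans xr r1)).
Qed.

Let b0E r : 0 < r -> r < 1 -> (alpha + 1) * b 0 r = 1 - (1 - r) `^ (alpha + 1).
Proof.
move=> r0 r1; rewrite /b -RintegralZl //; last exact: f_int.
have dF (t : R) : t < 1 -> is_derive t (1 : R) (fun t => - (1 - t) `^ (alpha + 1)) ((alpha + 1) * f 0 t).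
  by move=> t1; have H := dpow t1; apply: is_derive_eq; rewrite /f expr0 mul1r; ring.
rewrite (FTC0r r0 r1 dF); first by rewrite subr0 powR1 opprK addrC.
by move=> t t1; apply: cvgM; [exact: cvg_cst | exact: f_cont].
Qed.

(** Integrates the derivative of t^(n+1) (1 - t)^(alpha+1). As r tends to 1 the right side vanishes
    and the recursion defining [gam] remains. *)
Let bSE n r : 0 < r -> r < 1 ->
  n.+1%:R * b n r - (n.+1%:R + alpha + 1) * b n.+1 r = r ^+ n.+1 * (1 - r) `^ (alpha + 1).
Proof.
move=> r0 r1; have iZ k c : mu.-integrable `[0, r] (EFin \o (fun t => c * f k t)).
  rewrite (_ : _ \o _ = (fun x => c%:E * (EFin \o f k) x)%E) //.
  by apply: integrableZl => //; exact: f_int.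
rewrite /b -!RintegralZl //; try exact: f_int.
rewrite -RintegralB //; try exact: iZ.
have dF (t : R) : t < 1 -> is_derive t (1 : R) (fun t => t ^+ n.+1 * (1 - t) `^ (alpha + 1))
    (n.+1%:R * f n t - (n.+1%:R + alpha + 1) * f n.+1 t).
  move=> t1; have H := dpow t1.
  have HX : is_derive t (1 : R) (fun t : R => t ^+ n.+1) (n.+1%:R * t ^+ n).
    have := is_deriveX n.+1 (is_derive_id t (1 : R)).
    rewrite (_ : id ^+ n.+1 = (fun t : R => t ^+ n.+1)); last by apply/funext => x; rewrite exprfctE.
    by rewrite /GRing.scale /= mulr1.
  have HM := is_deriveM HX H; apply: (is_derive_eq HM).
  rewrite /GRing.scale /= powS // /f exprS; ring.
rewrite (FTC0r r0 r1 dF); first by rewrite expr0n mul0r subr0.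
by move=> t t1; apply: cvgB; (apply: cvgM; [exact: cvg_cst | exact: f_cont]).
Qed.

(** Starting from [k.+2] keeps every radius strictly positive, as the two formulas for [b]
    require. *)
Let r_ (k : nat) : R := 1 - k.+2%:R^-1.

Let r_gt0 k : 0 < r_ k.
Proof. by rewrite subr_gt0 invf_lt1 // ltr1n. Qed.

Let r_lt1 k : r_ k < 1.
Proof. by rewrite ltrBlDr ltrDl invr_gt0. Qed.

Let cvg_pow : (1 - r_ k) `^ (alpha + 1) @[k --> \oo] --> (0 : R).
Proof.
have a0 : 0 < alpha + 1 by have := a1; lra.
apply/cvgrPdist_le => e e0.
have /cvgrPdist_le/(_ e e0)[d /= d0 H] := powR_cvg0 a0.
have /cvgrPdist_lt/(_ d d0)[N _ HN] := @cvg_harmonic R.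
exists N => // k Nk; apply: H; last by rewrite /= subr_gt0.
have := HN k.+1 (leq_trans Nk (leqnSn _)).
by rewrite /= /r_ subKr.
Qed.

Let b_cvg n : b n (r_ k) @[k --> \oo] --> gam n / (alpha + 1).
Proof.
have a0 : 0 < alpha + 1 by have := a1; lra.
elim: n => [|n IH].
  rewrite (_ : (fun k => b 0 (r_ k)) = (fun k => (1 - (1 - r_ k) `^ (alpha + 1)) / (alpha + 1))).
    apply: cvgM; last exact: cvg_cst.
    by rewrite -[gam 0]subr0; apply: cvgB; [exact: cvg_cst | exact: cvg_pow].
  by apply/funext => k; rewrite -b0E // mulrC mulKf // gt_eqF.
have c0 : n.+1%:R + alpha + 1 != 0.
  by rewrite gt_eqF // -natr1; have : 0 <= n%:R :> R by []; lra.
rewrite (_ : (fun k => b n.+1 (r_ k)) = (fun k =>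
   (n.+1%:R * b n (r_ k) - r_ k ^+ n.+1 * (1 - r_ k) `^ (alpha + 1)) / (n.+1%:R + alpha + 1))); last first.
  by apply/funext => k; rewrite -bSE // opprB addrCA subrr addr0 mulrC mulKf.
have -> : gam n.+1 / (alpha + 1) = (n.+1%:R * (gam n / (alpha + 1)) - 0) / (n.+1%:R + alpha + 1).
  by rewrite /= subr0; ring.
apply: cvgM; last exact: cvg_cst.
apply: cvgB; first by apply: cvgM; [exact: cvg_cst | exact: IH].
apply/cvgrPdist_le => e e0; have /cvgrPdist_le/(_ e e0)[N _ HN] := cvg_pow.
exists N => // k /HN; rewrite /= !sub0r !normrN => h; apply: le_trans h.
rewrite normrM ger0_norm ?exprn_ge0 ?(ltW (r_gt0 _)) //.
by rewrite ler_piMl // exprn_ile1 // ltW.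
Qed.

Lemma beta_moment n :
  (\int[mu]_(t in `[0%R, 1%R[) (t ^+ n * (1 - t) `^ alpha)%:E = (gam n / (alpha + 1))%:E)%E.
Proof.
have -> : `[0, 1[ = \bigcup_k `[0, r_ k].
  apply/seteqP; split => x; rewrite /= ?in_itv /=.
    move=> /andP[x0 x1]; have x1' : 0 < 1 - x by lra.
    have /cvgrPdist_lt/(_ _ x1')[N _ HN] := @cvg_harmonic R.
    exists N => //=; rewrite in_itv /= x0 /=.
    have := HN N.+1 (leqnSn _); rewrite /= sub0r normrN ger0_norm ?invr_ge0 // => /ltW h.
    by rewrite /r_ lerBrDr addrC -lerBrDr.
  move=> [k _]; rewrite /= in_itv /= => /andP[-> xr]; exact: le_lt_trans (r_lt1 k).
have H1 : (\int[mu]_(t in `[0%R, r_ k]) (f n t)%:E @[k --> \oo] -->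
    \int[mu]_(t in \bigcup_k `[0%R, r_ k]) (f n t)%:E)%E.
  apply: ge0_nondecreasing_set_cvg_integral => //.
  - apply/nondecreasing_seqP => k; rewrite subsetEset => x /=; rewrite !in_itv /= => /andP[-> xr] /=.
    by apply: le_trans xr _; rewrite /r_ lerD2l lerN2 lef_pV2 ?posrE // ler_nat.
  - by move=> i; have /integrableP[] := f_int n (r_lt1 i).
  - move=> i x /=; rewrite in_itv /= => /andP[x0 xr].
    by rewrite lee_fin mulr_ge0 ?exprn_ge0 ?powR_ge0.
have H2 : (\int[mu]_(t in `[0%R, r_ k]) (f n t)%:E @[k --> \oo] --> (gam n / (alpha + 1))%:E)%E.
  rewrite (_ : (fun k => _) = EFin \o (fun k => b n (r_ k))).
    by apply: cvg_EFin; [exact: nearW | exact: b_cvg].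
  apply/funext => k; rewrite /= /b /Rintegral fineK //.
  by apply: integrable_fin_num => //; exact: f_int.
by rewrite -(cvg_lim _ H1) // (cvg_lim _ H2).
Qed.

(** The integrand depends on [rho] alone, so the pushforward reduces it to [beta_moment] on [0,
    1[. *)
Lemma disk_moment n :
  (\int[@areaR R]_(p in @diskR R) (rho p ^+ n * bweight alpha p)%:E = (pi * (gam n / (alpha + 1)))%:E)%E.
Proof.
have -> : @diskR R = @rho R @^-1` `[0, 1[.
  by apply/seteqP; split => p; rewrite /= in_itv /= rho_ge0.
have mg : measurable_fun (`[0, 1[ : set T) (fun t : T => (t ^+ n * (1 - t) `^ alpha)%:E).
  apply/measurable_EFinP; apply: measurable_funM; first exact: measurable_funX.
  apply: (measurableT_comp (measurable_powR _)).
  by apply: measurable_funB.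
have := ge0_integral_pushforward (@measurable_rho R) (mu \x mu)%E (D := `[0, 1[) _ mg.
move=> /(_ (measurable_itv _)) H; rewrite [LHS](esym (H _)); last first.
  by move=> t; rewrite inE /= in_itv /= => /andP[t0 t1]; rewrite lee_fin mulr_ge0 ?exprn_ge0 ?powR_ge0.
have pi0 : 0 <= pi :> R := pi_ge0 R.
rewrite (eq_measure_integral (mscale (NngNum pi0) mu)); last 2 first.
- exact: measurable_rho.
- by move=> ? A mA A01; exact: areaR_rho_pushforward mA A01.
rewrite ge0_integral_mscale //; last first.
  by move=> t /=; rewrite in_itv /= => /andP[t0 t1]; rewrite lee_fin mulr_ge0 ?exprn_ge0 ?powR_ge0.
by rewrite beta_moment -EFinM.
Qed.

End beta_moments.

(** * Complex-valued integrals against area *)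

Section area_integrals.
Variables (R : realType) (alpha : R).
Hypothesis a1 : -1 < alpha.
Local Notation C := R[i].
Local Notation T := (measurableTypeR R).
Local Notation TT := (measurableTypeR R * measurableTypeR R)%type.
Local Notation ar := (@lebesgue_measure R \x @lebesgue_measure R)%E.
Local Open Scope classical_set_scope.
Implicit Types (f g : C -> C) (h : TT -> C) (E : set TT).

Definition cmeas E h := measurable_fun E (fun p => Re (h p) : T) /\ measurable_fun E (fun p => Im (h p) : T).

Definition cintegrable E h := ar.-integrable E (fun p => (Re (h p))%:E) /\ ar.-integrable E (fun p => (Im (h p))%:E).

Definition carea E h : C :=
  (\int[ar]_(p in E) Re (h p))%R +i* (\int[ar]_(p in E) Im (h p))%R.

Lemma cmeas_cst E (k : C) : cmeas E (fun=> k).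
Proof. by split; exact: measurable_cst. Qed.

Lemma cmeasD E h1 h2 : cmeas E h1 -> cmeas E h2 -> cmeas E (fun p => h1 p + h2 p).
Proof.
move=> [r1 i1] [r2 i2]; split.
  by under eq_fun do rewrite ReD; exact: measurable_funD.
by under eq_fun do rewrite ImD; exact: measurable_funD.
Qed.

Lemma cmeasM E h1 h2 : cmeas E h1 -> cmeas E h2 -> cmeas E (fun p => h1 p * h2 p).
Proof.
move=> [r1 i1] [r2 i2]; split.
  by under eq_fun do rewrite ReM; apply: measurable_funB; exact: measurable_funM.
by under eq_fun do rewrite ImM; apply: measurable_funD; exact: measurable_funM.
Qed.

Lemma cmeas_conj E h : cmeas E h -> cmeas E (fun p => (h p)^*%C).
Proof.
move=> [r1 i1]; split; first by under eq_fun do rewrite ReJ.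
under eq_fun do rewrite ImJ; exact: (measurableT_comp (@oppr_measurable _ _)).
Qed.

Lemma cmeas_real E (w : TT -> R) : measurable_fun E (w : TT -> T) -> cmeas E (fun p => (w p)%:C).
Proof. by move=> mw; split => //=; exact: measurable_cst. Qed.

Lemma cmeas_pt E : cmeas E (@pt R).
Proof.
by split => /=; apply: measurable_funTS; [exact: measurable_fst | exact: measurable_snd].
Qed.

Lemma cmeasX E h n : cmeas E h -> cmeas E (fun p => h p ^+ n).
Proof.
move=> mh; elim: n => [|n IH]; first by under eq_fun do rewrite expr0; exact: cmeas_cst.
by under eq_fun do rewrite exprS; exact: cmeasM.
Qed.

Lemma cmeas_sum E n (F : nat -> TT -> C) : (forall k, cmeas E (F k)) ->
  cmeas E (fun p => \sum_(k < n) F k p).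
Proof.
move=> H; elim: n => [|n IH]; first by under eq_fun do rewrite big_ord0; exact: cmeas_cst.
by under eq_fun do rewrite big_ord_recr /=; exact: cmeasD.
Qed.

Lemma cmeas_cn2 E h : cmeas E h -> measurable_fun E (fun p => cn (h p) ^+ 2 : T).
Proof.
move=> [r1 i1]; under eq_fun do rewrite cn_sqr.
by apply: measurable_funD; exact: measurable_funX.
Qed.

Lemma cmeas_lim E (u : nat -> TT -> C) h : measurable E -> (forall n, cmeas E (u n)) ->
  (forall p, E p -> ccvg (fun n => u n p) (h p)) -> cmeas E h.
Proof.
move=> mE mu uh; split.
  apply: (@measurable_fun_cvg _ _ _ _ (fun n p => Re (u n p))) => // [n|p Ep]; first by case: (mu n).
  exact: ccvg_Re (uh p Ep).
apply: (@measurable_fun_cvg _ _ _ _ (fun n p => Im (u n p))) => // [n|p Ep]; first by case: (mu n).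
exact: ccvg_Im (uh p Ep).
Qed.

Lemma cintegrable_le E h (w : TT -> R) : measurable E -> cmeas E h ->
  ar.-integrable E (fun p => (w p)%:E) -> (forall p, E p -> cn (h p) <= w p) -> cintegrable E h.
Proof.
move=> mE [mr mi] iw H; split.
- apply: (le_integrable mE _ _ iw); first exact/measurable_EFinP.
  by move=> p Ep /=; rewrite lee_fin (le_trans (Re_le_cn _)) // (le_trans (H p Ep)) // ler_norm.
- apply: (le_integrable mE _ _ iw); first exact/measurable_EFinP.
  by move=> p Ep /=; rewrite lee_fin (le_trans (Im_le_cn _)) // (le_trans (H p Ep)) // ler_norm.
Qed.

Lemma careaD E h1 h2 : measurable E -> cintegrable E h1 -> cintegrable E h2 ->
  carea E (fun p => h1 p + h2 p) = carea E h1 + carea E h2.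
Proof.
move=> mE [r1 i1] [r2 i2]; apply: eqC; rewrite /carea ?ReImE /=.
  by under eq_Rintegral do rewrite ReD; rewrite RintegralD.
by under eq_Rintegral do rewrite ImD; rewrite RintegralD.
Qed.

Lemma careaZ E k h : measurable E -> cintegrable E h ->
  carea E (fun p => k * h p) = k * carea E h.
Proof.
move=> mE [r1 i1].
have I1 (r : R) (F : TT -> R) : ar.-integrable E (fun p => (F p)%:E) -> ar.-integrable E (EFin \o (fun p => r * F p)).
  by move=> iF; rewrite (_ : _ \o _ = (fun x => r%:E * (F x)%:E)%E) //; exact: integrableZl.
apply: eqC; rewrite /carea ?ReImE /=.
  by under eq_Rintegral do rewrite ReM; rewrite RintegralB ?RintegralZl //; exact: I1.
by under eq_Rintegral do rewrite ImM; rewrite RintegralD ?RintegralZl //; exact: I1.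
Qed.

Lemma carea_conj E h : measurable E -> cintegrable E h -> carea E (fun p => (h p)^*%C) = (carea E h)^*%C.
Proof.
move=> mE [r1 i1]; apply: eqC; rewrite /carea ?ReImE /=.
  by under eq_Rintegral do rewrite ReJ.
under eq_Rintegral do rewrite ImJ -mulN1r; rewrite RintegralZl ?mulN1r //.
Qed.

Lemma eq_carea E h1 h2 : (forall p, E p -> h1 p = h2 p) -> carea E h1 = carea E h2.
Proof.
by move=> H; apply: eqC; rewrite /carea /=; apply: eq_Rintegral => p; rewrite inE => /H ->.
Qed.

Lemma carea_le E h (w : TT -> R) : measurable E -> cmeas E h ->
  ar.-integrable E (fun p => (w p)%:E) -> (forall p, E p -> cn (h p) <= w p) ->
  cn (carea E h) <= 2 * (\int[ar]_(p in E) w p)%R.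
Proof.
move=> mE mh iw H; have [ir ii] := cintegrable_le mE mh iw H.
apply: le_trans (cn_le_ReIm _) _; rewrite mulr_natl mulr2n /carea /=; apply: lerD.
  apply: le_trans (le_normr_Rintegral mE ir) _; apply: le_Rintegral => //.
    by apply: (@eq_integrable _ _ _ _ _ mE (fun p => `|(Re (h p))%:E|)%E) => //; exact: integrable_abse.
  by move=> p Ep; rewrite (le_trans (Re_le_cn _)) // H.
apply: le_trans (le_normr_Rintegral mE ii) _; apply: le_Rintegral => //.
  by apply: (@eq_integrable _ _ _ _ _ mE (fun p => `|(Im (h p))%:E|)%E) => //; exact: integrable_abse.
by move=> p Ep; rewrite (le_trans (Im_le_cn _)) // H.
Qed.

Lemma carea_rot E (c s : R) h : c ^+ 2 + s ^+ 2 = 1 -> c != -1 -> measurable E ->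
  rotR c s @^-1` E = E -> cmeas setT h -> cintegrable E (fun p => h (rotR c s p)) ->
  carea E (fun p => h (rotR c s p)) = carea E h.
Proof.
move=> cs c1 mE rE [mr mi] [ir ii].
have key (F : TT -> R) : measurable_fun setT (F : TT -> T) ->
    ar.-integrable E (fun p => (F (rotR c s p))%:E) ->
    (\int[ar]_(p in E) F (rotR c s p))%R = (\int[ar]_(p in E) F p)%R.
  move=> mF iF; rewrite /Rintegral; congr fine.
  have mF' : measurable_fun setT (fun p : TT => (F p)%:E) by exact/measurable_EFinP.
  have iF' : ar.-integrable (rotR c s @^-1` E) ((fun p => (F p)%:E) \o rotR c s) by rewrite rE.
  have H := integral_pushforward (measurable_rotR c s) mF' iF' mE.
  rewrite rE in H; rewrite -[LHS]H; apply: eq_measure_integral; first exact: measurable_rotR.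
  by move=> ? A mA _; exact: (areaR_rot cs c1 mA).
by apply: eqC; rewrite /carea /=; exact: key.
Qed.

End area_integrals.

(** * The weighted L^2 inner product and power series *)

Section weighted_L2.
Variables (R : realType) (alpha : R).
Hypothesis a1 : -1 < alpha.
Local Notation C := R[i].
Local Notation T := (measurableTypeR R).
Local Notation TT := (measurableTypeR R * measurableTypeR R)%type.
Local Notation ar := (@lebesgue_measure R \x @lebesgue_measure R)%E.
Local Notation D := (@diskR R : set TT).
Local Notation w := (bweight alpha : TT -> R).
Local Open Scope classical_set_scope.
Implicit Types (f g : C -> C) (h : TT -> C) (E : set TT).

Lemma measurable_bweight E : measurable_fun E (w : TT -> T).
Proof.
apply: measurable_funTS; apply: (measurableT_comp (measurable_powR _)).
by apply: measurable_funB => //; exact: measurable_rho.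
Qed.

Lemma bweight_ge0 p : 0 <= w p.
Proof. exact: powR_ge0. Qed.
Hint Extern 0 (is_true (@Order.le _ _ _ (bweight _ _))) => exact: bweight_ge0 : core.

(** [s] bounds the squared radius, and [dk 1] is the unit disk by conversion. *)
Definition dk (s : R) : set TT := [set p | rho p < s].

Lemma measurable_dk s : measurable (dk s).
Proof.
have -> : dk s = @rho R @^-1` `]-oo, s[ by apply/seteqP; split => p; rewrite /= in_itv.
by rewrite -[X in measurable X]setTI; apply: measurable_rho.
Qed.

Lemma measurable_diskR : measurable D.
Proof. exact: (measurable_dk 1). Qed.

Lemma cn_pt2 (p : TT) : cn (pt p) ^+ 2 = rho p.
Proof. by rewrite cn_sqr. Qed.

Lemma D_cn_pt (p : TT) : D p <-> cn (pt p) < 1.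
Proof. by rewrite /diskR /= -/(rho p) -cn_pt2 expr_lt1. Qed.

Lemma integrable_bweight : ar.-integrable D (fun p => (w p)%:E).
Proof.
apply/integrableP; split; first by apply/measurable_EFinP; exact: measurable_bweight.
have := disk_moment a1 0; under eq_integral do rewrite expr0 mul1r.
under [X in (X < _)%E]eq_integral do rewrite gee0_abs ?lee_fin //.
by move=> H; rewrite [X in (X < _)%E]H ltry.
Qed.

(** Lacks the factor (alpha + 1) / pi of [ipA2], restored in [ipA2E]. The domain varies because
    Bessel's inequality is established on smaller disks before the whole one. *)
Definition ip E f g : C := carea E (fun p => f (pt p) * (g (pt p))^*%C * (w p)%:C).

Definition N2 E f : \bar R := (\int[ar]_(p in E) (cn (f (pt p)) ^+ 2 * w p)%:E)%E.

Definition L2 E f := cmeas E (fun p => f (pt p)) /\ (N2 E f < +oo)%E.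

(** [fine] sends infinity to 0, so this is the squared norm only under [L2]. *)
Definition n2 E f : R := fine (N2 E f).

Lemma N2_ge0 E f : (0 <= N2 E f)%E.
Proof. by apply: integral_ge0 => p _; rewrite lee_fin mulr_ge0 ?sqr_ge0. Qed.

Lemma n2_ge0 E f : 0 <= n2 E f.
Proof. by apply: fine_ge0; exact: N2_ge0. Qed.

Lemma L2_N2 E f : L2 E f -> N2 E f = (n2 E f)%:E.
Proof. by move=> [_ h]; rewrite /n2 fineK // ge0_fin_numE // N2_ge0. Qed.

Lemma L2_integrable E f : measurable E -> L2 E f ->
  ar.-integrable E (fun p => (cn (f (pt p)) ^+ 2 * w p)%:E).
Proof.
move=> mE [mf h]; apply/integrableP; split.
  apply/measurable_EFinP; apply: measurable_funM; first exact: cmeas_cn2.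
  exact: measurable_bweight.
move: h; rewrite /N2; under [X in (_ -> X < _)%E]eq_integral do rewrite gee0_abs ?lee_fin ?mulr_ge0 ?sqr_ge0 //.
by [].
Qed.

Lemma N2_ReIm f : N2 D f = (\int[@areaR R]_(p in D)
  ((Re (f (pt p)) ^+ 2 + Im (f (pt p)) ^+ 2) * bweight alpha p)%:E)%E.
Proof. by apply: eq_integral => p _; rewrite cn_sqr. Qed.

Lemma eq_N2 E f g : (forall p, E p -> f (pt p) = g (pt p)) -> N2 E f = N2 E g.
Proof. by move=> H; apply: eq_integral => p; rewrite inE => /H ->. Qed.

Lemma eq_ip E f1 f2 g1 g2 : (forall p, E p -> f1 (pt p) = f2 (pt p)) ->
  (forall p, E p -> g1 (pt p) = g2 (pt p)) -> ip E f1 g1 = ip E f2 g2.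
Proof. by move=> H1 H2; apply: eq_carea => p Ep; rewrite H1 ?H2. Qed.

Lemma eq_L2 E f g : (forall p, E p -> f (pt p) = g (pt p)) -> L2 E f -> L2 E g.
Proof.
move=> H [mf hf]; split; last by rewrite -(eq_N2 H).
split; [apply: eq_measurable_fun mf.1 | apply: eq_measurable_fun mf.2];
  by move=> p; rewrite inE => /H ->.
Qed.

Lemma bounded_L2 E f (M : R) : measurable E -> E `<=` D -> cmeas E (fun p => f (pt p)) ->
  (forall p, E p -> cn (f (pt p)) <= M) -> L2 E f.
Proof.
move=> mE ED mf H; split => //.
have iw : ar.-integrable E (fun p => (M ^+ 2 * w p)%:E).
  have iw1 : ar.-integrable E (fun p => (w p)%:E).
    exact: integrableS measurable_diskR mE ED integrable_bweight.
  by rewrite (_ : (fun p => _) = (fun p => (M ^+ 2)%:E * (w p)%:E)%E) //; exact: integrableZl.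
have : ar.-integrable E (fun p => (cn (f (pt p)) ^+ 2 * w p)%:E).
  apply: (le_integrable mE _ _ iw).
    apply/measurable_EFinP; apply: measurable_funM; first exact: cmeas_cn2.
    exact: measurable_bweight.
  move=> p Ep; have fM : cn (f (pt p)) ^+ 2 <= M ^+ 2.
    by apply: lerXn2r; rewrite ?nnegrE ?(le_trans (cn_ge0 _) (H p Ep)) //; exact: H.
  rewrite !gee0_abs ?lee_fin ?(mulr_ge0 (sqr_ge0 _) (bweight_ge0 p)) //.
  by apply: ler_wpM2r.
move=> /integrableP[_]; rewrite /N2.
by under eq_integral do rewrite gee0_abs ?lee_fin ?mulr_ge0 ?sqr_ge0 //.
Qed.

Section fixed_domain.
Variable E : set TT.
Hypothesis mE : measurable E.

Lemma cmeas_ip f g : cmeas E (fun p => f (pt p)) -> cmeas E (fun p => g (pt p)) ->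
  cmeas E (fun p => f (pt p) * (g (pt p))^*%C * (w p)%:C).
Proof.
move=> mf mg; apply: cmeasM; first by apply: cmeasM => //; exact: cmeas_conj.
by apply: cmeas_real; exact: measurable_bweight.
Qed.

(** Weighted arithmetic-geometric inequality; with [t] free it serves, once integrated, in place of
    Cauchy-Schwarz. *)
Lemma ip_bound f g (t : R) p : 0 < t ->
  cn (f (pt p) * (g (pt p))^*%C * (w p)%:C) <=
  t / 2 * (cn (f (pt p)) ^+ 2 * w p) + t^-1 / 2 * (cn (g (pt p)) ^+ 2 * w p).
Proof.
move=> t0; rewrite !cnM cn_conj cn_real ger0_norm // !mulrA -mulrDl (ler_wpM2r (bweight_ge0 p)) //.
set x := cn _; set y := cn _.
have ti : t * t^-1 = 1 by rewrite divff // gt_eqF.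
have ti0 : 0 < t^-1 by rewrite invr_gt0.
have : 0 <= t^-1 * (t * x - y) ^+ 2 by rewrite mulr_ge0 ?sqr_ge0 // ltW.
have -> : t^-1 * (t * x - y) ^+ 2 = (t * t^-1) * (t * x ^+ 2) - (t * t^-1) * (2 * x * y) + t^-1 * y ^+ 2 by ring.
rewrite ti; lra.
Qed.

Lemma integrable_comb f g (x y : R) : L2 E f -> L2 E g ->
  ar.-integrable E (fun p => (x * (cn (f (pt p)) ^+ 2 * w p) + y * (cn (g (pt p)) ^+ 2 * w p))%:E).
Proof.
move=> hf hg.
have iZ k (F : TT -> R) : ar.-integrable E (fun p => (F p)%:E) -> ar.-integrable E (fun p => (k * F p)%:E).
  by move=> iF; rewrite (_ : (fun p => _) = (fun p => k%:E * (F p)%:E)%E) //; exact: integrableZl.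
have i1 := iZ x _ (L2_integrable mE hf); have i2 := iZ y _ (L2_integrable mE hg).
by have := integrableD mE i1 i2.
Qed.

Lemma ip_integrable f g : L2 E f -> L2 E g ->
  cintegrable E (fun p => f (pt p) * (g (pt p))^*%C * (w p)%:C).
Proof.
move=> hf hg; apply: cintegrable_le mE _ (integrable_comb (1 / 2) (1^-1 / 2) hf hg) _.
  by apply: cmeas_ip; [case: hf | case: hg].
by move=> p _; apply: ip_bound.
Qed.

Lemma Rint_n2 f (x : R) : L2 E f ->
  (\int[ar]_(p in E) (x * (cn (f (pt p)) ^+ 2 * w p)))%R = x * n2 E f.
Proof. by move=> hf; rewrite RintegralZl //; exact: L2_integrable. Qed.

(** The factor 2 of [carea_le] cancels the two halves in [ip_bound]. *)
Lemma ip_le f g (t : R) : 0 < t -> L2 E f -> L2 E g ->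
  cn (ip E f g) <= t * n2 E f + t^-1 * n2 E g.
Proof.
move=> t0 hf hg.
have := carea_le mE (cmeas_ip hf.1 hg.1) (integrable_comb (t / 2) (t^-1 / 2) hf hg).
move=> /(_ (fun p _ => ip_bound f g p t0)) H; apply: le_trans H _.
have iZ k (F : TT -> R) : ar.-integrable E (fun p => (F p)%:E) -> ar.-integrable E (fun p => (k * F p)%:E).
  by move=> iF; rewrite (_ : (fun p => _) = (fun p => k%:E * (F p)%:E)%E) //; exact: integrableZl.
rewrite RintegralD //; [|exact/iZ/L2_integrable|exact/iZ/L2_integrable].
rewrite !Rint_n2 // le_eqVlt; apply/orP; left; apply/eqP.
by field; rewrite gt_eqF.
Qed.

Lemma L2D f g : L2 E f -> L2 E g -> L2 E (fun z => f z + g z).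
Proof.
move=> hf hg; split; first by apply: cmeasD; [case: hf | case: hg].
have /integrableP[mI hI] := integrable_comb 2 2 hf hg.
apply: le_lt_trans hI; apply: ge0_le_integral => //.
- by move=> p _; rewrite lee_fin mulr_ge0 ?sqr_ge0.
- apply/measurable_EFinP; apply: measurable_funM; last exact: measurable_bweight.
  by apply: cmeas_cn2; apply: cmeasD; [case: hf | case: hg].
- exact: measurableT_comp.
- move=> p _; rewrite lee_fin ger0_norm; last by rewrite addr_ge0 // mulr_ge0 // mulr_ge0 ?sqr_ge0.
  rewrite mulrA [2 * (cn (g _) ^+ 2 * _)]mulrA -mulrDl (ler_wpM2r (bweight_ge0 p)) //.
  have := cnD (f (pt p)) (g (pt p)); set x := cn (f _); set y := cn (g _); set s := cn (_ + _) => H.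
  have x0 : 0 <= x by exact: cn_ge0.
  have y0 : 0 <= y by exact: cn_ge0.
  have s0 : 0 <= s by exact: cn_ge0.
  have : s ^+ 2 <= (x + y) ^+ 2 by apply: lerXn2r; rewrite ?nnegrE ?addr_ge0.
  have := sqr_ge0 (x - y); nra.
Qed.

Lemma L2Z k f : L2 E f -> L2 E (fun z => k * f z).
Proof.
move=> hf; split; first by apply: cmeasM; [exact: cmeas_cst | case: hf].
have /integrableP[mI hI] := integrable_comb (cn k ^+ 2) 0 hf hf.
apply: le_lt_trans hI; apply: ge0_le_integral => //.
- by move=> p _; rewrite lee_fin mulr_ge0 ?sqr_ge0.
- apply/measurable_EFinP; apply: measurable_funM; last exact: measurable_bweight.
  by apply: cmeas_cn2; apply: cmeasM; [exact: cmeas_cst | case: hf].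
- exact: measurableT_comp.
- move=> p _; rewrite lee_fin mul0r addr0 ger0_norm; last by rewrite !mulr_ge0 ?sqr_ge0.
  by rewrite cnM exprMn mulrA.
Qed.

Lemma L2_sum n (F : nat -> C -> C) : L2 E (fun=> 0) -> (forall k, L2 E (F k)) ->
  L2 E (fun z => \sum_(k < n) F k z).
Proof.
move=> h0 H; elim: n => [|n IH]; first by under eq_fun do rewrite big_ord0.
by under eq_fun do rewrite big_ord_recr /=; exact: L2D.
Qed.

Lemma ipD f1 f2 g : L2 E f1 -> L2 E f2 -> L2 E g ->
  ip E (fun z => f1 z + f2 z) g = ip E f1 g + ip E f2 g.
Proof.
move=> h1 h2 hg; rewrite /ip -careaD //; try exact: ip_integrable.
by apply: eq_carea => p _; ring.
Qed.

Lemma ipZ k f g : L2 E f -> L2 E g -> ip E (fun z => k * f z) g = k * ip E f g.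
Proof.
move=> hf hg; rewrite /ip -careaZ //; last exact: ip_integrable.
by apply: eq_carea => p _; ring.
Qed.

Lemma ip_conj f g : L2 E f -> L2 E g -> ip E g f = (ip E f g)^*%C.
Proof.
move=> hf hg; rewrite /ip -carea_conj //; last exact: ip_integrable.
apply: eq_carea => p _; case: (f _) (g _) => [x y] [x' y'].
by apply: eqC => /=; ring.
Qed.

Lemma ip_sum n (F : nat -> C -> C) g : L2 E (fun=> 0) -> (forall k, L2 E (F k)) -> L2 E g ->
  ip E (fun z => \sum_(k < n) F k z) g = \sum_(k < n) ip E (F k) g.
Proof.
move=> h0 H hg; elim: n => [|n IH].
  rewrite big_ord0 /ip (@eq_carea _ _ _ (fun p => 0 * (0 * (g (pt p))^*%C * (w p)%:C))).
    by rewrite careaZ ?mul0r //; exact: (ip_integrable h0 hg).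
  by move=> p _; rewrite big_ord0 !mul0r.
rewrite big_ord_recr /= -IH -ipD //; last exact: L2_sum.
by apply: eq_ip => // p _; rewrite big_ord_recr.
Qed.

Lemma ip_self f : ip E f f = (n2 E f)%:C.
Proof.
apply: eqC; rewrite /ip /carea /=.
  rewrite /n2 /N2 /Rintegral; congr fine; apply: eq_integral => p _; congr EFin.
  by rewrite cn_mulJ -rmorphM.
transitivity (\int[ar]_(p in E) (fun=> 0 : R) p)%R; last by rewrite Rintegral_cst // mul0r.
by apply: eq_Rintegral => p _; rewrite cn_mulJ -rmorphM.
Qed.

End fixed_domain.

End weighted_L2.

(** * Orthogonality of monomials, Bessel and Parseval *)

Section bergman_series.
Variables (R : realType) (alpha : R).
Hypothesis a1 : -1 < alpha.
Local Notation C := R[i].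
Local Notation TT := (measurableTypeR R * measurableTypeR R)%type.
Local Notation ar := (@lebesgue_measure R \x @lebesgue_measure R)%E.
Local Notation ci := (0 +i* 1 : C).
Local Notation D := (@diskR R : set TT).
Local Notation w := (bweight alpha : TT -> R).
Local Notation ip := (ip alpha).
Local Notation N2 := (N2 alpha).
Local Notation n2 := (n2 alpha).
Local Notation L2 := (L2 alpha).
Local Open Scope classical_set_scope.
Implicit Types (f g : C -> C) (h : TT -> C) (E : set TT) (a : nat -> C).

Lemma rho_rotR (c s : R) (p : TT) : c ^+ 2 + s ^+ 2 = 1 -> rho (rotR c s p) = rho p.
Proof.
move=> cs; rewrite /rho /=; transitivity ((c ^+ 2 + s ^+ 2) * (p.1 ^+ 2 + p.2 ^+ 2)); last by rewrite cs mul1r.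
by ring.
Qed.

Lemma pt_rotR (t : R) (p : TT) : pt (rotR (cos t) (sin t) p) = cis t * pt p.
Proof. by apply: eqC; rewrite ?ReM ?ImM /=; ring. Qed.

Lemma dk_sub (s : R) : s <= 1 -> dk s `<=` D.
Proof. by move=> s1 p /= h; exact: lt_le_trans s1. Qed.

Definition mono n (z : C) : C := z ^+ n.

Lemma mono_L2 s n : s <= 1 -> L2 (dk s) (mono n).
Proof.
move=> s1; apply: (bounded_L2 a1 (M := 1)); first exact: measurable_dk.
- exact: dk_sub.
- exact: cmeasX (cmeas_pt _).
by move=> p /(dk_sub s1)/D_cn_pt h; rewrite cnX exprn_ile1 // ltW.
Qed.

Lemma L2_0 s : s <= 1 -> L2 (dk s) (fun=> 0).
Proof.
move=> s1; apply: (bounded_L2 a1 (M := 0)); [exact: measurable_dk | exact: dk_sub | exact: cmeas_cst |].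
by move=> p _; rewrite cn0.
Qed.

(* A rotation by pi / (2 (n - m)) multiplies z ^+ n * conj (z ^+ m) by i. *)
Lemma mono_orth_lt s n m : s <= 1 -> (m < n)%N -> ip (dk s) (mono n) (mono m) = 0.
Proof.
move=> s1 mn; pose d : R := (n - m)%:R; pose t := pi / (2 * d).
have d1 : 1 <= d by rewrite ler1n subn_gt0.
have d0 : 0 < d by lra.
have dt : d * t = pi / 2 by rewrite /t; field; rewrite gt_eqF.
have t0 : 0 <= t by rewrite divr_ge0 ?pi_ge0 // mulr_ge0 // ltW.
have t2 : t <= pi / 2.
  by rewrite -dt ler_peMl.
(* The angle lies in [0, pi/2], which keeps the cosine off the value -1 excluded by [areaR_rot]. *)
have c0 : 0 <= cos t.
  by rewrite cos_ge0_pihalf // t2 andbT (le_trans _ t0) // oppr_le0 divr_ge0 // pi_ge0.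
have c1 : cos t != -1 by apply/eqP => h; move: c0; rewrite h; lra.
have cs : cos t ^+ 2 + sin t ^+ 2 = 1 := cos2Dsin2 t.
pose h p := mono n (pt p) * (mono m (pt p))^*%C * (w p)%:C.
have mE : measurable (dk s : set TT) by exact: measurable_dk.
have mh E : cmeas E h.
  apply: cmeasM; last by apply: cmeas_real; exact: measurable_bweight.
  by apply: cmeasM; [|apply: cmeas_conj]; exact: cmeasX (cmeas_pt _).
have wr p : w (rotR (cos t) (sin t) p) = w p by rewrite /bweight -!/(rho _) rho_rotR.
have hr p : h (rotR (cos t) (sin t) p) = ci * h p.
  rewrite /h wr pt_rotR /mono.
  have key (c z : C) (v : R) : c * c^*%C = 1 -> c ^+ n = c ^+ m * ci ->
      (c * z) ^+ n * ((c * z) ^+ m)^*%C * v%:C = ci * (z ^+ n * (z ^+ m)^*%C * v%:C).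
    move=> cc cn'; rewrite !exprMn cn' rmorphM /= rmorphXn /=.
    transitivity ((c * c^*%C) ^+ m * (ci * (z ^+ n * (z ^+ m)^*%C * v%:C))); first by rewrite exprMn; ring.
    by rewrite cc expr1n mul1r.
  apply: key; first by rewrite cn_mulJ cn_cis expr1n.
  rewrite -(subnKC (ltnW mn)) exprD; congr (_ * _); rewrite cisX -/d dt.
  by apply: eqC; rewrite /= ?cos_pihalf ?sin_pihalf.
have ih : cintegrable (dk s) h by apply: ip_integrable => //; exact: mono_L2.
have rE : rotR (cos t) (sin t) @^-1` (dk s) = dk s.
  by apply/seteqP; split => p /=; rewrite /dk /= rho_rotR.
have := carea_rot cs c1 mE rE (mh setT).
have -> : (fun p => h (rotR (cos t) (sin t) p)) = (fun p => ci * h p) by apply/funext => p; exact: hr.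
rewrite careaZ // => H.
have : cintegrable (dk s) (fun p => ci * h p).
  apply: (cintegrable_le mE (w := fun p => 1 / 2 * (cn (mono n (pt p)) ^+ 2 * w p) + 1^-1 / 2 * (cn (mono m (pt p)) ^+ 2 * w p))).
  - by apply: cmeasM => //; exact: cmeas_cst.
  - by apply: integrable_comb => //; exact: mono_L2.
  - by move=> p _; rewrite cnM cn_ci mul1r; apply: ip_bound.
(* Rotation invariance says that the pairing equals i times itself, hence vanishes. *)
move=> /H; rewrite -[carea _ _]/(ip (dk s) (mono n) (mono m)) => /eqP.
rewrite -subr_eq0 -{2}[ip _ _ _]mul1r -mulrBl mulf_eq0 => /orP[|/eqP //].
by rewrite subr_eq0 => /eqP/(congr1 (@complex.Re R)) /= /eqP; rewrite eq_sym oner_eq0.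
Qed.

Lemma mono_orth s n m : s <= 1 -> n != m -> ip (dk s) (mono n) (mono m) = 0.
Proof.
move=> s1; case: (ltngtP n m) => // h _; last exact: mono_orth_lt.
have mE : measurable (dk s : set TT) by exact: measurable_dk.
by rewrite (ip_conj mE) ?mono_orth_lt ?conjc0 //; exact: mono_L2.
Qed.

Definition gs s n := n2 (dk s) (mono n).

Lemma amono_L2 s a k : s <= 1 -> L2 (dk s) (fun z => a k * mono k z).
Proof. by move=> s1; apply: L2Z; [exact: measurable_dk | exact: mono_L2]. Qed.

Lemma cpart_L2 s a N : s <= 1 -> L2 (dk s) (fun z => cpart a z N).
Proof.
move=> s1; have mE : measurable (dk s : set TT) by exact: measurable_dk.
exact: (L2_sum mE N (F := fun k z => a k * mono k z) (L2_0 s1) (fun k => amono_L2 a k s1)).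
Qed.

Lemma ip_cpart s a N g : s <= 1 -> L2 (dk s) g ->
  ip (dk s) (fun z => cpart a z N) g = \sum_(k < N) a k * ip (dk s) (mono k) g.
Proof.
move=> s1 hg; have mE : measurable (dk s : set TT) by exact: measurable_dk.
transitivity (\sum_(k < N) ip (dk s) (fun z => a k * mono k z) g).
  exact: (ip_sum mE N (F := fun k z => a k * mono k z) (L2_0 s1) (fun k => amono_L2 a k s1)).
by apply: eq_bigr => k _; rewrite (ipZ mE) //; exact: mono_L2.
Qed.

Lemma ip_cpart_mono s a N m : s <= 1 -> (m < N)%N ->
  ip (dk s) (fun z => cpart a z N) (mono m) = a m * (gs s m)%:C.
Proof.
move=> s1 mN; rewrite ip_cpart //; last exact: mono_L2.
rewrite (bigD1 (Ordinal mN)) //= ip_self; last exact: measurable_dk.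
rewrite big1 ?addr0 // => k km; by rewrite mono_orth ?mulr0.
Qed.

Lemma n2_cpart s a N : s <= 1 -> n2 (dk s) (fun z => cpart a z N) = \sum_(k < N) cn (a k) ^+ 2 * gs s k.
Proof.
move=> s1; apply: complexI; rewrite -ip_self; last exact: measurable_dk.
have mE : measurable (dk s : set TT) by exact: measurable_dk.
rewrite ip_cpart //; last exact: cpart_L2.
rewrite rmorph_sum; apply: eq_bigr => k _ /=.
rewrite (ip_conj mE (cpart_L2 a N s1) (mono_L2 k s1)) ip_cpart_mono //.
have -> : (a k * (gs s k)%:C)^*%C = (a k)^*%C * (gs s k)%:C.
  by rewrite rmorphM; congr (_ * _); exact: conjc_real.
by rewrite mulrA cn_mulJ -rmorphM.
Qed.

Lemma gs1 n : gs 1 n = pi / (alpha + 1) * gam alpha n.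
Proof.
rewrite /gs /n2; have := disk_moment a1 n; rewrite /N2.
have -> : (\int[ar]_(p in dk 1) (cn (mono n (pt p)) ^+ 2 * w p)%:E =
   \int[@areaR R]_(p in @diskR R) (rho p ^+ n * bweight alpha p)%:E)%E.
  by apply: eq_integral => p _; rewrite cnX exprAC cn_pt2.
by move=> ->; rewrite /=; ring.
Qed.

Lemma gs_ge0 s n : 0 <= gs s n. Proof. exact: n2_ge0. Qed.

Lemma psum_cmeas a E : measurable E -> E `<=` D -> growth a -> cmeas E (fun p => psum a (pt p)).
Proof.
move=> mE ED ga; apply: (@cmeas_lim _ E (fun n p => cpart a (pt p) n)) => //.
  move=> n; apply: (@cmeas_sum _ E n (fun k p => a k * pt p ^+ k)) => k; apply: cmeasM; first exact: cmeas_cst.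
  exact: cmeasX (cmeas_pt _).
by move=> p /ED/D_cn_pt h; exact: ccvg_psum.
Qed.

Lemma ccvg_cn2w (u : nat -> C) l (y : R) : ccvg u l ->
  ((fun n => (cn (u n) ^+ 2 * y)%:E) @ \oo --> (cn l ^+ 2 * y)%:E)%classic.
Proof.
move=> ul; apply: cvg_EFin; first exact: nearW.
have cu : (fun n => cn (u n)) @ \oo --> cn l.
  apply/cvgrPdist_le => e /ul[N H]; exists N => // n /H h.
  by apply: le_trans (cn_dist _ _) _; rewrite cn_distC.
have H : (fun n => cn (u n) ^+ 2 * y) @ \oo --> cn l ^+ 2 * y by apply: cvgM; [apply: cvgM | exact: cvg_cst].
exact: H.
Qed.

Lemma measurable_N2 E f : cmeas E (fun p => f (pt p)) ->
  measurable_fun E (fun p => (cn (f (pt p)) ^+ 2 * w p)%:E).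
Proof.
move=> mf; apply/measurable_EFinP; apply: measurable_funM; first exact: cmeas_cn2.
exact: measurable_bweight.
Qed.

(** On the disk the squared modulus of the sum is the pointwise limit of those of the partial sums,
    so a uniform bound on their integrals survives in the lower limit. *)
Lemma fatou_psum a (K : R) : growth a -> (forall M, n2 D (fun z => cpart a z M) <= K) ->
  (N2 D (psum a) <= K%:E)%E.
Proof.
move=> ga HK; have mD := @measurable_diskR R.
have hp M : L2 D (fun z => cpart a z M) by apply: cpart_L2; exact: lexx.
have H := @fatou _ _ _ ar D mD (fun M p => (cn (cpart a (pt p) M) ^+ 2 * w p)%:E).
have -> : N2 D (psum a) = (\int[ar]_(p in D) limn_einf (fun M => (cn (cpart a (pt p) M) ^+ 2 * w p)%:E))%E.
  apply: eq_integral => p; rewrite inE => /D_cn_pt h.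
  have cv := @ccvg_cn2w _ _ (bweight alpha p) (ccvg_psum ga h).
  by rewrite is_cvg_limn_einfE; [rewrite (cvg_lim _ cv) | apply/cvg_ex; eexists; exact: cv].
have H1 M : measurable_fun D (fun p => (cn (cpart a (pt p) M) ^+ 2 * w p)%:E).
  by apply: (@measurable_N2 _ (fun z => cpart a z M)); case: (hp M).
have H2 M p : D p -> (0 <= (cn (cpart a (pt p) M) ^+ 2 * w p)%:E)%E.
  by move=> _; rewrite lee_fin mulr_ge0 ?sqr_ge0 // bweight_ge0.
apply: (le_trans (H H1 H2)).
rewrite limn_einf_lim; apply: lime_le; first exact: is_cvg_einfs.
apply: nearW => M; apply: (@le_trans _ _ (N2 D (fun z => cpart a z M))).
  by apply: ereal_inf_lbound; exists M => //=.
by rewrite L2_N2 // lee_fin.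
Qed.

Lemma growth_sqr_summable_partial a s : growth a -> 0 <= s -> s < 1 ->
  exists B, forall p N, dk s p -> cn (cpart a (pt p) N) <= B.
Proof.
move=> ga s0 s1.
(* [s] is a squared radius, hence the square root. *)
have q1 : Num.sqrt s < 1 by rewrite -sqrtr1 ltr_sqrt.
have [B HB] := growth_summable ga (sqrtr_ge0 s) q1.
exists B => p N ps; apply: le_trans (HB N); apply: le_trans (cn_sum _ _ _) _.
apply: ler_sum => k _; rewrite cnM cnX (ler_wpM2l (cn_ge0 _)) //.
apply: lerXn2r; rewrite ?nnegrE ?sqrtr_ge0 //.
by rewrite -[leLHS]ger0_norm ?cn_ge0 // -sqrtr_sqr ler_wsqrtr // cn_pt2; exact: ltW.
Qed.

Lemma n2_cpart_mono s a N M : s <= 1 -> (N <= M)%N ->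
  n2 (dk s) (fun z => cpart a z N) <= n2 (dk s) (fun z => cpart a z M).
Proof.
move=> s1 NM; rewrite !n2_cpart //.
rewrite -(subnKC NM) -(big_mkord xpredT (fun k => cn (a k) ^+ 2 * gs s k)).
rewrite -(big_mkord xpredT (fun k => cn (a k) ^+ 2 * gs s k)) (@big_cat_nat _ _ _ N 0 (N + (M - N))) ?leq_addr //=.
by rewrite lerDl sumr_ge0 // => k _; rewrite mulr_ge0 ?sqr_ge0 // gs_ge0.
Qed.

(* For [s < 1] the partial sums are uniformly bounded on [dk s], so dominated convergence applies. *)
Lemma bessel_dk a s N : growth a -> 0 <= s -> s < 1 ->
  (N2 (dk s) (fun z => cpart a z N) <= N2 (dk s) (psum a))%E.
Proof.
move=> ga s0 s1; have mE : measurable (dk s : set TT) by exact: measurable_dk.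
have s1' := ltW s1.
have [B HB] := growth_sqr_summable_partial ga s0 s1.
have iw : ar.-integrable (dk s) (fun p => (B ^+ 2 * w p)%:E).
  have iw1 : ar.-integrable (dk s) (fun p => (w p)%:E).
    exact: integrableS (@measurable_diskR R) mE (dk_sub s1') (integrable_bweight a1).
  by rewrite (_ : (fun p => _) = (fun p => (B ^+ 2)%:E * (w p)%:E)%E) //; exact: integrableZl.
have [||||_ _ cv] := @dominated_convergence _ _ _ ar (dk s) mE
  (fun M p => (cn (cpart a (pt p) M) ^+ 2 * w p)%:E) (fun p => (cn (psum a (pt p)) ^+ 2 * w p)%:E)
  (fun p => (B ^+ 2 * w p)%:E) _ _ _ iw.
- by move=> M; apply: (@measurable_N2 _ (fun z => cpart a z M)); case: (@cpart_L2 s a M s1').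
- by apply: (@measurable_N2 _ (psum a)); apply: psum_cmeas => //; exact: dk_sub.
- apply: aeW => p ps; apply: ccvg_cn2w; apply: ccvg_psum => //; exact/D_cn_pt/(dk_sub s1').
- apply: aeW => p M ps; rewrite gee0_abs ?lee_fin ?mulr_ge0 ?sqr_ge0 ?bweight_ge0 //.
  rewrite ler_wpM2r ?bweight_ge0 //; apply: lerXn2r; rewrite ?nnegrE ?HB //.
  exact: le_trans (cn_ge0 _) (HB p M ps).
have {}cv : N2 (dk s) (fun z => cpart a z M) @[M --> \oo] --> N2 (dk s) (psum a) by exact: cv.
rewrite -(cvg_lim _ cv) //; apply: lime_ge; first by apply/cvg_ex; eexists; exact: cv.
exists N => // M NM; rewrite /= !L2_N2 ?lee_fin ?n2_cpart_mono //; exact: cpart_L2.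
Qed.

(** The squared radius increases to 1 in [bessel_dk]: the left side converges by monotone
    convergence over growing disks, the right side is at most the integral over the whole disk. *)
Lemma bessel a N : growth a -> L2 D (psum a) -> n2 D (fun z => cpart a z N) <= n2 D (psum a).
Proof.
move=> ga hf; have mD := @measurable_diskR R.
have hp : L2 D (fun z => cpart a z N) by apply: cpart_L2; exact: lexx.
rewrite -lee_fin -!L2_N2 //.
pose r_ (k : nat) : R := 1 - k.+1%:R^-1.
have r0 k : 0 <= r_ k by rewrite subr_ge0 invf_le1 // ler1n.
have r1 k : r_ k < 1 by rewrite ltrBlDr ltrDl invr_gt0.
have DE : (D : set TT) = \bigcup_k dk (r_ k).
  apply/seteqP; split => p.
    move=> pD; have x1 : 0 < 1 - rho p by rewrite subr_gt0.
    have /cvgrPdist_lt/(_ _ x1)[K _ HK] := @cvg_harmonic R.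
    exists K => //=; have := HK K (leqnn _); rewrite /= sub0r normrN ger0_norm ?invr_ge0 // => h.
    by rewrite /dk /= /r_ ltrBrDr addrC -ltrBrDr.
  by move=> [k _]; apply: dk_sub; exact: ltW.
have cv : N2 (dk (r_ k)) (fun z => cpart a z N) @[k --> \oo] --> N2 D (fun z => cpart a z N).
  rewrite /(N2 D _) DE; apply: ge0_nondecreasing_set_cvg_integral.
  - apply/nondecreasing_seqP => k; rewrite subsetEset => p /= h; apply: lt_le_trans h _.
    by rewrite /r_ lerD2l lerN2 lef_pV2 ?posrE // ler_nat.
  - by move=> k; exact: measurable_dk.
  - by move=> k; apply: (@measurable_N2 _ (fun z => cpart a z N)); case: (@cpart_L2 (r_ k) a N (ltW (r1 k))).
  - by move=> k p _; rewrite lee_fin mulr_ge0 ?sqr_ge0 // bweight_ge0.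
rewrite -(cvg_lim _ cv) //; apply: lime_le; first by apply/cvg_ex; eexists; exact: cv.
apply: nearW => k; apply: le_trans (bessel_dk N ga (r0 k) (r1 k)) _.
apply: ge0_subset_integral => //.
- exact: measurable_dk.
- by apply: (@measurable_N2 _ (psum a)); case: hf.
- by move=> p _; rewrite lee_fin mulr_ge0 ?sqr_ge0 // bweight_ge0.
- exact: dk_sub (ltW (r1 k)).
Qed.

(** Makes the remainder a power series in its own right, to which [fatou_psum] applies. *)
Definition tailc a N k : C := if (k < N)%N then 0 else a k.

Lemma growth_tailc a N : growth a -> growth (tailc a N).
Proof.
move=> ga r r0 r1; have [M HM] := ga r r0 r1; exists M => n; rewrite /tailc; case: ifP => _ //.
by rewrite cn0 mul0r; apply: le_trans (HM 0%N); rewrite expr0 mulr1.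
Qed.

Lemma psum_tailc a N z : growth a -> cn z < 1 -> psum (tailc a N) z = psum a z - cpart a z N.
Proof.
move=> ga z1; apply: psum_unique => //; first exact: growth_tailc.
have := ccvgB ((ccvg_shift _ _ N).2 (ccvg_psum ga z1)) (ccvg_cst (cpart a z N)).
set u := (fun n => _); suff -> : u = (fun n => cpart (tailc a N) z (n + N)%N) by move/(ccvg_shift (cpart (tailc a N) z) _ N).1.
apply/funext => n; rewrite /u /cpart addnC.
rewrite -(big_mkord xpredT (fun k => a k * z ^+ k)) -(big_mkord xpredT (fun k => a k * z ^+ k)).
rewrite -(big_mkord xpredT (fun k => tailc a N k * z ^+ k)) !(@big_cat_nat _ _ _ N 0 (N + n)) ?leq_addr //=.
rewrite addrAC subrr add0r [X in _ = X + _]big_nat_cond [X in _ = X + _]big1; last first.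
  by move=> k /andP[/andP[_ kN] _]; rewrite /tailc kN mul0r.
rewrite add0r; apply: eq_big_nat => k /andP[Nk _].
by rewrite /tailc ltnNge Nk.
Qed.

(** Each partial sum of the remainder has squared norm at most the tail of a convergent numerical
    series, and Fatou transfers this bound to the remainder itself. *)
Lemma n2_tail_cvg a (K : R) (e : R) : growth a -> (forall M, n2 D (fun z => cpart a z M) <= K) -> 0 < e ->
  exists N0, forall N, (N0 <= N)%N ->
    L2 D (fun z => psum a z - cpart a z N) /\ n2 D (fun z => psum a z - cpart a z N) <= e.
Proof.
move=> ga HK e0; have D1 : (1 : R) <= 1 by [].
pose c k := cn (a k) ^+ 2 * gs 1 k.
have c0 k : 0 <= c k by rewrite mulr_ge0 ?sqr_ge0 // gs_ge0.
have cK M : \sum_(k < M) c k <= K by rewrite -n2_cpart //; exact: HK.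
have cv : cvgn (fun n => \sum_(k < n) c k).
  by apply: (@cvg_real_summable _ c c K) => // n; rewrite ger0_norm.
have /cvgrPdist_le/(_ e e0)[N0 _ HN] := cv.
exists N0 => N N0N; set S := limn _ in HN.
have SM M : \sum_(k < M) c k <= S.
  have nd : nondecreasing_seq (fun n => \sum_(k < n) c k).
    by apply/nondecreasing_seqP => n; rewrite big_ord_recr /= lerDl.
  exact: (nondecreasing_cvgn_le nd cv M).
have tE M : n2 D (fun z => cpart (tailc a N) z M) <= e.
  rewrite (n2_cpart (tailc a N) M D1).
  apply: (@le_trans _ _ (S - \sum_(k < N) c k)); last first.
    by apply: le_trans (HN N N0N); exact: ler_norm.
  rewrite lerBrDr; apply: le_trans (SM (N + M)%N).
  rewrite -!(big_mkord xpredT c) (@big_cat_nat _ _ _ N 0 (N + M)) ?leq_addr //=.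
  rewrite [leLHS]addrC lerD2l.
  rewrite -(big_mkord xpredT (fun k => cn (tailc a N k) ^+ 2 * gs 1 k)).
  case: (leqP M N) => MN.
    rewrite big_nat_cond big1 ?sumr_ge0 // => k /andP[/andP[_ kM] _].
    by rewrite /tailc (leq_trans kM MN) cn0 expr0n mul0r.
  rewrite (@big_cat_nat _ _ _ N) ?(ltnW MN) //= big_nat_cond big1 ?add0r; last first.
    by move=> k /andP[/andP[_ kN] _]; rewrite /tailc kN cn0 expr0n mul0r.
  rewrite (@big_cat_nat _ _ _ M N (N + M)) ?leq_addl ?(ltnW MN) //=.
  rewrite -[leLHS]addr0; apply: lerD; last by rewrite sumr_ge0.
  rewrite le_eqVlt; apply/orP; left; apply/eqP; apply: eq_big_nat => k /andP[Nk _].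
  by rewrite /tailc ltnNge Nk.
have F := fatou_psum (growth_tailc N ga) tE.
have eqT : forall p, D p -> psum (tailc a N) (pt p) = psum a (pt p) - cpart a (pt p) N.
  by move=> p /D_cn_pt h; exact: psum_tailc.
have hT : L2 D (psum (tailc a N)).
  split; last by apply: le_lt_trans F _; rewrite ltry.
  by apply: psum_cmeas => //; [exact: measurable_diskR | exact: growth_tailc].
have hL : L2 D (fun z => psum a z - cpart a z N) by exact: eq_L2 hT.
split => //; rewrite -lee_fin -L2_N2 //.
by rewrite -(@eq_N2 _ _ D (psum (tailc a N)) _ eqT).
Qed.

(** Turns an estimate of the kind of [ip_le] into convergence. [K] stands for the bound of an
    operator applied to the remainder, and is 1 when there is none. *)
Lemma ccvg_tail a (x : C) (y : nat -> C) (K M : R) : growth a -> L2 D (psum a) -> 0 <= K -> 0 <= M ->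
  (forall t N, 0 < t -> L2 D (fun z => psum a z - cpart a z N) ->
     cn (y N - x) <= t * (K * n2 D (fun z => psum a z - cpart a z N)) + t^-1 * M) ->
  ccvg y x.
Proof.
move=> ga hf K0 M0 H e e0.
have M1 : 0 < M + 1 by rewrite ltr_wpDl.
have K1 : 0 < K + 1 by rewrite ltr_wpDl.
(* This [t] makes the second term at most e / 2; the remainder is then taken small relative to [t],
   so that the first term is too. *)
pose t := 2 * (M + 1) / e.
have t0 : 0 < t by rewrite divr_gt0 // mulr_gt0.
have e4 : 0 < e / (2 * t * (K + 1)) by rewrite divr_gt0 // mulr_gt0 // mulr_gt0.
have [N0 HN] := n2_tail_cvg ga (fun M => bessel M ga hf) e4.
exists N0 => N /HN[hL hle]; apply: le_trans (H t N t0 hL) _.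
have h1 : t * (K * n2 D (fun z => psum a z - cpart a z N)) <= e / 2.
  have -> : e / 2 = t * ((K + 1) * (e / (2 * t * (K + 1)))) by field; rewrite !gt_eqF.
  rewrite (ler_wpM2l (ltW t0)) //; apply: ler_pM => //; first exact: n2_ge0.
  by rewrite lerDl.
have h2 : t^-1 * M <= e / 2.
  rewrite /t invf_div mulrC mulrA ler_pdivrMr ?mulr_gt0 //.
  have -> : e / 2 * (2 * (M + 1)) = M * e + e by field.
  by rewrite lerDl ltW.
lra.
Qed.

Lemma ip_series a g : growth a -> L2 D (psum a) -> L2 D g ->
  ccvg (fun N => \sum_(k < N) a k * ip D (mono k) g) (ip D (psum a) g).
Proof.
move=> ga hf hg; have mD := @measurable_diskR R.
apply: (ccvg_tail (K := 1) (M := n2 D g) ga hf) => //; first exact: n2_ge0.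
move=> t N t0 hL; have hp : L2 D (fun z => cpart a z N) by apply: cpart_L2; exact: lexx.
rewrite -(ip_cpart a N (lexx 1) hg) cn_distC mul1r.
have -> : ip D (psum a) g - ip D (fun z => cpart a z N) g = ip D (fun z => psum a z - cpart a z N) g.
  rewrite -mulN1r -(ipZ mD) // -(ipD mD) //; last exact: L2Z.
  by apply: eq_ip => // p _; rewrite mulN1r.
exact: ip_le.
Qed.

Lemma ip_psum_mono a n : growth a -> L2 D (psum a) -> ip D (psum a) (mono n) = a n * (gs 1 n)%:C.
Proof.
move=> ga hf; have H := ip_series ga hf (mono_L2 n (lexx 1)).
apply: (ccvg_unique H); apply/(ccvg_shift _ _ n.+1).
rewrite (_ : (fun N => _) = fun=> a n * (gs 1 n)%:C); first exact: ccvg_cst.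
apply/funext => N; have nN : (n < N + n.+1)%N by rewrite addnS ltnS leq_addl.
by rewrite -(ip_cpart_mono a (lexx 1) nN) ip_cpart ?lexx //; exact: mono_L2 (lexx 1).
Qed.

Lemma parseval a b : growth a -> growth b -> L2 D (psum a) -> L2 D (psum b) ->
  ccvg (fun N => \sum_(k < N) a k * (b k)^*%C * (gs 1 k)%:C) (ip D (psum a) (psum b)).
Proof.
move=> ga gb ha hb; have mD := @measurable_diskR R.
have := ip_series ga ha hb; congr ccvg; apply/funext => N; apply: eq_bigr => k _.
rewrite (ip_conj mD hb (mono_L2 k (lexx 1))) ip_psum_mono //.
by rewrite rmorphM -mulrA; congr (_ * (_ * _)); exact: conjc_real.
Qed.

(** The converse of Bessel's inequality, by which an adjoint is built from its coefficients. *)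
Lemma L2_psum a (K : R) : growth a -> (forall M, \sum_(k < M) cn (a k) ^+ 2 * gs 1 k <= K) -> L2 D (psum a).
Proof.
move=> ga HK; split; first by apply: psum_cmeas => //; exact: measurable_diskR.
have H M : n2 D (fun z => cpart a z M) <= K by rewrite (n2_cpart a M (lexx 1)).
by apply: le_lt_trans (fatou_psum ga H) _; rewrite ltry.
Qed.

End bergman_series.

(** * The binomial series *)

Section real_lines.
Variable R : realType.
Local Notation C := R[i].
Local Open Scope classical_set_scope.
Implicit Types (f : C -> C) (e z u : C).

Lemma is_derive_eps (f : R -> R) (x l : R) : (forall e : R, 0 < e ->
    exists2 dl : R, 0 < dl & forall h, `|h| < dl -> `|f (x + h) - f x - l * h| <= e * `|h|) ->
  is_derive x (1 : R) f l.
Proof.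
move=> fl.
have cv : h^-1 *: ((f \o shift x) (h *: (1 : R)) - f x) @[h --> 0^'] --> l.
  apply/cvgrPdist_le => e e0; have [dl d0 H] := fl _ e0.
  exists dl => // h; rewrite /= sub0r normrN => hd h0.
  rewrite /GRing.scale /= mulr1 [h + x]addrC.
  have -> : l - h^-1 * (f (x + h) - f x) = - (f (x + h) - f x - l * h) / h by field.
  by rewrite normrM normrN normfV ler_pdivrMr ?normr_gt0 // H.
split; first by apply/cvg_ex; exists l.
by rewrite /derive; apply/(cvg_lim _ cv).
Qed.

Lemma is_derive_line_Re f e (t : R) l : cdiff f (t%:C * e) l ->
  is_derive t (1 : R) (fun t => Re (f (t%:C * e))) (Re (l * e)).
Proof.
move=> fl; apply: is_derive_eps => eps e0; have c1 : 0 < cn e + 1 by rewrite ltr_wpDl.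
have [dl d0 H] := fl _ (divr_gt0 e0 c1).
exists (dl / (cn e + 1)); first exact: divr_gt0.
move=> h; rewrite ltr_pdivlMr // => hd.
have hC : cn (h%:C * e) = `|h| * cn e by rewrite cnM cn_real.
have hd' : cn (h%:C * e) < dl.
  by rewrite hC; apply: le_lt_trans hd; rewrite ler_wpM2l // lerDl.
have -> : Re (f ((t + h)%:C * e)) - Re (f (t%:C * e)) - Re (l * e) * h =
    Re (f (t%:C * e + h%:C * e) - f (t%:C * e) - l * (h%:C * e)).
  have -> : (t + h)%:C * e = t%:C * e + h%:C * e by rewrite rmorphD mulrDl.
  by rewrite !ReImE /=; ring.
apply: le_trans (Re_le_cn _) _; apply: le_trans (H _ hd') _.
rewrite hC [leRHS]mulrC mulrCA ler_wpM2l // -mulrA ler_piMr ?(ltW e0) //.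
by rewrite mulrC ler_pdivrMr // mul1r lerDl.
Qed.

Lemma is_derive_line_Im f e (t : R) l : cdiff f (t%:C * e) l ->
  is_derive t (1 : R) (fun t => Im (f (t%:C * e))) (Im (l * e)).
Proof.
move=> fl; have H := is_derive_line_Re (cdiffM (cdiff_cst (0 +i* -1) _) fl).
have -> : (fun t : R => Im (f (t%:C * e))) = (fun t => Re ((0 +i* -1) * f (t%:C * e))).
  by apply/funext => x; rewrite ReM /=; ring.
by apply: (is_derive_eq H); rewrite !ReImE /=; ring.
Qed.

(** Removes the square root: along a ray the modulus is then a real power of a quadratic polynomial
    in the parameter. *)
Lemma cpow_sqrt u (s : R) : Num.sqrt (Re u ^+ 2 + Im u ^+ 2) `^ s = (Re u ^+ 2 + Im u ^+ 2) `^ (s / 2).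
Proof. by rewrite -powR12_sqrt ?addr_ge0 ?sqr_ge0 // -powRrM mulrC. Qed.

(** Along a ray the logarithmic derivative of (1 - t e)^s is -s e / (1 - t e). A derivative in this
    real variable suffices for the comparison with the binomial series. *)
Lemma is_derive_cpow (e : C) (s t : R) : let u := 1 - t%:C * e in 0 < Re u ->
  let W y := cpow (1 - y%:C * e) s in
  is_derive t (1 : R) (fun y => Re (W y)) (Re (- s%:C * e / u * W t)) /\
  is_derive t (1 : R) (fun y => Im (W y)) (Im (- s%:C * e / u * W t)).
Proof.
case: e => e1 e2; set e := e1 +i* e2 => u u0 W.
pose x (y : R) := 1 - y * e1; pose v (y : R) := - (y * e2).
pose rh (y : R) := x y ^+ 2 + v y ^+ 2.
have ReE y : Re (1 - y%:C * e) = x y by rewrite !ReImE /= /x; ring.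
have ImE y : Im (1 - y%:C * e) = v y by rewrite !ReImE /= /v; ring.
have x0 : 0 < x t by rewrite -ReE.
have rh0 : 0 < rh t by rewrite ltr_wpDr ?sqr_ge0 // exprn_gt0.
have dx : is_derive t (1 : R) x (- e1) by rewrite /x; apply: is_derive_eq; rewrite /GRing.scale /=; ring.
have dv : is_derive t (1 : R) v (- e2) by rewrite /v; apply: is_derive_eq; rewrite /GRing.scale /=; ring.
have drh : is_derive t (1 : R) rh (2 * (x t * - e1 + v t * - e2)).
  by rewrite /rh; apply: is_derive_eq; rewrite /GRing.scale /=; ring.
pose P (y : R) := rh y `^ (s / 2).
(* [p] is the logarithmic derivative of the modulus [P] and [q] the derivative of the angle [th];
   they are the real and imaginary parts of [- s%:C * e / u]. *)
pose p := s * (x t * - e1 + v t * - e2) / rh t; pose q := s * (x t * - e2 + v t * e1) / rh t.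
have dP : is_derive t (1 : R) P (p * P t).
  have := @is_derive1_comp _ (fun y => y `^ (s / 2)) rh t _ _ (is_derive1_powR (s / 2) rh0) drh.
  move=> H; apply: (is_derive_eq H); rewrite /p /P powRB ?(gt_eqF rh0) ?implybT // powRr1 ?(ltW rh0) //.
  by field; rewrite gt_eqF.
pose th (y : R) := s * atan (v y / x y).
have dth : is_derive t (1 : R) th q.
  have dV := is_deriveV (lt0r_neq0 x0) dx.
  have dq := is_deriveM dv dV.
  have dat := @is_derive1_comp _ atan (v * (fun y => (x y)^-1)) t _ _ (is_derive1_atan _) dq.
  have := is_deriveZ s dat.
  move=> H; apply: (is_derive_eq H); rewrite /q /rh /GRing.scale /=.
  rewrite -[(v * _) t]/(v t * (x t)^-1).
  move: (rh0) x0; rewrite /rh; move: (x t) (v t) => a b rh1 a0.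
  have nz : 1 + (b * a^-1) ^+ 2 != 0 by rewrite gt_eqF // ltr_wpDr ?sqr_ge0.
  field; rewrite ?gt_eqF //.
have dc := @is_derive1_comp _ cos th t _ _ (is_derive_cos (th t)) dth.
have ds := @is_derive1_comp _ sin th t _ _ (is_derive_sin (th t)) dth.
have We y : W y = P y * cos (th y) +i* (P y * sin (th y)).
  by rewrite /W /cpow cpow_sqrt ReE ImE.
have pq : - s%:C * e / u = p +i* q.
  have un : u != 0 by apply/eqP => h; move: u0; rewrite h ltxx.
  have uE : u = x t +i* v t by apply: eqC; [exact: ReE | exact: ImE].
  have nz : rh t != 0 by rewrite gt_eqF.
  apply: (mulIf un); rewrite mulfVK // uE; apply: eqC; rewrite !ReImE /= /p /q; move: nz; rewrite /rh => nz.
    by field.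
  by field.
rewrite pq We; split.
  have -> : (fun y => Re (W y)) = P * (cos \o th) by apply/funext => y; rewrite We.
  have H := is_deriveM dP dc; apply: (is_derive_eq H).
  by rewrite !ReImE /= /GRing.scale /=; ring.
have -> : (fun y => Im (W y)) = P * (sin \o th) by apply/funext => y; rewrite We.
have H := is_deriveM dP ds; apply: (is_derive_eq H).
by rewrite !ReImE /= /GRing.scale /=; ring.
Qed.

End real_lines.

(** * Binomial coefficients and the principal power *)

Section kernels.
Variable R : realType.
Local Notation C := R[i].
Implicit Types (s : R) (z u v : C).

(* Taylor coefficients of (1 - z)^(-s). *)
Fixpoint kc s n : R := if n is m.+1 then kc s m * ((m%:R + s) / m.+1%:R) else 1.

Lemma kc_gt0 s n : 0 < s -> 0 < kc s n.
Proof.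
by move=> s0; elim: n => //= n IH; rewrite mulr_gt0 // divr_gt0 // ltr_wpDl.
Qed.

Lemma kcS s n : kc s n.+1 = kc s n * ((n%:R + s) / n.+1%:R).
Proof. by []. Qed.

Lemma kc_rec s n : n.+1%:R * kc s n.+1 = (n%:R + s) * kc s n.
Proof.
have : n.+1%:R != 0 :> R by rewrite pnatr_eq0.
by rewrite kcS; move: (n.+1%:R) => x x0; field.
Qed.

(** Coefficient form of the derivative of (1 - z)^(-s), which is s (1 - z)^(-s-1). *)
Lemma kc_shift s n : n.+1%:R * kc s n.+1 = s * kc (s + 1) n.
Proof.
elim: n => [|n IH]; first by rewrite /= add0r divr1 mul1r mul1r mulr1.
have nz : n.+1%:R != 0 :> R by rewrite pnatr_eq0.
apply: (mulfI nz); rewrite kc_rec mulrCA IH mulrCA [RHS]mulrCA kc_rec -natr1; ring.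
Qed.

Lemma growth_kc s : 0 < s -> growth (fun n => (kc s n)%:C).
Proof.
move=> s0 r r0 r1; pose t n := kc s n * r ^+ n.
have t0 n : 0 <= t n by rewrite mulr_ge0 ?exprn_ge0 ?ltW // kc_gt0.
have r1' : 0 < 1 - r by lra.
have [m0 Hm] : exists m0, forall m, (m0 <= m)%N -> (m%:R + s) * r <= m.+1%:R.
  (* Beyond s / (1 - r) the ratio of consecutive terms is at most 1, so the sum of the terms up to
     that index bounds all of them. *)
  exists (Num.bound (s / (1 - r))) => m hm.
  have : s / (1 - r) <= m%:R.
    apply: le_trans (_ : (Num.bound (s / (1 - r)))%:R <= _); last by rewrite ler_nat.
    by apply: ltW; rewrite archi_boundP // divr_ge0 // ltW.
  rewrite ler_pdivrMr // -natr1 => h; have : s * r <= s by rewrite ler_piMr ?ltW.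
  by move: h; lra.
exists (\sum_(k < m0.+1) t k) => n; rewrite cn_real gtr0_norm ?kc_gt0 // -/(t n).
have below k : (k <= m0)%N -> t k <= \sum_(k < m0.+1) t k.
  move=> km; rewrite -ltnS in km; rewrite (bigD1 (Ordinal km)) //= lerDl sumr_ge0 //.
have [/below //|/ltnW mn] := leqP n m0.
apply: le_trans (below _ (leqnn _)).
rewrite -(subnKC mn); elim: (n - m0)%N => [|k IH]; first by rewrite addn0.
apply: le_trans IH; rewrite addnS /t /= exprS.
set m := (m0 + k)%N.
have -> : kc s m * ((m%:R + s) / m.+1%:R) * (r * r ^+ m) = kc s m * r ^+ m * ((m%:R + s) * r / m.+1%:R) by ring.
by rewrite ler_piMr ?(t0 m) // ler_pdivrMr // mul1r Hm // leq_addr.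
Qed.

(** The recursion [kc_rec], summed, is the differential equation (1 - z) G' = s G of the binomial
    series. *)
Lemma psum_kc_ode s z : 0 < s -> cn z < 1 ->
  (1 - z) * psum (dcoef (fun n => (kc s n)%:C)) z = s%:C * psum (fun n => (kc s n)%:C) z.
Proof.
move=> s0 z1; set k := fun n => (kc s n)%:C; have gk : growth k := growth_kc s0.
have e1 : psum (fun n => n%:R * k n) z = z * psum (dcoef k) z.
  by rewrite psum_rec ?mul0r ?add0r //; exact: growth_nat.
have e2 : dcoef k = fun n => s%:C * k n + n%:R * k n.
  apply/funext => n; rewrite /dcoef /k /= -mulrDl -!(rmorph_nat (real_complex R)) -rmorphD -!rmorphM /=; congr (_%:C).
  by rewrite kc_rec; ring.
rewrite mulrBl mul1r -e1 {1}e2 psumD ?psumZ ?addrK //; first exact: growthZ.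
exact: growth_nat.
Qed.

Lemma Re_1B_gt0 z : cn z < 1 -> 0 < Re (1 - z).
Proof. by move=> z1; rewrite !ReImE /=; have := Re_le_cn z; rewrite ler_norml => /andP[_]; lra. Qed.

Lemma cpow1 s : cpow 1 s = 1.
Proof.
by rewrite /cpow /= expr0n /= addr0 expr1n sqrtr1 powR1 mul0r atan0 mulr0 cos0 sin0 mulr0 mulr1.
Qed.

Let ray_Re (q A B : C) :
  Re B * Re (q * A) + Re A * Re (- (q * B)) - (Im B * Im (q * A) + Im A * Im (- (q * B))) = 0.
Proof. by rewrite !ReImE; ring. Qed.

Let ray_Im (q A B : C) :
  Re B * Im (q * A) + Im A * Re (- (q * B)) + (Im B * Re (q * A) + Re A * Im (- (q * B))) = 0.
Proof. by rewrite !ReImE; ring. Qed.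

(* Along the ray [t |-> t z] the two factors have opposite logarithmic derivatives. *)
Lemma psum_kc_cpow s z : 0 < s -> cn z < 1 ->
  psum (fun n => (kc s n)%:C) z * cpow (1 - z) s = 1.
Proof.
move=> s0 z1; pose G := psum (fun n => (kc s n)%:C); pose W (t : R) := cpow (1 - t%:C * z) s.
have tz (t : R) : 0 <= t -> t <= 1 -> cn (t%:C * z) < 1.
  move=> t0 t1; rewrite cnM cn_real ger0_norm //; apply: le_lt_trans z1.
  by rewrite ler_piMl.
pose H t := G (t%:C * z) * W t.
have dH (t : R) : 0 <= t -> t <= 1 ->
    is_derive t (1 : R) (fun y => Re (H y)) 0 /\ is_derive t (1 : R) (fun y => Im (H y)) 0.
  move=> t0 t1; have h := tz t t0 t1.
  have dG := cdiff_psum (growth_kc s0) h.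
  have [WR WI] := is_derive_cpow s (Re_1B_gt0 h).
  have GR := is_derive_line_Re dG; have GI := is_derive_line_Im dG.
  have un : 1 - t%:C * z != 0 by apply/eqP => e; have := Re_1B_gt0 h; rewrite e ltxx.
  (* The differential equation solved for the derivative along the ray: the logarithmic derivative
     of [G] is opposite to that of [W]. *)
  have e0 : psum (dcoef (fun n => (kc s n)%:C)) (t%:C * z) * z = - (- s%:C * z / (1 - t%:C * z) * G (t%:C * z)).
    apply: (mulfI un); rewrite mulrA psum_kc_ode // -/G.
    by move: (G _) (s%:C) (1 - _) un => g k u un; field.
  move: GR GI; rewrite e0 -/G => GR GI.
  set q := - s%:C * z / (1 - t%:C * z) in WR WI GR GI.
  split.
    have -> : (fun y => Re (H y)) = (fun y => Re (G (y%:C * z))) * (fun y => Re (W y)) - (fun y => Im (G (y%:C * z))) * (fun y => Im (W y)).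
      by apply/funext => y; rewrite /H ReM.
    have K := is_deriveB (is_deriveM GR WR) (is_deriveM GI WI); apply: (is_derive_eq K).
    exact: ray_Re.
  have -> : (fun y => Im (H y)) = (fun y => Re (G (y%:C * z))) * (fun y => Im (W y)) + (fun y => Im (G (y%:C * z))) * (fun y => Re (W y)).
    by apply/funext => y; rewrite /H ImM.
  have K := is_deriveD (is_deriveM GR WI) (is_deriveM GI WR); apply: (is_derive_eq K).
  exact: ray_Im.
have H01 (F : R -> R) : (forall t : R, 0 <= t -> t <= 1 -> is_derive t (1 : R) F 0) -> F 1 = F 0.
  move=> dF; have c1 : {within `[(0 : R), 1], continuous F}%classic.
    apply: within_continuous => x x0 x1; apply/differentiable_continuous/derivable1_diffP.
    by have [] := dF x x0 x1.
  have [|c _] := @MVT_segment R F (fun=> 0) 0 1 ler01 _ c1.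
    by move=> x; rewrite in_itv /= => /andP[x0 x1]; apply: dF; exact: ltW.
  by rewrite mul0r => /eqP; rewrite subr_eq0 => /eqP.
have HE : H 1 = H 0.
  by apply: eqC; [apply: (H01 (fun y => Re (H y))) => t a b; have [] := dH t a b
                 | apply: (H01 (fun y => Im (H y))) => t a b; have [] := dH t a b].
move: HE; rewrite /H /W rmorph1 mul1r rmorph0 mul0r subr0 cpow1 mulr1 /G => ->.
by rewrite psum_rec ?cn0 ?mul0r ?addr0 //; exact: growth_kc.
Qed.

Definition arg u := atan (Im u / Re u).

Lemma cpowE u s : cpow u s = (cn u `^ s)%:C * cis (s * arg u).
Proof.
rewrite /cpow -/(arg u) -cn_sqr sqrtr_sqr ger0_norm //.
by apply: eqC; rewrite !ReImE /=; ring.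
Qed.

(** The quotient Im / Re determines the direction only up to sign; positivity of the real part
    selects the right one. *)
Lemma cis_arg u : 0 < Re u -> u = (cn u)%:C * cis (arg u).
Proof.
move=> u0; have c0 : 0 < cn u by apply: lt_le_trans (Re_le_cn u); rewrite gtr0_norm.
have q0 : cos (arg u) = Re u / cn u.
  rewrite /arg cos_atan; have -> : 1 + (Im u / Re u) ^+ 2 = (cn u / Re u) ^+ 2.
    by rewrite !exprMn !exprVn cn_sqr; field; rewrite gt_eqF.
  by rewrite sqrtr_sqr gtr0_norm ?divr_gt0 // invf_div.
have cn0 : cos (arg u) != 0 by rewrite q0 gt_eqF // divr_gt0.
have s0 : sin (arg u) = Im u / cn u.
  have : tan (arg u) = Im u / Re u by rewrite /arg atanK.
  move=> /(congr1 (fun x => x * cos (arg u))); rewrite /tan divfK // => ->.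
  by rewrite q0; field; rewrite !gt_eqF.
by apply: eqC; rewrite !ReImE /= ?q0 ?s0; field; rewrite gt_eqF.
Qed.

Lemma cos_eq1 (x : R) : `|x| < 2 * pi -> cos x = 1 -> x = 0.
Proof.
move=> xp cx; have H : sin (x / 2) = 0.
  apply/eqP; rewrite -sqrf_eq0; apply/eqP.
  have := cos_mulr2n (x / 2); have := cos2Dsin2 (x / 2).
  have -> : x / 2 *+ 2 = x by rewrite mulr2n; field.
  by rewrite cx mulr2n; lra.
apply/eqP; rewrite -[_ == _]negbK; apply/negP => xn.
have : 0 < sin (`|x| / 2).
  by apply: sin_gt0_pi; rewrite divr_gt0 ?normr_gt0 //= ltr_pdivrMr // mulrC.
have [x0|x0] := leP 0 x; first by rewrite ger0_norm // H ltxx.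
by rewrite ltr0_norm // mulNr sinN H oppr0 ltxx.
Qed.

(* Both sums of arguments lie in ]-pi, pi[, hence agree exactly and not only modulo 2 pi. *)
Lemma cpow_mul_eq u v u' v' s : 0 < Re u -> 0 < Re v -> 0 < Re u' -> 0 < Re v' ->
  u * v = u' * v' -> cpow u s * cpow v s = cpow u' s * cpow v' s.
Proof.
move=> u0 v0 u0' v0' e; have cE : cn u * cn v = cn u' * cn v' by rewrite -!cnM e.
have cp x : 0 < Re x -> 0 < cn x by move=> x0; apply: lt_le_trans (Re_le_cn x); rewrite gtr0_norm.
have aE : arg u + arg v = arg u' + arg v'.
  apply/eqP; rewrite -subr_eq0; apply/eqP/cos_eq1.
    have := @atan_ltpi2 R; have := @atan_gtNpi2 R => h1 h2; rewrite ltr_norml /arg.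
    have := (h1 (Im u / Re u), h2 (Im u / Re u), (h1 (Im v / Re v), h2 (Im v / Re v))).
    have := (h1 (Im u' / Re u'), h2 (Im u' / Re u'), (h1 (Im v' / Re v'), h2 (Im v' / Re v'))).
    move=> [[a b] [c d]] [[a' b'] [c' d']]; apply/andP; split; lra.
  rewrite -[cos _]/(Re (cis _)) cisD cisN.
  have -> : cis (arg u + arg v) = cis (arg u' + arg v'); last by rewrite divff ?cis_neq0.
  have nz : (cn u * cn v)%:C != 0 by rewrite -cn_gt0 cn_real normr_gt0 mulf_neq0 ?gt_eqF ?cp.
  apply: (mulfI nz); rewrite {2}cE !rmorphM !cisD /=.
  rewrite mulrACA -!cis_arg // e {1}(cis_arg u0') {1}(cis_arg v0'); ring.
rewrite !cpowE mulrACA [RHS]mulrACA -!rmorphM -!cisD -!mulrDr aE.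
by rewrite -!powRM ?cE.
Qed.

End kernels.

(** * The space A^2_alpha and its kernels *)

Section bergman_space.
Variables (R : realType) (alpha : R).
Hypothesis a1 : -1 < alpha.
Local Notation C := R[i].
Local Notation TT := (measurableTypeR R * measurableTypeR R)%type.
Local Notation ar := (@lebesgue_measure R \x @lebesgue_measure R)%E.
Local Notation D := (@diskR R : set TT).
Local Notation ip := (ip alpha D).
Local Notation N2 := (N2 alpha D).
Local Notation n2 := (n2 alpha D).
Local Notation L2 := (L2 alpha D).
Local Notation A2 := (inA2 alpha).
Local Notation mono := (@mono R).
Implicit Types (f g h : C -> C) (a b : nat -> C) (z w : C).
Let mD := @measurable_diskR R.

Lemma alpha1_gt0 : 0 < alpha + 1.
Proof. by have := a1; lra. Qed.


Lemma growth_le a b : (forall n, cn (a n) <= cn (b n)) -> growth b -> growth a.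
Proof.
move=> ab gb r r0 r1; have [M HM] := gb r r0 r1; exists M => n.
by apply: le_trans (HM n); rewrite ler_wpM2r ?ab // exprn_ge0 // ltW.
Qed.

Lemma holo_disk_cdiff f z : holo_disk f -> cn z < 1 -> cdiff f z (cderiv f z).
Proof. by move=> hf z1; apply/derivable_cdiff/hf; rewrite norm_lt1. Qed.

Lemma holo_disk_series f : holo_disk f ->
  exists2 a, growth a & forall z, cn z < 1 -> f z = psum a z.
Proof. by move=> hf; apply: taylor_disk => z; exact: holo_disk_cdiff. Qed.

(** Differentiability is local, so equality inside the open disk transfers it. This is how a
    function is replaced by its Taylor series, from which it may differ elsewhere. *)
Lemma eq_disk_cdiff f g z l : cn z < 1 -> (forall x, cn x < 1 -> f x = g x) -> cdiff g z l -> cdiff f z l.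
Proof.
move=> z1 fg; have r0 : 0 < 1 - cn z by lra.
apply: cdiff_near r0 _ => h hh; rewrite fg //; apply: le_lt_trans (cnD _ _) _; lra.
Qed.

Lemma holo_diskP f : (forall z, cn z < 1 -> exists l, cdiff f z l) -> holo_disk f.
Proof. by move=> H z; rewrite norm_lt1 => /H[l /cdiff_derivable[]]. Qed.

Lemma cdiff_cderiv f z l : cdiff f z l -> cderiv f z = l.
Proof. by move=> /cdiff_derivable[]. Qed.

Lemma psum_holo_disk a : growth a -> holo_disk (psum a).
Proof. by move=> ga; apply: holo_diskP => z z1; eexists; exact: cdiff_psum. Qed.

Lemma eq_holo_disk f g : (forall z, cn z < 1 -> f z = g z) -> holo_disk g -> holo_disk f.
Proof.
move=> fg hg; apply: holo_diskP => z z1; exists (cderiv g z).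
exact/(eq_disk_cdiff z1 fg)/holo_disk_cdiff.
Qed.

Lemma inA2P f : A2 f <-> holo_disk f /\ L2 f.
Proof.
rewrite /inA2 -(N2_ReIm alpha f); split=> [[hf nf]|[hf [_ nf]]] //.
do 2!split => //; have [a ga fa] := holo_disk_series hf.
have [m1 m2] : cmeas D (fun p => psum a (pt p)) by exact: psum_cmeas.
by split; [apply: eq_measurable_fun m1 | apply: eq_measurable_fun m2] => p;
  rewrite inE => /D_cn_pt/fa ->.
Qed.

Lemma inA2_L2 f : A2 f -> L2 f. Proof. by move=> /inA2P[]. Qed.

Lemma eq_inA2 f g : (forall z, cn z < 1 -> f z = g z) -> A2 f -> A2 g.
Proof.
move=> fg /inA2P[hf nf]; apply/inA2P; split; first by apply: eq_holo_disk hf => z /fg.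
by apply: eq_L2 nf => p /D_cn_pt/fg.
Qed.

Lemma psum_inA2 a : growth a -> L2 (psum a) -> A2 (psum a).
Proof. by move=> ga ha; apply/inA2P; split => //; exact: psum_holo_disk. Qed.

Lemma inA2_series f : A2 f ->
  exists a, [/\ growth a, forall z, cn z < 1 -> f z = psum a z & L2 (psum a)].
Proof.
move=> /inA2P[hf nf]; have [a ga fa] := holo_disk_series hf.
by exists a; split => //; apply: eq_L2 nf => p /D_cn_pt/fa.
Qed.

Lemma inA2_comb f g k : A2 f -> A2 g -> A2 (fun z => f z + k * g z).
Proof.
move=> /inA2P[hf nf] /inA2P[hg ng]; apply/inA2P; split.
  apply: holo_diskP => z z1; eexists.
  exact: cdiffD (holo_disk_cdiff hf z1) (cdiffM (cdiff_cst k z) (holo_disk_cdiff hg z1)).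
by apply: L2D => //; exact: L2Z.
Qed.

Lemma mono_inA2 n : A2 (mono n).
Proof.
apply/inA2P; split; last exact: mono_L2.
apply: holo_diskP => z z1; elim: n => [|n [l IH]].
  by exists 0; apply: cdiff_cst.
eexists; apply: (cdiff_near (f := fun x => x * mono n x) (r := 1)) => //.
  by move=> h _; rewrite /mono exprS.
exact: cdiffM (cdiff_id z) IH.
Qed.

Lemma cpart_inA2 a N : A2 (fun z => cpart a z N).
Proof.
elim: N => [|N IH].
  apply: (eq_inA2 (f := fun z => mono 0 z + (-1) * mono 0 z)); last exact: inA2_comb (mono_inA2 0) (mono_inA2 0).
  by move=> z _; rewrite /cpart big_ord0 mulN1r subrr.
apply: eq_inA2 (inA2_comb (a N) IH (mono_inA2 N)) => z _.
by rewrite /cpart big_ord_recr.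
Qed.

(** Common source of the norm bounds: for multiplication, for D_phi, and for bounded functions
    compared with the constant [mono 0]. Measurability of [g] comes from its Taylor series. *)
Lemma n2_dom f g (c : R) : holo_disk g -> L2 f ->
  (forall z, cn z < 1 -> cn (g z) ^+ 2 <= c * cn (f z) ^+ 2) -> A2 g /\ n2 g <= c * n2 f.
Proof.
move=> hg hf gf; have [a ga fa] := holo_disk_series hg.
have eq_g p : D p -> psum a (pt p) = g (pt p) by move=> /D_cn_pt/fa.
have mg : cmeas D (fun p => g (pt p)).
  have [m1 m2] : cmeas D (fun p => psum a (pt p)) by exact: psum_cmeas.
  by split; [apply: eq_measurable_fun m1 | apply: eq_measurable_fun m2] => p;
    rewrite inE => /eq_g ->.
have N2g : (N2 g <= (c * n2 f)%:E)%E.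
  have -> : ((c * n2 f)%:E = \int[ar]_(p in D) (c%:E * (cn (f (pt p)) ^+ 2 * bweight alpha p)%:E))%E.
    by rewrite integralZl //; [rewrite -[X in (_ * X)%E]/(N2 f) L2_N2 | exact: L2_integrable].
  apply: ge0_le_integral => //.
  - by move=> p _; rewrite lee_fin mulr_ge0 ?sqr_ge0 // bweight_ge0.
  - exact: measurable_N2.
  - by apply: emeasurable_funM => //; apply: measurable_N2; case: hf.
  - by move=> p /D_cn_pt/gf h; rewrite -EFinM lee_fin mulrA ler_wpM2r // bweight_ge0.
have Lg : L2 g by split => //; apply: le_lt_trans N2g _; rewrite ltry.
by split; [apply/inA2P | rewrite -lee_fin -L2_N2].
Qed.

Lemma ipA2E f g : ipA2 alpha f g = ((alpha + 1) / pi)%:C * ip f g.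
Proof.
rewrite /ipA2; congr (_ * _); apply: eqC; rewrite /=; apply: eq_Rintegral => p _.
  by case: (f _) (g _) => [x y] [x' y']; rewrite !ReImE /=; ring.
by case: (f _) (g _) => [x y] [x' y']; rewrite !ReImE /=; ring.
Qed.

Let k0_gt0 : 0 < (alpha + 1) / pi.
Proof. by rewrite divr_gt0 ?alpha1_gt0 ?pi_gt0. Qed.

Lemma conjMr (k : R) z : (k%:C * z)^*%C = k%:C * z^*%C.
Proof. by case: z => x y; apply: eqC; rewrite /=; ring. Qed.

Lemma conjM z w : (z * w)^*%C = z^*%C * w^*%C.
Proof. by case: z w => [x y] [x' y']; apply: eqC; rewrite /=; ring. Qed.

Lemma ipA2_conj f g : A2 f -> A2 g -> ipA2 alpha g f = (ipA2 alpha f g)^*%C.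
Proof.
move=> /inA2_L2 hf /inA2_L2 hg; rewrite !ipA2E (ip_conj mD hf hg).
by rewrite conjMr.
Qed.

Lemma ipA2_Zr f g k : A2 f -> A2 g -> ipA2 alpha f (fun z => k * g z) = k^*%C * ipA2 alpha f g.
Proof.
move=> /inA2_L2 hf /inA2_L2 hg; rewrite !ipA2E (ip_conj mD (L2Z mD k hg) hf) (ipZ mD k hg hf).
by rewrite conjM -(ip_conj mD hg hf) mulrCA.
Qed.

Lemma eq_ipA2 f1 f2 g1 g2 : (forall z, cn z < 1 -> f1 z = f2 z) -> (forall z, cn z < 1 -> g1 z = g2 z) ->
  ipA2 alpha f1 g1 = ipA2 alpha f2 g2.
Proof.
by move=> fE gE; rewrite !ipA2E; congr (_ * _); apply: eq_ip => p /D_cn_pt; [exact: fE | exact: gE].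
Qed.

Lemma parseval_A2 a b : growth a -> growth b -> L2 (psum a) -> L2 (psum b) ->
  ccvg (fun N => \sum_(k < N) a k * (b k)^*%C * (gam alpha k)%:C) (ipA2 alpha (psum a) (psum b)).
Proof.
move=> ga gb ha hb; rewrite ipA2E; have := ccvgZ ((alpha + 1) / pi)%:C (parseval a1 ga gb ha hb).
congr ccvg; apply/funext => N; rewrite mulr_sumr; apply: eq_bigr => k _.
rewrite gs1 // mulrCA -rmorphM; congr (_ * _%:C).
by rewrite mulrA mulf_div [pi * _]mulrC divff ?mul1r // mulf_neq0 // lt0r_neq0 ?alpha1_gt0 ?(pi_gt0 R).
Qed.

Lemma absum_bounded a (B : R) : (forall N, \sum_(k < N) cn (a k) <= B) ->
  growth a /\ forall z, cn z < 1 -> cn (psum a z) <= B.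
Proof.
move=> aB; have ga : growth a.
  apply: (growth_bounded (M := B)) => n; apply: le_trans (aB n.+1).
  by rewrite big_ord_recr /= lerDr sumr_ge0.
split=> // z z1; apply: ccvg_le (ccvg_psum ga z1) _ => N.
apply: le_trans (aB N); apply: le_trans (cn_sum _ _ _) _; apply: ler_sum => k _.
by rewrite cnM cnX ler_piMr // exprn_ile1 // ltW.
Qed.

(** The weight has total mass pi / (alpha + 1), so a bounded function is square integrable; this
    puts the kernels in the space. *)
Lemma absum_L2 a (B : R) : (forall N, \sum_(k < N) cn (a k) <= B) ->
  L2 (psum a) /\ n2 (psum a) <= B ^+ 2 * (pi / (alpha + 1)).
Proof.
move=> aB; have [ga Hb] := absum_bounded aB.
have B0 : 0 <= B by apply: le_trans (aB 0%N); rewrite big_ord0.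
have [|/inA2_L2 h1 h2] := @n2_dom (mono 0) (psum a) (B ^+ 2) (psum_holo_disk ga) (mono_L2 a1 0 (lexx 1)).
  move=> z z1; rewrite /mono expr0 cn1 expr1n mulr1.
  by apply: lerXn2r; rewrite ?nnegrE // Hb.
split=> //; apply: le_trans h2 _; rewrite -[n2 (mono 0)]/(gs alpha 1 0) gs1 //.
by rewrite /= mulr1.
Qed.

Local Notation s := (alpha + 2).

Lemma s_gt0 : 0 < s. Proof. by have := a1; lra. Qed.

(** The reproducing property at the level of coefficients: those of the kernel are inverse to the
    squared norms of the monomials. *)
Lemma gamK n : kc s n * gam alpha n = 1.
Proof.
elim: n => [|n IH]; first by rewrite /= mulr1.
rewrite kcS /= mulrACA IH mul1r -natr1.
by field; have := ler0n R n; have := a1; move=> ? ?; apply/andP; split; rewrite gt_eqF //; lra.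
Qed.

(* Taylor coefficients of K_w and of K^(1)_w. *)
Definition kerc w n : C := w^*%C ^+ n * (kc s n)%:C.

Definition kerc1 w n : C := if n is m.+1 then w^*%C ^+ m * (n%:R * kc s n)%:C else 0.

Lemma kerc_absum w : cn w < 1 -> exists B, forall N, \sum_(k < N) cn (kerc w k) <= B.
Proof.
move=> w1; have [B HB] := growth_summable (growth_kc s_gt0) (cn_ge0 w) w1.
exists B => N; apply: le_trans (HB N); apply: ler_sum => k _.
by rewrite cnM cnX cn_conj mulrC.
Qed.

(** A single [B] serves all [w] of modulus at most [r]; [cderiv_bound] rests on this uniformity. *)
Lemma kerc1_absum (r : R) : 0 <= r -> r < 1 ->
  exists B, forall w, cn w <= r -> forall N, \sum_(k < N) cn (kerc1 w k) <= B.
Proof.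
move=> r0 r1; have [B HB] := growth_summable (growth_dcoef (growth_kc s_gt0)) r0 r1.
exists B => w wr; case=> [|N]; first by apply: le_trans (HB 0%N); rewrite !big_ord0.
apply: le_trans (HB N); rewrite big_ord_recl /= cn0 add0r; apply: ler_sum => k _.
rewrite /= cnM cnX cn_conj mulrC /dcoef rmorphM rmorph_nat ler_wpM2l //.
by apply: lerXn2r; rewrite ?nnegrE.
Qed.

Lemma psum_scale a q z : growth a -> cn q <= 1 -> cn z < 1 ->
  psum (fun n => q ^+ n * a n) z = psum a (q * z).
Proof.
move=> ga q1 z1; have qz : cn (q * z) < 1 by rewrite cnM; apply: le_lt_trans z1; rewrite ler_piMl.
apply: psum_unique => //.
  by apply: growth_le ga => n; rewrite cnM cnX ler_piMl // exprn_ile1.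
have -> : cpart (fun n => q ^+ n * a n) z = cpart a (q * z); last exact: ccvg_psum.
by apply/funext => N; apply: eq_bigr => k _; rewrite exprMn; ring.
Qed.

Lemma cpow_neq0 (u : C) (t : R) : 0 < Re u -> cpow u t != 0.
Proof.
move=> u0; have c0 : 0 < cn u by apply: lt_le_trans (Re_le_cn u); rewrite gtr0_norm.
by rewrite cpowE mulf_neq0 ?cis_neq0 // -cn_gt0 cn_real normr_gt0 gt_eqF // powR_gt0.
Qed.

Lemma psum_kcE (t : R) z : 0 < t -> cn z < 1 -> psum (fun n => (kc t n)%:C) z = (cpow (1 - z) t)^-1.
Proof.
move=> t0 z1; have nz := cpow_neq0 t (Re_1B_gt0 z1).
by apply: (mulIf nz); rewrite psum_kc_cpow // mulVf.
Qed.

Lemma conj_mul_lt1 w z : cn w < 1 -> cn z < 1 -> cn (w^*%C * z) < 1.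
Proof.
move=> w1 z1; rewrite cnM cn_conj; apply: le_lt_trans z1; rewrite ler_piMl // ltW //.
Qed.

Lemma K1E w z : K1 alpha w z = (s%:C * z) / cpow (1 - w^*%C * z) (alpha + 3).
Proof. by rewrite /K1; congr (_ / cpow (1 - _ * _) _); case: w => x y; apply: eqC. Qed.

Lemma dcoef_kc (t : R) : dcoef (fun n => (kc t n)%:C) = fun n => t%:C * (kc (t + 1) n)%:C :> C.
Proof. by apply/funext => n; rewrite /dcoef -(rmorph_nat (real_complex R)) -!rmorphM /= -kc_shift. Qed.

(** One power of z splits off, and by [kc_shift] the remaining coefficients are alpha + 2 times
    those of the binomial series of exponent alpha + 3. *)
Lemma psum_kerc1 w z : cn w < 1 -> cn z < 1 -> psum (kerc1 w) z = K1 alpha w z.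
Proof.
move=> w1 z1; have [B HB] := kerc1_absum (cn_ge0 w) w1.
have [g1 _] := absum_bounded (HB w (lexx _)).
have gk := growth_kc (addr_gt0 s_gt0 ltr01).
rewrite psum_rec // add0r K1E.
have -> : (fun n => kerc1 w n.+1) = fun n => w^*%C ^+ n * (s%:C * (kc (s + 1) n)%:C).
  by apply/funext => n; rewrite /kerc1 kc_shift rmorphM.
rewrite psum_scale ?cn_conj ?(ltW w1) //; last exact: growthZ.
rewrite psumZ ?conj_mul_lt1 // (psum_kcE (addr_gt0 s_gt0 ltr01)) ?conj_mul_lt1 //.
have -> : s + 1 = alpha + 3 by ring.
by ring.
Qed.

Lemma K1_bounded w : cn w < 1 -> exists B, forall z, cn z < 1 -> cn (K1 alpha w z) <= B.
Proof.
move=> w1; have [B HB] := kerc1_absum (cn_ge0 w) w1; exists B => z z1.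
by rewrite -psum_kerc1 //; apply: (absum_bounded (HB w (lexx _))).2.
Qed.

Lemma kerc_growth_L2 w : cn w < 1 -> growth (kerc w) /\ L2 (psum (kerc w)).
Proof.
by move=> /kerc_absum[B HB]; have [g _] := absum_bounded HB; have [h _] := absum_L2 HB.
Qed.

Lemma kerc1_growth_L2 w : cn w < 1 -> growth (kerc1 w) /\ L2 (psum (kerc1 w)).
Proof.
move=> w1; have [B /(_ w (lexx _)) HB] := kerc1_absum (cn_ge0 w) w1.
by have [g _] := absum_bounded HB; have [h _] := absum_L2 HB.
Qed.

Lemma conj_kerc w n : (kerc w n)^*%C * (gam alpha n)%:C = w ^+ n.
Proof.
by rewrite /kerc conjM rmorphXn /= conjcK -mulrA [X in _ * (X * _)]conjc_real -rmorphM gamK mulr1.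
Qed.

Lemma conj_kerc1 w n : (kerc1 w n.+1)^*%C * (gam alpha n.+1)%:C = n.+1%:R * w ^+ n.
Proof.
have := gamK n.+1; rewrite -[kerc1 w n.+1]/(w^*%C ^+ n * (n.+1%:R * kc s n.+1)%:C).
move: (kc s n.+1) (gam alpha n.+1) => k g gK.
rewrite conjM rmorphXn /= conjcK -mulrA [X in _ * (X * _)]conjc_real -rmorphM -mulrA gK mulr1.
by rewrite rmorph_nat mulrC.
Qed.

Lemma reproducing f w : A2 f -> cn w < 1 -> ipA2 alpha f (psum (kerc w)) = f w.
Proof.
move=> hf w1; have [a [ga fa ha]] := inA2_series hf; have [gk hk] := kerc_growth_L2 w1.
rewrite (eq_ipA2 (g2 := psum (kerc w)) fa) // fa //.
apply: ccvg_unique (parseval_A2 ga gk ha hk) _; have := ccvg_psum ga w1.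
by congr ccvg; apply/funext => N; apply: eq_bigr => k _; rewrite -mulrA conj_kerc.
Qed.

Lemma reproducing1 f w : A2 f -> cn w < 1 -> ipA2 alpha f (psum (kerc1 w)) = cderiv f w.
Proof.
move=> hf w1; have [a [ga fa ha]] := inA2_series hf; have [gk hk] := kerc1_growth_L2 w1.
rewrite (eq_ipA2 (g2 := psum (kerc1 w)) fa) //.
rewrite (cdiff_cderiv (eq_disk_cdiff w1 fa (cdiff_psum ga w1))).
apply: ccvg_unique (parseval_A2 ga gk ha hk) _; apply/ccvgS.
have := ccvg_psum (growth_dcoef ga) w1.
congr ccvg; apply/funext => N; rewrite big_ord_recl.
have -> : (kerc1 w (@ord0 N))^*%C = 0 by exact: conjc0.
rewrite mulr0 mul0r add0r; apply: eq_bigr => k _.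
by rewrite lift0 -mulrA conj_kerc1 /dcoef; ring.
Qed.

(** f'(z) is a pairing with a kernel whose norm is bounded for [cn z <= r]; a good choice of the
    parameter in [ip_le] then gives Cauchy-Schwarz up to a constant. *)
Lemma cderiv_bound (r : R) : 0 <= r -> r < 1 ->
  exists2 M : R, 0 <= M & forall f z, A2 f -> cn z <= r -> cn (cderiv f z) ^+ 2 <= M * n2 f.
Proof.
move=> r0 r1; have [B HB] := kerc1_absum r0 r1.
pose A := B ^+ 2 * (pi / (alpha + 1)) + 1; pose k := (alpha + 1) / pi.
have A0 : 0 < A.
  by apply: ltr_wpDl => //; apply: mulr_ge0 (sqr_ge0 _) (divr_ge0 (pi_ge0 _) (ltW alpha1_gt0)).
exists (4 * k ^+ 2 * A); first by apply: mulr_ge0 (ltW A0); apply: mulr_ge0 (sqr_ge0 _).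
move=> f z hf zr; have z1 := le_lt_trans zr r1.
have [_ nK] := absum_L2 (HB z zr); have [_ hK] := kerc1_growth_L2 z1.
rewrite -(reproducing1 hf z1) ipA2E cnM cn_real (gtr0_norm k0_gt0) -/k.
set x := cn (ip _ _).
have H t : 0 < t -> x <= t * n2 f + t^-1 * A.
  move=> t0; apply: le_trans (ip_le mD t0 (inA2_L2 hf) hK) _.
  rewrite lerD2l ler_wpM2l ?invr_ge0 ?(ltW t0) //; apply: le_trans nK _.
  by rewrite lerDl.
have : x ^+ 2 <= 4 * A * n2 f; last first.
  move=> h; have -> : 4 * k ^+ 2 * A * n2 f = k ^+ 2 * (4 * A * n2 f) by ring.
  by rewrite exprMn (ler_wpM2l (sqr_ge0 k)).
have [x0|x0] := ltP 0 x; last first.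
  have -> : x = 0 by apply/eqP; rewrite eq_le x0 cn_ge0.
  by rewrite expr0n; apply: mulr_ge0 (n2_ge0 _ _ _); apply: mulr_ge0 (ltW A0).
(* Taken as [t], this value makes the kernel term equal to x / 2, which is absorbed on the left. *)
have A2 : 0 < 2 * A / x by rewrite divr_gt0 // mulr_gt0.
have := H _ A2.
have -> : (2 * A / x)^-1 * A = x / 2 by field; rewrite !gt_eqF.
move=> h; have {h} : x / 2 <= 2 * A / x * n2 f by move: h; lra.
rewrite -(ler_pM2r x0) => h; move: h.
have -> : 2 * A / x * n2 f * x = 2 * A * n2 f by field; rewrite gt_eqF.
by rewrite expr2; lra.
Qed.

End bergman_space.

(** * Adjoints of bounded operators *)

Section adjoint.
Variables (R : realType) (alpha : R).
Hypothesis a1 : -1 < alpha.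
Local Notation C := R[i].
Local Notation TT := (measurableTypeR R * measurableTypeR R)%type.
Local Notation D := (@diskR R : set TT).
Local Notation ip := (ip alpha D).
Local Notation n2 := (n2 alpha D).
Local Notation L2 := (L2 alpha D).
Local Notation A2 := (inA2 alpha).
Local Notation mono := (@mono R).
Local Notation gs := (gs alpha 1).
Implicit Types (f g h : C -> C) (a b : nat -> C) (z w : C).
Let mD := @measurable_diskR R.

Variables (T : (C -> C) -> C -> C) (K : R).
Hypothesis K0 : 0 <= K.
Hypothesis Tbound : forall f, A2 f -> A2 (T f) /\ n2 (T f) <= K * n2 f.
Hypothesis Tlin : forall f g k z, A2 f -> A2 g -> cn z < 1 ->
  T (fun x => f x + k * g x) z = T f z + k * T g z.

Let TL2 f : A2 f -> L2 (T f).
Proof. by move=> /Tbound[h _]; exact: inA2_L2 h. Qed.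

Let ipT_comb f g h k : A2 f -> A2 g -> L2 h ->
  ip (T (fun x => f x + k * g x)) h = ip (T f) h + k * ip (T g) h.
Proof.
move=> hf hg hh; rewrite -(ipZ mD k (TL2 hg) hh) -(ipD mD (TL2 hf) (L2Z mD k (TL2 hg)) hh).
by apply: eq_ip => // p /D_cn_pt; exact: Tlin.
Qed.

Let ipT_cpart a N h : L2 h -> ip (T (fun z => cpart a z N)) h = \sum_(k < N) a k * ip (T (mono k)) h.
Proof.
move=> hh; elim: N => [|N IH].
  have -> : (fun z => cpart a z 0) = (fun z => mono 0 z + (-1) * mono 0 z).
    by apply/funext => z; rewrite /cpart big_ord0 mulN1r subrr.
  by rewrite ipT_comb ?mulN1r ?subrr ?big_ord0 //; exact: mono_inA2.
have -> : (fun z => cpart a z N.+1) = (fun z => cpart a z N + a N * mono N z).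
  by apply/funext => z; rewrite /cpart big_ord_recr.
by rewrite ipT_comb ?IH ?big_ord_recr //; [exact: cpart_inA2 | exact: mono_inA2].
Qed.

Let gs_gt0 n : 0 < gs n.
Proof. by rewrite gs1 // mulr_gt0 ?gam_gt0 // divr_gt0 ?(pi_gt0 R) ?alpha1_gt0. Qed.

Let adjc g n : C := (ip (T (mono n)) g)^*%C / (gs n)%:C.

Let adjc_conj g n : (adjc g n)^*%C * (gs n)%:C = ip (T (mono n)) g.
Proof.
have -> : (adjc g n)^*%C * (gs n)%:C = (adjc g n * (gs n)%:C)^*%C by rewrite mulrC -conjMr mulrC.
by rewrite /adjc divfK ?conjcK // -cn_gt0 cn_real normr_gt0 gt_eqF.
Qed.

(** Pairing [g] with the image under [T] of the polynomial with coefficients [adjc g] returns the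
    squared norm [S] of that polynomial. Hence S <= t K S + n2 g / t, and t K <= 1/2 lets the first
    term be absorbed. *)
Let adjc_bound g : L2 g -> exists B, forall N, \sum_(k < N) cn (adjc g k) ^+ 2 * gs k <= B.
Proof.
move=> hg; pose t := (2 * (K + 1))^-1.
have K1 : 0 < K + 1 by rewrite ltr_wpDl.
have t0 : 0 < t by rewrite invr_gt0 mulr_gt0.
have tK : t * K <= 1 / 2.
  by rewrite /t mulrC ler_pdivrMr ?mulr_gt0 //; have := K0; lra.
exists (2 * (t^-1 * n2 g)) => N; set S := \sum_(k < N) _.
have hp := cpart_inA2 a1 (adjc g) N.
have S0 : 0 <= S by apply: sumr_ge0 => k _; apply: mulr_ge0 (sqr_ge0 _) (ltW (gs_gt0 _)).
have nS : n2 (fun z => cpart (adjc g) z N) = S by apply: n2_cpart.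
have : ip (T (fun z => cpart (adjc g) z N)) g = S%:C.
  rewrite ipT_cpart // rmorph_sum; apply: eq_bigr => k _ /=.
  by rewrite -adjc_conj mulrA cn_mulJ -rmorphM.
move=> /(congr1 (@cn R)); rewrite cn_real (ger0_norm S0) => SE.
have := ip_le mD t0 (TL2 hp) hg; rewrite SE.
have := ler_wpM2l (ltW t0) (Tbound hp).2; rewrite nS.
have := ler_wpM2r S0 tK; rewrite mulrA; lra.
Qed.

(** One term of the previous sum bounds |c_n|^2 by a multiple of 1 / gam n, which is [kc]; then x <=
    1 + x^2 and [growth_kc] conclude. *)
Let growth_adjc g : L2 g -> growth (adjc g).
Proof.
move=> hg; have [B HB] := adjc_bound hg.
have B0 : 0 <= B by apply: le_trans (HB 0%N); rewrite big_ord0.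
pose k0 := pi / (alpha + 1); have k00 : 0 < k0 by rewrite divr_gt0 ?(pi_gt0 R) ?alpha1_gt0.
apply: (growth_le (b := fun n => 1 + (B / k0)%:C * (kc (alpha + 2) n)%:C)); last first.
  apply: growthD; first by apply: (growth_bounded (M := 1)) => n; rewrite cn1.
  by apply: growthZ; exact: growth_kc (s_gt0 a1).
move=> n; have : cn (adjc g n) ^+ 2 * gs n <= B.
  apply: le_trans (HB n.+1); rewrite big_ord_recr /= lerDr sumr_ge0 // => k _.
  exact: mulr_ge0 (sqr_ge0 _) (ltW (gs_gt0 _)).
have kg := gamK a1 n; have kp := kc_gt0 n (s_gt0 a1); have gp := gam_gt0 a1 n.
rewrite gs1 // -/k0 => h.
have {}h : cn (adjc g n) ^+ 2 <= B / k0 * kc (alpha + 2) n.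
  have -> : B / k0 * kc (alpha + 2) n = B * (k0 * gam alpha n)^-1.
    have -> : kc (alpha + 2) n = (gam alpha n)^-1 by rewrite -[LHS](mulfK (lt0r_neq0 gp)) kg mul1r.
    by rewrite -mulrA; congr (_ * _); rewrite -invfM // mulrC.
  by rewrite ler_pdivlMr ?(mulr_gt0 k00 gp).
have -> : 1 + (B / k0)%:C * (kc (alpha + 2) n)%:C = (1 + B / k0 * kc (alpha + 2) n)%:C :> C.
  by rewrite -rmorphM -[in LHS](rmorph1 (real_complex R)) -rmorphD.
have q0 : 0 <= B / k0 * kc (alpha + 2) n.
  by apply: mulr_ge0 (ltW kp); apply: divr_ge0 B0 (ltW k00).
rewrite cn_real ger0_norm; last by lra.
have := sqr_ge0 (cn (adjc g n) - 1); rewrite sqrrB1 mulr2n; lra.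
Qed.

Lemma bounded_adjoint : exists S, is_adjoint alpha T S.
Proof.
have adjL2 g : A2 g -> growth (adjc g) /\ L2 (psum (adjc g)).
  move=> /(inA2_L2) hg; have ga := growth_adjc hg; split => //.
  by have [B HB] := adjc_bound hg; exact: L2_psum ga HB.
exists (fun g => psum (adjc g)) => f hf; have [gf nf] := adjL2 f hf.
split; [by case: (Tbound hf) | exact: psum_inA2 |].
move=> g hg; have {gf nf}[gg ng] := adjL2 g hg; have hgL := inA2_L2 hg.
have [a [ga fa ha]] := inA2_series hf.
rewrite !ipA2E; congr (_ * _).
have faD p : D p -> f (pt p) = psum a (pt p) by move=> /D_cn_pt/fa.
rewrite (eq_ip (g2 := psum (adjc g)) _ faD) //.
apply: ccvg_unique (parseval a1 ga gg ha ng).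
have -> : (fun N => \sum_(k < N) a k * (adjc g k)^*%C * (gs k)%:C) =
    (fun N => ip (T (fun z => cpart a z N)) g).
  by apply/funext => N; rewrite ipT_cpart //; apply: eq_bigr => k _; rewrite -mulrA adjc_conj.
(* Continuity of [T]: the images of the Taylor polynomials of [f], paired with [g], tend to the
   pairing of [T f] with [g]. *)
apply: (ccvg_tail (M := n2 g) a1 ga ha K0); first exact: n2_ge0.
move=> t N t0 hL; have hp := cpart_inA2 a1 a N.
have hd := inA2_comb (-1) hf hp.
rewrite cn_distC -mulN1r -ipT_comb //.
apply: le_trans (ip_le mD t0 (TL2 hd) hgL) _; rewrite lerD2r ler_pM2l //.
apply: le_trans (Tbound hd).2 _.
have E p : D p -> f (pt p) + (-1) * cpart a (pt p) N = psum a (pt p) - cpart a (pt p) N.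
  by move=> /D_cn_pt/fa ->; rewrite mulN1r.
have NE := @eq_N2 R alpha D (fun z => f z + (-1) * cpart a z N) (fun z => psum a z - cpart a z N) E.
by rewrite le_eqVlt; apply/orP; left; apply/eqP; congr (_ * fine _); exact: NE.
Qed.

End adjoint.

(** * Linear fractional maps *)

Section linear_fractional.
Variable R : realType.
Local Notation C := R[i].
Variables (a b c d : C) (r : R).
Hypothesis det : a * d - b * c != 0.
Hypothesis r0 : 0 <= r.
Hypothesis r1 : r < 1.
Hypothesis lftr : forall z : C, cn z < 1 -> c * z + d != 0 /\ cn (lft a b c d z) <= r.
Implicit Types z w : C.

(* The bound on the open disk extends to the closed disk in this division-free form, which
   rules out a pole on the unit circle since [a d - b c != 0]. *)
Let closed_bound z : cn z <= 1 -> cn (a * z + b) <= r * cn (c * z + d).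
Proof.
move=> z1; apply/ler_addgt0Pr => e e0; pose A := cn a + r * cn c.
have A0 : 0 <= A by apply: addr_ge0 => //; exact: mulr_ge0.
have eA : 0 < e + A by rewrite ltr_wpDr.
(* Multiplication by 1 - u moves [z] into the open disk, where the hypothesis applies; undoing this
   costs at most [u * A], hence at most [e]. *)
pose u := e / (e + A); have u0 : 0 < u by exact: divr_gt0.
have u1 : u <= 1 by rewrite ler_pdivrMr // mul1r lerDl.
have uA : u * A <= e.
  by rewrite mulrAC ler_pdivrMr // (ler_wpM2l (ltW e0)) // lerDr ltW.
have tz : cn ((1 - u)%:C * z) < 1.
  rewrite cnM cn_real ger0_norm ?subr_ge0 //.
  apply: (@le_lt_trans _ _ (1 - u)); last by lra.
  by rewrite ler_piMr // subr_ge0.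
have [nz] := lftr tz; rewrite /lft cnM cnV ler_pdivrMr ?cn_gt0 // => H.
have uz : cn (u%:C * z) <= u by rewrite cnM cn_real gtr0_norm // ler_piMr // ltW.
have E (p q : C) : p * z + q = p * ((1 - u)%:C * z) + q + p * (u%:C * z).
  by rewrite rmorphB rmorph1; ring.
have h1 : cn (a * z + b) <= cn (a * ((1 - u)%:C * z) + b) + cn a * u.
  by rewrite E; apply: le_trans (cnD _ _) _; rewrite lerD2l cnM (ler_wpM2l (cn_ge0 _)).
have h2 : cn (c * ((1 - u)%:C * z) + d) <= cn (c * z + d) + cn c * u.
  have -> : c * ((1 - u)%:C * z) + d = c * z + d - c * (u%:C * z) by rewrite [c * z + d]E; ring.
  by apply: le_trans (cnB _ _) _; rewrite lerD2l cnM (ler_wpM2l (cn_ge0 _)).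
have := ler_wpM2l r0 h2; rewrite mulrDr => h3.
have : u * A = cn a * u + r * (cn c * u) by rewrite /A; ring.
by move: uA h1 h3 H; lra.
Qed.

Lemma lft_den_neq0 z : cn z <= 1 -> c * z + d != 0.
Proof.
move=> z1; apply/eqP => e; have := closed_bound z1; rewrite e cn0 mulr0 => h.
have {h} : a * z + b = 0 by apply/eqP; rewrite -cn_eq0 eq_le h cn_ge0.
move=> h; move/eqP: det; apply.
have -> : a * d - b * c = a * (c * z + d) - c * (a * z + b) by ring.
by rewrite e h; ring.
Qed.

Lemma lft_le z : cn z <= 1 -> cn (lft a b c d z) <= r.
Proof.
move=> z1; rewrite /lft cnM cnV ler_pdivrMr ?closed_bound //.
by rewrite cn_gt0 lft_den_neq0.
Qed.

Lemma lft_cdiff z : cn z < 1 -> exists l, cdiff (lft a b c d) z l.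
Proof.
move=> z1; have nz := lft_den_neq0 (ltW z1); eexists.
exact: cdiffM (cdiff_affine a b z) (cdiff_comp (cdiff_affine c d z) (cdiff_inv nz)).
Qed.

(** |b / d| = |phi(0)| <= r < 1, so [b * w] cannot equal [d]. *)
Let den_neq0 w : cn w < 1 -> d - b * w != 0.
Proof.
move=> w1; have d0 : d != 0 by have := @lft_den_neq0 0; rewrite cn0 mulr0 add0r; apply.
apply/eqP => e; have := @lft_le 0; rewrite cn0 /lft !mulr0 !add0r => /(_ ler01) h.
have : cn (b / d) * cn w < 1.
  by apply: le_lt_trans r1; apply: le_trans h; rewrite ler_piMr // ltW.
rewrite -cnM; have -> : b / d * w = 1; last by rewrite cn1 ltxx.
by move: e => /eqP; rewrite subr_eq0 => /eqP e; rewrite mulrAC -e divff.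
Qed.

Lemma kreinE w : krein a b c d w = ((a * w^*%C - c) / (d - b * w^*%C))^*%C.
Proof.
rewrite /krein /lft conjM conjc_inv; congr (_ / _).
  by case: a c w => [? ?] [? ?] [? ?]; apply: eqC => /=; ring.
by case: b d w => [? ?] [? ?] [? ?]; apply: eqC => /=; ring.
Qed.

(** If q, the conjugate of sigma(w), had modulus at least 1, then 1/q would be a point of the closed
    disk at which conj(w) phi takes the value 1, against |phi| <= r < 1 there. *)
Lemma krein_lt1 w : cn w < 1 -> cn (krein a b c d w) < 1.
Proof.
move=> w1; have wJ : cn w^*%C < 1 by rewrite cn_conj.
have nz := den_neq0 wJ; rewrite kreinE cn_conj.
set q := _ / _; rewrite ltNge; apply/negP => q1.
have qn : q != 0 by rewrite -cn_gt0; apply: lt_le_trans q1.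
pose z := q^-1; have z1 : cn z <= 1 by rewrite cnV invf_le1 // (lt_le_trans ltr01).
have qz : q * z = 1 by rewrite divff.
have E : c * z + d = w^*%C * (a * z + b).
  apply/eqP; rewrite -subr_eq0; apply/eqP.
  have -> : c * z + d - w^*%C * (a * z + b) = (d - b * w^*%C) * (1 - q * z) by rewrite /q; field.
  by rewrite qz subrr mulr0.
have cd0 : 0 < cn (c * z + d) by rewrite cn_gt0 lft_den_neq0.
have := closed_bound z1; have : cn (c * z + d) = cn w * cn (a * z + b) by rewrite E cnM cn_conj.
move=> e h; have : cn (c * z + d) <= r * cn (c * z + d).
  by rewrite {1}e; apply: le_trans h; rewrite ler_piMl // ltW.
by rewrite ler_pMl // leNgt r1.
Qed.

Lemma lft_krein_mul w z : cn w < 1 -> cn z < 1 ->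
  (1 - (krein a b c d 0)^*%C * z) * (1 - w^*%C * lft a b c d z) =
  (1 - lft a b c d 0 * w^*%C) * (1 - (krein a b c d w)^*%C * z).
Proof.
move=> w1 z1; have wJ : cn w^*%C < 1 by rewrite cn_conj.
have nw := den_neq0 wJ; have nz := lft_den_neq0 (ltW z1).
have nd : d != 0 by have := @lft_den_neq0 0; rewrite cn0 mulr0 add0r; apply.
rewrite !kreinE !conjcK conjc0 /lft !mulr0 !add0r !subr0.
by field; rewrite nd nz nw.
Qed.

End linear_fractional.

(** * Bounds for the two operators and derivatives of the kernels *)

Section bounded_operators.
Variables (R : realType) (alpha : R).
Hypothesis a1 : -1 < alpha.
Local Notation C := R[i].
Local Notation TT := (measurableTypeR R * measurableTypeR R)%type.
Local Notation D := (@diskR R : set TT).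
Local Notation n2 := (n2 alpha D).
Local Notation A2 := (inA2 alpha).
Local Notation mono := (@mono R).
Implicit Types (f g : C -> C) (z w : C).

Lemma holo_cderiv_comp phi f : (forall z, cn z < 1 -> exists l, cdiff phi z l) ->
  (forall z, cn z < 1 -> cn (phi z) < 1) -> holo_disk f -> holo_disk (Dop phi f).
Proof.
move=> hphi phi1 /holo_disk_series[a ga fa]; apply: holo_diskP => z z1; have [l hl] := hphi z z1.
exists (psum (dcoef (dcoef a)) (phi z) * l).
apply: (eq_disk_cdiff z1 (g := fun x => psum (dcoef a) (phi x))).
  by move=> x x1; apply: cdiff_cderiv; apply: eq_disk_cdiff (phi1 x x1) fa (cdiff_psum ga (phi1 x x1)).
by apply: cdiff_comp hl (cdiff_psum _ (phi1 z z1)); exact: growth_dcoef.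
Qed.

(** By [cderiv_bound] the composite of f' with phi is bounded by a multiple of the norm of f;
    comparison with the constant [mono 0] turns this into a norm bound. *)
Lemma Dop_bounded phi (r : R) : r < 1 -> (forall z, cn z < 1 -> exists l, cdiff phi z l) ->
  (forall z, cn z < 1 -> cn (phi z) <= r) ->
  exists2 K : R, 0 <= K & forall f, A2 f -> A2 (Dop phi f) /\ n2 (Dop phi f) <= K * n2 f.
Proof.
move=> r1 hphi phir; have phi1 z : cn z < 1 -> cn (phi z) < 1 by move=> /phir h; exact: le_lt_trans r1.
have r0 : 0 <= r by have := phir 0; rewrite cn0 => /(_ ltr01); apply: le_trans.
have [M M0 HM] := cderiv_bound a1 r0 r1.
exists (M * n2 (mono 0)); first by apply: mulr_ge0 => //; exact: n2_ge0.
move=> f hf; have [hol _] := (inA2P alpha f).1 hf.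
have [|h1 h2] := n2_dom (c := M * n2 f) (holo_cderiv_comp hphi phi1 hol) (mono_L2 a1 0 (lexx 1)).
  by move=> z z1; rewrite /mono expr0 cn1 expr1n mulr1; apply: HM => //; exact: phir.
by split => //; apply: le_trans h2 _; rewrite mulrAC.
Qed.

Lemma Dop_lin phi f g k z : (forall z, cn z < 1 -> cn (phi z) < 1) -> A2 f -> A2 g -> cn z < 1 ->
  Dop phi (fun x => f x + k * g x) z = Dop phi f z + k * Dop phi g z.
Proof.
move=> phi1 [hf _] [hg _] z1; have p1 := phi1 z z1; apply: cdiff_cderiv.
have := cdiffD (holo_disk_cdiff hf p1) (cdiffM (cdiff_cst k _) (holo_disk_cdiff hg p1)).
by rewrite mul0r add0r.
Qed.

Lemma Toep_bounded psi (B : R) : holo_disk psi -> (forall z, cn z < 1 -> cn (psi z) <= B) ->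
  exists2 K : R, 0 <= K & forall f, A2 f -> A2 (Toep psi f) /\ n2 (Toep psi f) <= K * n2 f.
Proof.
move=> hpsi HB; exists (B ^+ 2); first exact: sqr_ge0.
move=> f hf; have [hol L2f] := (inA2P alpha f).1 hf.
apply: (n2_dom _ L2f).
  apply: holo_diskP => z z1; eexists.
  exact: cdiffM (holo_disk_cdiff hpsi z1) (holo_disk_cdiff hol z1).
move=> z z1; rewrite /Toep cnM exprMn ler_wpM2r ?sqr_ge0 //.
by apply: lerXn2r; rewrite ?nnegrE ?HB //; apply: le_trans (cn_ge0 _) (HB z z1).
Qed.

Lemma K1_holo w : cn w < 1 -> holo_disk (K1 alpha w).
Proof.
move=> w1; have [g1 _] := kerc1_growth_L2 a1 w1.
by apply: eq_holo_disk (psum_holo_disk g1) => z z1; rewrite psum_kerc1.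
Qed.

Lemma cpow_conj (u : C) (s : R) : cpow u^*%C s = (cpow u s)^*%C.
Proof.
rewrite /cpow !ReImE sqrrN mulNr atanN mulrN cosN sinN.
by apply: eqC; rewrite /= ?mulrN.
Qed.

Lemma conj_K1 w z : (K1 alpha w z)^*%C = (alpha + 2)%:C * z^*%C / cpow (1 - w * z^*%C) (alpha + 3).
Proof.
rewrite K1E conjM conjc_inv -cpow_conj conjMr; congr (_ / cpow _ _).
by case: w z => [? ?] [? ?]; apply: eqC; rewrite /=; ring.
Qed.

Lemma cderiv_kernel w z : cn w < 1 -> cn z < 1 ->
  cderiv (psum (kerc alpha w)) z = (alpha + 2)%:C * w^*%C / cpow (1 - w^*%C * z) (alpha + 3).
Proof.
move=> w1 z1; have wz := conj_mul_lt1 w1 z1.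
have gk : growth (fun n => (kc (alpha + 2) n)%:C : C) := growth_kc (s_gt0 a1).
apply: cdiff_cderiv.
apply: (eq_disk_cdiff z1 (g := fun x => psum (fun n => (kc (alpha + 2) n)%:C) (w^*%C * x + 0))).
  by move=> x x1; rewrite addr0 psum_scale // cn_conj ltW.
have wz0 : cn (w^*%C * z + 0) < 1 by rewrite addr0.
have := cdiff_comp (cdiff_affine w^*%C 0 z) (cdiff_psum gk wz0).
rewrite addr0 dcoef_kc psumZ //; last exact: growth_kc (addr_gt0 (s_gt0 a1) ltr01).
rewrite (psum_kcE (addr_gt0 (s_gt0 a1) ltr01) wz).
have -> : alpha + 2 + 1 = alpha + 3 by ring.
by rewrite mulrAC.
Qed.

End bounded_operators.

(** [lft_krein_mul] is raised to the power alpha + 3. Its four factors have the form 1 - x with |x|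
    < 1, so [cpow_mul_eq] applies; the numerators agree up to the order of the factors. *)
Lemma Toep_Dop_kernel (R : realType) (alpha : R) (a b c d : R[i]) (r : R) (w z : R[i]) :
  -1 < alpha -> a * d - b * c != 0 -> 0 <= r -> r < 1 ->
  (forall z : R[i], cn z < 1 -> c * z + d != 0 /\ cn (lft a b c d z) <= r) ->
  cn w < 1 -> cn z < 1 ->
  Toep (K1 alpha (krein a b c d 0)) (Dop (lft a b c d) (psum (kerc alpha w))) z =
  (K1 alpha (lft a b c d 0) w)^*%C * psum (kerc1 alpha (krein a b c d w)) z.
Proof.
move=> a1 det r0 r1 lftr w1 z1.
have o1 : cn (0 : R[i]) < 1 by rewrite cn0.
have phi1 x : cn x < 1 -> cn (lft a b c d x) < 1 by move=> x1; apply: le_lt_trans r1; case: (lftr x x1).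
have sig1 x : cn x < 1 -> cn (krein a b c d x) < 1 := @krein_lt1 _ _ _ _ _ _ det r0 r1 lftr x.
rewrite /Toep /Dop cderiv_kernel // ?phi1 // psum_kerc1 // ?sig1 // conj_K1 !K1E.
have p1 : cn (lft a b c d 0 * w^*%C) < 1 by have := conj_mul_lt1 w1 (phi1 0 o1); rewrite mulrC.
have H := cpow_mul_eq (alpha + 3) (Re_1B_gt0 (conj_mul_lt1 (sig1 0 o1) z1))
  (Re_1B_gt0 (conj_mul_lt1 w1 (phi1 z z1))) (Re_1B_gt0 p1) (Re_1B_gt0 (conj_mul_lt1 (sig1 w w1) z1))
  (lft_krein_mul det r0 r1 lftr w1 z1).
rewrite mulf_div H [RHS]mulf_div; congr (_ / _); ring.
Qed.

Theorem theorem6p1 (R : realType) (alpha : R) (a b c d : R[i]) :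
  -1 < alpha ->
  a * d - b * c != 0 ->
  (forall z : R[i], `|z| < 1 -> c * z + d != 0 /\ `|lft a b c d z| < 1) ->
  (exists r : R, r < 1 /\
     forall z : R[i], `|z| < 1 -> `|lft a b c d z| <= r%:C) ->
  let phi := lft a b c d in
  let sigma := krein a b c d in
  (exists Dstar Tstar : (R[i] -> R[i]) -> (R[i] -> R[i]),
      is_adjoint alpha (Dop phi) Dstar /\
      is_adjoint alpha (Toep (K1 alpha (sigma 0))) Tstar) /\
  (forall Dstar Tstar : (R[i] -> R[i]) -> (R[i] -> R[i]),
      is_adjoint alpha (Dop phi) Dstar ->
      is_adjoint alpha (Toep (K1 alpha (sigma 0))) Tstar ->
      forall f : R[i] -> R[i], inA2 alpha f ->
      forall z : R[i], `|z| < 1 ->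
        Dstar (Tstar f) z = Toep (K1 alpha (phi 0)) (Dop sigma f) z).
Proof.
move=> a1 det lft1 [r [r1 lftr]] phi sigma.
have lftrc z : cn z < 1 -> c * z + d != 0 /\ cn (lft a b c d z) <= r.
  by rewrite -norm_lt1 => z1; split; [case: (lft1 z z1) | rewrite -leC_cn; exact: lftr].
have o1 : cn (0 : R[i]) < 1 by rewrite cn0.
have r0 : 0 <= r by apply: le_trans (lftrc 0 o1).2.
have phi1 z : cn z < 1 -> cn (phi z) < 1 by move=> /lftrc[_ h]; exact: le_lt_trans r1.
have sig1 z : cn z < 1 -> cn (sigma z) < 1 := @krein_lt1 _ _ _ _ _ _ det r0 r1 lftrc z.
have phid z : cn z < 1 -> exists l, cdiff phi z l := @lft_cdiff _ _ _ _ _ _ det r0 lftrc z.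
have phir z : cn z < 1 -> cn (phi z) <= r by case/lftrc.
have [K K0 HK] := Dop_bounded a1 r1 phid phir.
have [B HB] := K1_bounded a1 (sig1 0 o1).
have [L L0 HL] := Toep_bounded alpha (K1_holo a1 (sig1 0 o1)) HB.
split.
  have [Ds HDs] := bounded_adjoint a1 K0 HK (fun f g k z => @Dop_lin _ _ phi f g k z phi1).
  have [Ts HTs] : exists Ts, is_adjoint alpha (Toep (K1 alpha (sigma 0))) Ts.
    by apply: (bounded_adjoint a1 L0 HL) => f g k z _ _ _; rewrite /Toep; ring.
  by exists Ds, Ts.
move=> Ds Ts HD HT f hf z; rewrite norm_lt1 => z1.
have [gk nk] := kerc_growth_L2 a1 z1; have hk := psum_inA2 gk nk.
have [g1 n1] := kerc1_growth_L2 a1 (sig1 z z1); have h1 := psum_inA2 g1 n1.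
have [_ hTf _] := HT f hf; have [_ hDTf _] := HD _ hTf.
have [hDk _ HDk] := HD _ hk; have [_ _ HTDk] := HT _ hDk.
(* Both adjoints are moved to the kernel side: the value at [z] becomes the conjugate of the pairing
   with [f] of the image of K_z under D_phi followed by the multiplication. *)
rewrite -(reproducing a1 hDTf z1) (ipA2_conj hk hDTf) -(HDk _ hTf) -HTDk //.
have E x : cn x < 1 -> Toep (K1 alpha (sigma 0)) (Dop phi (psum (kerc alpha z))) x =
    (K1 alpha (phi 0) z)^*%C * psum (kerc1 alpha (sigma z)) x.
  exact: Toep_Dop_kernel a1 det r0 r1 lftrc z1.
rewrite (eq_ipA2 alpha E (fun x _ => erefl (f x))).
have [hE _] := HL _ hDk; have hE' := eq_inA2 E hE.
rewrite -(ipA2_conj hE' hf) ipA2_Zr // conjcK.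
by rewrite (reproducing1 a1 hf (sig1 z z1)).
Qed.
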